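(* For every compact convex set $K\subset\mathbb{E}^3$ with volume $V$, $$\int_{P\notin K}|\Omega(P)|^{2}\,dP\ \ge\ 4\pi^2V ,$$ and equality holds if and only if $K$ is a ball.
   Context: $\mathbb{E}^3$ is Euclidean 3-space and $dP$ is Lebesgue measure on it. For $P\notin K$, the visual solid angle $\Omega(P)\subset S^2$ of $K$ from $P$ is the set of unit vectors $u$ such that the ray $\{P+tu:t\ge0\}$ meets $K$, and $|\Omega(P)|$ is its surface measure on the unit sphere $S^2$.
   Formalization: The equality characterization is stated only for K not contained in a line, with balls of positive radius: for the empty set and for segments both sides are 0 although K is not a ball; single points are excluded as well. *)

(* Defs.v *)
From HB Require Import structures.
From mathcomp Require Export all_boot all_order all_algebra.
From mathcomp Require Export all_classical all_reals all_analysis.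
Export numFieldNormedType.Exports.

Set Implicit Arguments.
Unset Strict Implicit.
Unset Printing Implicit Defensive.

Import Order.TTheory GRing.Theory Num.Theory.
Local Open Scope classical_set_scope.
Local Open Scope ring_scope.

(* Triples of reals with the product topology and the product (Borel)
   sigma-algebra.  The library norm on this type is the sup norm, which is why
   the Euclidean norm is introduced separately. *)
Notation E3 R := (R * R * R)%type.

Definition enorm (R : realType) (x : E3 R) : R :=
  Num.sqrt (x.1.1 ^+ 2 + x.1.2 ^+ 2 + x.2 ^+ 2).

Definition lebesgue3 (R : realType) :
    {measure set (measurableTypeR R * measurableTypeR R * measurableTypeR R)
       -> \bar R} :=
  ((@lebesgue_measure R \x @lebesgue_measure R) \x @lebesgue_measure R)%E.

Definition is_ball (R : realType) (K : set (E3 R)) : Prop :=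
  exists (c : E3 R) (r : R), 0 < r /\ K = [set x | enorm (x - c) <= r].

(* Includes the empty set and singletons. *)
Definition in_a_line (R : realType) (K : set (E3 R)) : Prop :=
  exists a v : E3 R, forall x, K x -> exists s : R, x = a + s *: v.

Definition solid_angle (R : realType) (K : set (E3 R)) (P : E3 R) :
    set (E3 R) :=
  [set u | enorm u = 1 /\ exists2 t : R, 0 <= t & K (P + t *: u)].

Definition sphere_point (R : realType) (a : R * R) : E3 R :=
  (sin a.1 * cos a.2, sin a.1 * sin a.2, cos a.1).

(* Surface measure of the part of A lying on the unit sphere, in the
   parametrization by colatitude a.1 and longitude a.2, whose area element is
   sin a.1 da.1 da.2. *)
Definition sphere_area (R : realType) (A : set (E3 R)) : \bar R :=
  (\int[@lebesgue_measure R \x @lebesgue_measure R]_(a in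
      (`[0%R, pi] `*` `[0%R, (2 * pi)%R]))
    (\1_A (sphere_point a) * sin a.1)%:E)%E.

(* Main.v *)
Require Import Defs.
From HB Require Import structures.
From mathcomp Require Import ring lra measurable_realfun.
(** Let G(P) be the measure of the set of lines through P that meet K, where the
    direction (1, a, b) has the density (1 + a^2 + b^2)^(-3/2), the area element of a
    hemisphere of directions; all lines through a point have measure 2 pi. If P is not
    in K, a line through P meets K on one side of P only, and so G(P) is the visual
    angle |Omega(P)| ([sphere_area_solid_angle]); if P is in K, then G(P) = 2 pi. Hence
    the integral of G^2 over space exceeds the one of the theorem by 4 pi^2 V
    ([visual_angle_integral]), and what has to be shown is that it is at least 8 pi^2 V.

    The square G(P)^2 is an integral over pairs of lines through P. Each pair spans a
    plane, and sorting the triples of a point and two lines by this plane gives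
      integral of G(P)^2 dP = integral of W(E)^2 dE
    over the planes E, given by z = k x + m y + e with the measure dk dm de; here W(E)
    is the measure of the lines in E that meet K, where the directions keep the density
    above ([integral_line_measure_sqr]). In Euclidean
    coordinates of E the number W(E) is, up to a factor that depends on (k, m) only,
    the perimeter of the section. The planar isoperimetric inequality therefore bounds
    W(E)^2 from below by 4 pi (1 + k^2 + m^2)^(-3/2) times the area of the section
    ([section_isoperimetric]). For fixed k and m the areas add up to V, and the
    remaining factor has the integral 2 pi, which gives 8 pi^2 V
    ([volume_le_line_measure]). For a ball all sections are discs, and all inequalities
    are equalities ([ball_line_measure]).

    The planar inequality is proved by the method of Knothe: the abscissas of the body
    are matched with those of the disc of the same area in such a way that equal areas
    lie to the left, and the widths of the body are compared with the derivative of an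
    explicit function of the matching ([area_le_shadow_length_disc]). The proof shows
    that equality holds for discs only.

    In the case of equality almost every plane meets K in the empty set, in a point, or
    in a disc ([ae_round_section]); such planes are dense. Let a and b be points of K
    at maximal distance. If a plane through a and b has points of K strictly on both
    sides, then nearby planes meet K close to a and close to b, and a disc in K that
    contains two points almost at the distance of a and b almost contains the disc of
    diameter a b in this plane ([separated_plane_disc]). As K is not in a line, one such
    plane exists, and then all planes through a and b are of this kind
    ([open_ball_sub]). So K contains the ball of diameter a b, and by maximality of the
    distance it is that ball ([round_body_ball]). *)

Set Implicit Arguments.
Unset Strict Implicit.
Unset Printing Implicit Defensive.
Import Order.TTheory GRing.Theory Num.Theory.
Import numFieldNormedType.Exports.
Local Open Scope classical_set_scope.
Local Open Scope ring_scope.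

(** * Measurability of projections along compact sets *)

Definition dense_seq (R : realType) (U : pseudoMetricType R) (D : nat -> U) :=
  forall (x : U) (e : R), 0 < e -> exists n, ball x e (D n).

Lemma dense_seq_real (R : realType) : exists D : nat -> R, dense_seq D.
Proof.
exists (fun n => if unpickle n is Some q then ratr q else 0 : R) => x e e0.
have /rat_in_itvoo[q] : x - e < x + e by rewrite ltrD2l gtrN.
rewrite in_itv/= => /andP[q1 q2]; exists (pickle q); rewrite pickleK.
by rewrite /ball/= ltr_distlC q1 q2.
Qed.

Lemma dense_seq_prod (R : realType) (U V : pseudoMetricType R) :
  (exists D : nat -> U, dense_seq D) -> (exists D : nat -> V, dense_seq D) ->
  exists D : nat -> (U * V)%type, dense_seq D.
Proof.
move=> [D Dd] [E Ed].
exists (fun n => if unpickle n is Some (i, j) then (D i, E j) else (D 0%N, E 0%N)).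
move=> [x y] e e0; have [i xi] := Dd x e e0; have [j yj] := Ed y e e0.
by exists (pickle (i, j)); rewrite pickleK.
Qed.

Lemma measurable_abs_lt d (R : realType) (T : measurableType d) (f : T -> R) (a : R) :
  measurable_fun setT f -> measurable [set p | `|f p| < a].
Proof.
move=> mf; rewrite -[X in measurable X]setTI.
have mF : measurable_fun setT (fun p => `|f p| < a).
  by apply: measurable_fun_ltr => //; exact: measurableT_comp.
exact: (mF measurableT [set true]).
Qed.

(** The projection along a compact factor of the zero set of a continuous
    function is again such a set; testing the equation approximately on a
    countable dense set of candidates avoids any topology on the parameters. *)
Lemma measurable_compact_exists d (R : realType) (T : measurableType d)
    (U : pseudoMetricType R) (K : set U) (Phi : T -> U -> R) :
  (exists D : nat -> U, dense_seq D) -> compact K ->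
  (forall q, measurable_fun setT (Phi^~ q)) ->
  (forall p, continuous (Phi p)) ->
  measurable [set p | exists2 X, K X & Phi p X = 0].
Proof.
move=> [D Dd] cK mPhi cPhi.
have -> : [set p | exists2 X, K X & Phi p X = 0] =
  \bigcap_n \bigcup_(j in [set j | exists2 X, K X & ball X n.+1%:R^-1 (D j)])
    [set p | `|Phi p (D j)| < n.+1%:R^-1].
  apply/seteqP; split => p /=.
    move=> [X KX PX0] n _.
    have n0 : 0 < n.+1%:R^-1 :> R by rewrite invr_gt0.
    have : \forall y \near X, `|Phi p X - Phi p y| < n.+1%:R^-1.
      by have /cvgr_dist_lt := cPhi p X; apply.
    move=> /nbhs_ballP[e /= e0 He].
    have [j Xj] := Dd X (Num.min e n.+1%:R^-1) ltac:(by rewrite lt_min e0 n0).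
    exists j => /=.
      by exists X => //; apply: le_ball Xj; rewrite ge_min lexx orbT.
    have /= := He (D j); rewrite PX0 sub0r normrN; apply.
    by apply: le_ball Xj; rewrite ge_min lexx.
  move=> H; apply: contrapT => /forall2NP NH.
  have Hcov : forall X, K X -> \forall X' \near X & n \near \oo,
      forall q, ball X' n.+1%:R^-1 q -> n.+1%:R^-1 <= `|Phi p q|.
    move=> X KX; have [//|/eqP PX] := NH X.
    have P0 : 0 < `|Phi p X| / 2 by rewrite divr_gt0// normr_gt0.
    have : \forall y \near X, `|Phi p X - Phi p y| < `|Phi p X| / 2.
      by have /cvgr_dist_lt := cPhi p X; apply.
    move=> /nbhs_ballP[e /= e0 He].
    near=> X' n.
    have XX' : ball X (e / 2) X'.
      by near: X'; apply: nbhsx_ballx; rewrite divr_gt0.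
    have ne : n.+1%:R^-1 <= e / 2.
      near: n; have := near_infty_natSinv_lt (PosNum (divr_gt0 e0 (ltr0Sn R 1))).
      by apply: filterS => n /ltW.
    have nP : n.+1%:R^-1 <= `|Phi p X| / 2.
      near: n; have := near_infty_natSinv_lt (PosNum P0).
      by apply: filterS => n /ltW.
    move=> q Xq.
    have Xq' : ball X e q.
      by rewrite (splitr e); apply: (@ball_triangle _ _ X') => //; apply: le_ball Xq.
    have /= := He q Xq' => d1.
    apply: (le_trans nP).
    have := ler_distD (Phi p q) (Phi p X) 0; rewrite !subr0.
    move: d1; lra.
  have cov := (compact_near_coveringP K).1 cK nat \oo
    (fun n X' => forall q, ball X' n.+1%:R^-1 q -> n.+1%:R^-1 <= `|Phi p q|) _ Hcov.
  have [n _ /(_ n (leqnn n)) Hn] := cov.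
  have [j /= [X KX Xj]] := H n I.
  by rewrite ltNge (Hn X KX _ Xj).
apply: bigcap_measurable => // n _; apply: bigcup_measurable => j _.
exact: measurable_abs_lt.
Unshelve. all: by end_near. Qed.

(** * Changes of variable *)

Local Open Scope ereal_scope.

Section density.
Context d (T : measurableType d) (R : realType) (mu : {measure set T -> \bar R}).
Variable w : T -> R.
Hypotheses (mw : measurable_fun setT w) (w0 : forall x, (0 <= w x)%R).

Definition density (A : set T) : \bar R := \int[mu]_(x in A) (w x)%:E.

Let density0 : density set0 = 0. Proof. exact: integral_set0. Qed.

Let density_ge0 A : 0 <= density A. Proof. by apply: integral_ge0 => x _; rewrite lee_fin. Qed.

Let density_sigma_additive : semi_sigma_additive density.
Proof.
move=> F mF tF mUF; rewrite /density ge0_integral_bigcup//; last 2 first.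
- exact/measurable_funTS/measurable_EFinP.
- by move=> x _; rewrite lee_fin.
apply: is_cvg_nneseries_cond => n _ _; apply: integral_ge0 => x _.
by rewrite lee_fin.
Qed.

HB.instance Definition _ := isMeasure.Build _ _ _ density
  density0 density_ge0 density_sigma_additive.

Definition density_measure : {measure set T -> \bar R} := density.

Import HBNNSimple.

Let integral_density_nnsfun (h : {nnsfun T >-> R}) :
  \int[density_measure]_x (h x)%:E = \int[mu]_x ((h x)%:E * (w x)%:E).
Proof.
rewrite [LHS](_ : _ = sintegral density_measure h); last exact: integralT_nnsfun.
rewrite sintegralE.
transitivity (\int[mu]_x
    (\sum_(y \in range h) (y%:E * ((\1_(h @^-1` [set y]) x)%:E * (w x)%:E)))); last first.
  apply: eq_integral => x _.
  rewrite [X in _ = X%:E * _]fimfunE -fsumEFin// ge0_mule_fsuml; last first.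
    by move=> y; exact: nnfun_muleindic_ge0.
  by apply: eq_fsbigr => y _; rewrite muleA.
have mI y : measurable_fun setT (fun x => (\1_(h @^-1` [set y]) x)%:E * (w x)%:E).
  apply: emeasurable_funM; last exact/measurable_EFinP.
  by apply/measurable_EFinP; apply: measurable_indic; exact: measurable_sfunP.
rewrite ge0_integral_fsum//; last 2 first.
- by move=> y; exact: measurable_funeM.
- move=> y x _; have h0 := nnfun_muleindic_ge0 h y x.
  by rewrite muleA mule_ge0// lee_fin.
apply: eq_fsbigr => y /[!inE] -[x _ <-]; rewrite ge0_integralZl_EFin//; last first.
  by move=> z _; rewrite mule_ge0// lee_fin.
congr (_ * _); rewrite [LHS]integral_mkcond; apply: eq_integral => z _.
by rewrite epatch_indic muleC.
Qed.

(** For simple functions this is the definition of the density; monotone limits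
    extend it. *)
Lemma ge0_integral_density (f : T -> \bar R) :
  measurable_fun setT f -> (forall x, 0 <= f x) ->
  \int[density_measure]_x f x = \int[mu]_x (f x * (w x)%:E).
Proof.
move=> mf f0; pose h := nnsfun_approx measurableT mf.
have hf x : (h n x)%:E @[n --> \oo] --> f x by exact: cvg_nnsfun_approx.
transitivity (limn (fun n => \int[density_measure]_x (h n x)%:E)).
  rewrite -monotone_convergence//.
  - by apply: eq_integral => x _; apply/esym/cvg_lim.
  - by move=> n; exact/measurable_EFinP/measurable_funP.
  - by move=> n x _; rewrite lee_fin.
  - by move=> x _ m n mn; rewrite lee_fin; exact/lefP/nd_nnsfun_approx.
have -> : (fun n => \int[density_measure]_x (h n x)%:E) =
          (fun n => \int[mu]_x ((h n x)%:E * (w x)%:E)).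
  by apply/funext => n; exact: integral_density_nnsfun.
rewrite -monotone_convergence//.
- apply: eq_integral => x _; apply/cvg_lim => //.
  exact: cvgeZr.
- move=> n; apply: emeasurable_funM; last exact/measurable_EFinP.
  exact/measurable_EFinP/measurable_funP.
- by move=> n x _; rewrite mule_ge0 ?lee_fin.
- move=> x _ m n mn; rewrite lee_wpmul2r ?lee_fin//; exact/lefP/nd_nnsfun_approx.
Qed.

End density.

(** The image of Lebesgue measure under x |-> c x + t, multiplied by |c|, gives
    intervals their length, and a measure on the line is determined by its
    values on intervals. *)
Lemma ge0_integral_affine (R : realType) (c t : R) (f : R -> \bar R) :
  c != 0%R -> measurable_fun setT f -> (forall x, 0 <= f x) ->
  \int[@lebesgue_measure R]_x f x =
  `|c|%:E * \int[@lebesgue_measure R]_x f (c * x + t)%R.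
Proof.
move=> c0 mf f0.
pose phi : measurableTypeR R -> measurableTypeR R := fun x => (c * x + t)%R.
have mphi : measurable_fun setT phi.
  by apply: measurable_funD => //; exact: measurable_funM.
pose m' := mscale (NngNum (normr_ge0 c)) (pushforward (@lebesgue_measure R) phi).
pose m : {measure set (measurableTypeR R) -> \bar R} := m' mphi.
have nc0 : (0 < `|c|)%R by rewrite normr_gt0.
have mE A : measurable A -> lebesgue_measure A = m A.
  apply: lebesgue_measure_unique => _ [[a b] _ <-] /=.
  rewrite /m /mscale/= /pushforward.
  rewrite lebesgue_measure_itv/= lte_fin.
  have [cgt|clt|ceq] := ltgtP c 0%R; last by rewrite ceq eqxx in c0.
  - have -> : phi @^-1` `]a, b]%classic = `[((b - t) / c)%R, ((a - t) / c)%R[%classic.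
      apply/seteqP; split => x /=; rewrite !in_itv/= /phi => /andP[h1 h2].
        by apply/andP; split; [rewrite ler_ndivrMr//|rewrite ltr_ndivlMr//]; lra.
      move: h1 h2; rewrite ler_ndivrMr// ltr_ndivlMr// => h1 h2.
      by apply/andP; split; lra.
    rewrite lebesgue_measure_itv/= lte_fin ltr_nM2r ?invr_lt0// ltrD2r.
    case: ifP => ab; last by rewrite mule0.
    by rewrite ltr0_norm// -!EFinB -EFinM; congr EFin; field.
  - have -> : phi @^-1` `]a, b]%classic = `]((a - t) / c)%R, ((b - t) / c)%R]%classic.
      apply/seteqP; split => x /=; rewrite !in_itv/= /phi => /andP[h1 h2].
        by apply/andP; split; [rewrite ltr_pdivrMr//|rewrite ler_pdivlMr//]; lra.
      move: h1 h2; rewrite ltr_pdivrMr// ler_pdivlMr// => h1 h2.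
      by apply/andP; split; lra.
    rewrite lebesgue_measure_itv/= lte_fin ltr_pM2r ?invr_gt0// ltrD2r.
    case: ifP => ab; last by rewrite mule0.
    by rewrite gtr0_norm// -!EFinB -EFinM; congr EFin; field.
rewrite (eq_measure_integral m) => [|A mA _]; last exact: mE.
by rewrite ge0_integral_mscale// ge0_integral_pushforward.
Qed.

Lemma integral_Cauchy_kernel_itv (R : realType) (x y : R) : (x <= y)%R ->
  \int[@lebesgue_measure R]_(a in `]x, y]) ((1 + a ^+ 2)^-1)%:E =
  (atan y - atan x)%:E.
Proof.
have cw : continuous (fun a : R => (1 + a ^+ 2)^-1)%R.
  exact: continuous_oneDsqrV.
rewrite le_eqVlt => /predU1P[->|xy].
  by rewrite set_itvoc0 integral_set0 subrr.
rewrite integral_itv_obnd_cbnd; last first.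
  apply/measurable_EFinP/measurable_funTS.
  exact: continuous_measurable_fun cw.
rewrite (continuous_FTC2 (F := atan) xy) ?EFinB//.
- exact: continuous_subspaceT.
- split.
  + by move=> a _; exact: derivable_atan.
  + exact/cvg_at_right_filter/continuous_atan.
  + exact/cvg_at_left_filter/continuous_atan.
- by move=> a _; rewrite derive1_atan.
Qed.

(** The tangent carries Lebesgue measure on ]-pi/2, pi/2[ to the measure of
    density 1 / (1 + a^2), since both give the mass atan y - atan x to ]x, y]. *)
Lemma ge0_integral_tan (R : realType) (f : R -> \bar R) :
  measurable_fun setT f -> (forall x, 0 <= f x) ->
  \int[@lebesgue_measure R]_(p in `](- (pi / 2))%R, (pi / 2)%R[) f (tan p) =
  \int[@lebesgue_measure R]_a (f a * ((1 + a ^+ 2)^-1)%:E).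
Proof.
move=> mf f0; set D : set R := `](- (pi / 2))%R, (pi / 2)%R[%classic.
have mD : measurable (D : set (measurableTypeR R)) by exact: measurable_itv.
pose w (a : R) : R := (1 + a ^+ 2)^-1%R.
have cw : continuous w.
  exact: continuous_oneDsqrV.
have mw : measurable_fun setT w by exact: continuous_measurable_fun.
have w0 a : (0 <= w a)%R by rewrite invr_ge0 addr_ge0// sqr_ge0.
rewrite -(ge0_integral_density (@lebesgue_measure R) mw w0 mf f0).
pose psi : measurableTypeR R -> measurableTypeR R := (@tan R) \_ D.
have mpsi : measurable_fun setT psi.
  apply: (measurable_restrictT (tan : measurableTypeR R -> measurableTypeR R) mD).1.
  apply: (@open_continuous_measurable_fun R D).
    by rewrite /D; apply: interval_open.
  move=> p; rewrite inE /D /= in_itv/= => pD; apply: continuous_tan.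
  by rewrite gt_eqF// cos_gt0_pihalf.
have mD1 : measurable_fun setT (\1_D : R -> R) by exact: measurable_indic.
have D10 p : (0 <= \1_D p :> R)%R by [].
pose lamD := density_measure (@lebesgue_measure R) mD1 D10.
have @m : {measure set (measurableTypeR R) -> \bar R}.
  by unshelve refine (pushforward lamD psi : {measure set _ -> \bar R}).
have mE A : measurable A -> density_measure (@lebesgue_measure R) mw w0 A = m A.
  move: A; apply: (@measure_unique _ R (measurableTypeR R) (@ocitv R)
    (fun n => `](- n%:R)%R, n%:R]%classic)) => //.
  - exact: ocitvI.
  - by move=> n; exact: is_ocitv.
  - exact: bigcup_itvT.
  - move=> _ [[x y] _ <-] /=.
    change (\int[@lebesgue_measure R]_(a in `]x, y]) (w a)%:E =
      \int[@lebesgue_measure R]_(p in psi @^-1` `]x, y]%classic) (\1_D p)%:E).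
    rewrite [RHS]integral_indic//; last first.
      by rewrite -[X in measurable X]setTI; apply: (mpsi _) => //; exact: measurable_itv.
    rewrite setIC.
    have [xy|yx] := leP x y; last first.
      rewrite set_itv_ge -?leNgt ?bnd_simp ?ltW// integral_set0.
      by rewrite preimage_set0 set0I measure0.
    rewrite integral_Cauchy_kernel_itv//.
    have -> : psi @^-1` `]x, y]%classic `&` D = `]atan x, atan y]%classic.
      apply/seteqP; split => p /=.
        rewrite /psi => -[+ pD]; rewrite patchE mem_set//= !in_itv/= => /andP[h1 h2].
        move: (pD); rewrite /D/= in_itv/= => /andP[p1 p2].
        rewrite -(tanK (x := p)) ?in_itv/= ?p1//.
        by rewrite lt_atan// le_atan.
      rewrite in_itv/= => /andP[h1 h2].
      have pD : D p.
        rewrite /D/= in_itv/= (lt_trans _ h1) ?atan_gtNpi2//=.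
        by rewrite (le_lt_trans h2) ?atan_ltpi2.
      split => //; rewrite /psi patchE mem_set//= in_itv/=.
      rewrite -(atanK x) -(atanK y) ltr_tan ?in_itv/= ?atan_gtNpi2 ?atan_ltpi2//.
      rewrite h1 /= leNgt ltr_tan ?in_itv/= ?atan_gtNpi2 ?atan_ltpi2//.
      by rewrite -leNgt.
    apply: (etrans _ (esym (@lebesgue_measure_itv R `]atan x, atan y]))).
    rewrite /= lte_fin; case: ltP => //.
    by move=> yx; have := le_atan xy => h; rewrite (@le_anti _ _ (atan y) (atan x)) ?yx ?h ?subrr.
  - move=> n.
    change (\int[@lebesgue_measure R]_(a in `](- n%:R)%R, n%:R]) (w a)%:E < +oo).
    by rewrite integral_Cauchy_kernel_itv ?ltry// (@le_trans _ _ 0%R) ?oppr_le0.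
rewrite (eq_measure_integral m) => [|A mA _]; last exact: mE.
rewrite ge0_integral_pushforward//= preimage_setT.
rewrite ge0_integral_density//=; last exact: measurableT_comp.
rewrite [LHS]integral_mkcond; apply: eq_integral => p _.
rewrite patchE /psi patchE indicE; case: ifPn => _; first by rewrite mule1.
by rewrite mule0.
Qed.

Local Close Scope ereal_scope.

(** * Explicit integrals *)

Local Open Scope ereal_scope.

Section constants.
Variable R : realType.
Local Notation mu := (@lebesgue_measure R).

Lemma sqr_sqrt1D (t : R) : (Num.sqrt (1 + t ^+ 2) ^+ 2 = 1 + t ^+ 2)%R.
Proof. by rewrite sqr_sqrtr// addr_ge0// sqr_ge0. Qed.

Lemma measurable_sqrt : measurable_fun setT (@Num.sqrt R).
Proof. by apply: continuous_measurable_fun; exact: sqrt_continuous. Qed.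

Lemma measurable_invr : measurable_fun setT (fun x : R => x^-1)%R.
Proof.
rewrite (_ : (fun x : R => x^-1)%R = (fun x => if x == 0 then 0 else x^-1)%R); last first.
  by apply/funext => x; case: ifPn => // /eqP ->; rewrite invr0.
have mN : measurable ([set~ 0%R] : set (measurableTypeR R)).
  by apply: measurableC; exact: measurable_set1.
have -> : (fun x : R => if x == 0 then 0 else x^-1)%R = (fun x : R => x^-1)%R \_ [set~ 0%R].
  apply/funext => x; rewrite patchE; case: ifPn => [/eqP ->|/eqP x0].
    by rewrite memNset//= => /(_ erefl).
  by rewrite mem_set.
apply: (measurable_restrictT (GRing.inv : measurableTypeR R -> measurableTypeR R) mN).1.
apply: (@open_continuous_measurable_fun R [set~ 0%R]).
  by apply: closed_openC; exact: compact_closed (@Rhausdorff R) (@compact_set1 _ 0%R).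
by move=> x; rewrite inE => /eqP x0; exact: inv_continuous.
Qed.

Lemma integral_Cauchy_kernel : \int[mu]_t ((1 + t ^+ 2)^-1)%:E = pi%:E.
Proof.
have := @ge0_integral_tan R (cst 1) (measurable_cst _) (fun=> lee01).
rewrite integral_cst//.
rewrite mul1e /= lebesgue_measure_itv/= lte_fin gtrN ?divr_gt0 ?pi_gt0//.
rewrite -EFinB opprK -splitr => ->.
by apply: eq_integral => t _; rewrite mul1e.
Qed.

Lemma integral_sqrt1D_N3 : \int[mu]_t ((Num.sqrt (1 + t ^+ 2)) ^- 3)%:E = 2%:E.
Proof.
have mf : measurable_fun setT (fun t : R => ((Num.sqrt (1 + t ^+ 2))^-1)%:E).
  apply/measurable_EFinP; apply: (measurableT_comp measurable_invr).
  apply: (measurableT_comp measurable_sqrt).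
  by apply: continuous_measurable_fun; exact: continuous_oneDsqr.
have := ge0_integral_tan mf.
have f0 (t : R) : 0 <= ((Num.sqrt (1 + t ^+ 2))^-1)%:E by rewrite lee_fin invr_ge0 sqrtr_ge0.
move=> /(_ f0) H.
transitivity (\int[mu]_a (((Num.sqrt (1 + a ^+ 2))^-1)%:E * ((1 + a ^+ 2)^-1)%:E)).
  apply: eq_integral => t _; rewrite -EFinM -[in X in (_ * X)%R]sqr_sqrt1D.
  by rewrite -invfM -exprS.
rewrite -{}H.
transitivity (\int[mu]_(p in `](- (pi / 2))%R, (pi / 2)%R[) (cos p)%:E).
  apply: eq_integral => p; rewrite inE/= in_itv/= => pD.
  have cp := cos_gt0_pihalf pD.
  rewrite -cos2_tan2 ?gt_eqF// -exprVn sqrtr_sqr ger0_norm ?invrK//.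
  by rewrite invr_ge0 ltW.
have mc : measurable_fun setT (fun p : R => (cos p)%:E).
  by apply/measurable_EFinP; apply: continuous_measurable_fun; exact: continuous_cos.
rewrite integral_itv_bndo_bndc; last exact: measurable_funTS.
rewrite integral_itv_obnd_cbnd; last exact: measurable_funTS.
rewrite (@continuous_FTC2 _ _ sin).
- by rewrite sinN sin_pihalf -EFinB opprK.
- by rewrite gtrN ?divr_gt0 ?pi_gt0.
- exact/continuous_subspaceT/continuous_cos.
- split.
  + by move=> a _; exact: derivable_sin.
  + exact/cvg_at_right_filter/continuous_sin.
  + exact/cvg_at_left_filter/continuous_sin.
- by move=> a _; rewrite derive1E; exact: derive_val.
Qed.

Lemma integral_sqrtD_N3 (B : R) : (0 < B)%R ->
  \int[mu]_t ((Num.sqrt (B + t ^+ 2)) ^- 3)%:E = (2 / B)%:E.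
Proof.
move=> B0; have sB : (0 < Num.sqrt B)%R by rewrite sqrtr_gt0.
have mf : measurable_fun setT (fun t : R => ((Num.sqrt (B + t ^+ 2)) ^- 3)%:E).
  apply/measurable_EFinP; apply: (measurableT_comp measurable_invr).
  apply: measurable_funX; apply: (measurableT_comp measurable_sqrt).
  by apply: measurable_funD => //; exact: measurable_funX.
have f0 (t : R) : 0 <= ((Num.sqrt (B + t ^+ 2)) ^- 3)%:E.
  by rewrite lee_fin invr_ge0 exprn_ge0// sqrtr_ge0.
rewrite (@ge0_integral_affine _ (Num.sqrt B) 0)//; last by rewrite gt_eqF.
under eq_integral => t _.
  have -> : ((Num.sqrt (B + (Num.sqrt B * t + 0) ^+ 2)) ^- 3 =
             Num.sqrt B ^- 3 * Num.sqrt (1 + t ^+ 2) ^- 3)%R.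
    rewrite addr0 exprMn sqr_sqrtr ?ltW// -{1}(mulr1 B) -mulrDr sqrtrM ?ltW//.
    by rewrite exprMn invfM.
  rewrite EFinM; over.
rewrite ge0_integralZl_EFin//.
- rewrite integral_sqrt1D_N3 gtr0_norm// -!EFinM; congr EFin.
  by rewrite -{3}(sqr_sqrtr (ltW B0)); field; rewrite gt_eqF.
- apply/measurable_EFinP; apply: (measurableT_comp measurable_invr).
  apply: measurable_funX; apply: (measurableT_comp measurable_sqrt).
  by apply: measurable_funD => //; exact: measurable_funX.
Qed.

(** This is the area of a hemisphere in central projection, where the direction
    (1, k, m) has the coordinates (k, m). *)
Lemma integral_gnomonic_density :
  \int[mu]_k \int[mu]_m ((Num.sqrt (1 + k ^+ 2 + m ^+ 2)) ^- 3)%:E = (2 * pi)%:E.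
Proof.
under eq_integral => k _.
  rewrite integral_sqrtD_N3 ?ltr_wpDr ?sqr_ge0// EFinM; over.
rewrite ge0_integralZl_EFin// ?integral_Cauchy_kernel//.
- by move=> k _; rewrite lee_fin invr_ge0 addr_ge0// sqr_ge0.
- apply/measurable_EFinP; apply: continuous_measurable_fun.
  exact: continuous_oneDsqrV.
Qed.

End constants.

Lemma ge0_integral_even_odd (R : realType) (f : R -> \bar R) :
  measurable_fun setT f -> (forall x, 0 <= f x) ->
  \int[@lebesgue_measure R]_x f x =
  \int[@lebesgue_measure R]_(x in `[0%R, +oo[) (f x + f (- x)%R).
Proof.
move=> mf f0.
have mfN : measurable_fun setT (fun x : R => f (- x)%R).
  by apply: measurableT_comp => //; exact: oppr_measurable.
rewrite ge0_integralD//; [|exact: measurable_funTS..].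
rewrite (ge0_integration_by_substitution0 mfN)//.
under [X in _ = _ + X]eq_integral do rewrite opprK.
rewrite addeC -(@integral_itv_bndo_bndc _ -oo%O 0%R); last exact: measurable_funTS.
rewrite -ge0_integral_setU//.
- by rewrite itv_setU_setT.
- exact: measurable_funTS.
- rewrite disj_set2E; apply/eqP/seteqP; split => // x [] /=; rewrite !in_itv/= andbT.
  by move=> /lt_le_trans h /h; rewrite ltxx.
Qed.

(** The nonnegative difference g - f has integral zero. *)
Lemma ge0_integral_eq_ae d (T : measurableType d) (R : realType)
    (mu : {measure set T -> \bar R}) (D : set T) (f g : T -> \bar R) :
  measurable D -> measurable_fun D f -> measurable_fun D g ->
  (forall x, D x -> 0 <= f x) -> (forall x, D x -> f x \is a fin_num) ->
  (forall x, D x -> f x <= g x) ->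
  \int[mu]_(x in D) g x <= \int[mu]_(x in D) f x ->
  \int[mu]_(x in D) f x < +oo ->
  {ae mu, forall x, D x -> g x = f x}.
Proof.
move=> mD mf mg f0 ffin fg gf foo.
have mgf : measurable_fun D (fun x => g x - f x) by exact: emeasurable_funB.
have gf0 x : D x -> 0 <= g x - f x by move=> Dx; rewrite sube_ge0 ?fg// ffin.
have : \int[mu]_(x in D) g x = \int[mu]_(x in D) f x + \int[mu]_(x in D) (g x - f x).
  rewrite -ge0_integralD//; apply: eq_integral => x; rewrite inE => Dx.
  by rewrite addeC subeK// ffin.
set I := \int[mu]_(x in D) (g x - f x) => gE.
have I0 : 0 <= I by exact: integral_ge0.
have fI : \int[mu]_(x in D) f x \is a fin_num.
  by rewrite ge0_fin_numE//; exact: integral_ge0.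
have {I0}I0 : I = 0.
  apply/eqP; rewrite eq_le I0 andbT; move: gf; rewrite gE.
  by rewrite -{2}(adde0 (\int[mu]_(x in D) f x)) leeD2lE.
have : ae_eq mu D (fun x => g x - f x) (cst 0).
  apply/ae_eq_integral_abs => //; rewrite -[RHS]I0.
  by apply: eq_integral => x; rewrite inE => Dx; rewrite gee0_abs ?gf0.
apply: filterS => x /= H Dx.
by rewrite -[LHS](@subeK _ _ (f x)) ?ffin// H// add0e.
Qed.

Local Close Scope ereal_scope.

(** * Matching areas with a disc *)

Section derivatives.
Variable R : realType.
Implicit Types (f g : R -> R) (x a b : R).

Lemma deriveC c x : is_derive x 1 (fun=> c : R) 0.
Proof. exact: is_derive_cst. Qed.

Lemma deriveD f g x a b : is_derive x 1 f a -> is_derive x 1 g b ->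
  is_derive x 1 (fun t => f t + g t) (a + b).
Proof. exact: is_deriveD. Qed.

Lemma deriveB f g x a b : is_derive x 1 f a -> is_derive x 1 g b ->
  is_derive x 1 (fun t => f t - g t) (a - b).
Proof. exact: is_deriveB. Qed.

Lemma deriveM f g x a b : is_derive x 1 f a -> is_derive x 1 g b ->
  is_derive x 1 (fun t => f t * g t) (f x * b + g x * a).
Proof. by move=> df dg; have := is_deriveM df dg. Qed.

Lemma deriveZ f x a c : is_derive x 1 f a -> is_derive x 1 (fun t => c * f t) (c * a).
Proof. by move=> df; have := is_deriveZ c df. Qed.

Lemma deriveinv f x a : f x != 0 -> is_derive x 1 f a ->
  is_derive x 1 (fun t => (f t)^-1) (- f x ^- 2 * a).
Proof. by move=> f0 df; have := is_deriveV f0 df. Qed.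

Lemma derive_sqr x : is_derive x 1 (fun t : R => t ^+ 2) (2 * x).
Proof.
have := deriveM (is_derive_id x 1) (is_derive_id x 1); rewrite mulr1 -mulr2n => h.
by rewrite mulr_natl; exact: h.
Qed.

Lemma deriveNarg f x a : is_derive (- x) 1 f a -> is_derive x 1 (fun t => f (- t)) (- a).
Proof.
by move=> df; rewrite -mulrN1; apply: (@is_derive1_comp _ f -%R).
Qed.

Lemma is_derive_continuous f x a : is_derive x 1 f a -> {for x, continuous f}.
Proof. by move=> [/derivable1_diffP/differentiable_continuous]. Qed.

End derivatives.

Section knothe.
Variable R : realType.
Local Notation mu := (@lebesgue_measure R).

Lemma sqr1D_gt0 (t : R) : 0 < 1 + t ^+ 2.
Proof. by rewrite ltr_wpDr// sqr_ge0. Qed.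

(** The part of the unit disc to the left of the abscissa - sin (atan t) has
    the area pi / 2 - halfdisc t. *)
Definition halfdisc (t : R) : R := atan t + t / (1 + t ^+ 2).

Lemma is_derive_oneDsqr (t : R) : is_derive t 1 (fun t : R => 1 + t ^+ 2) (2 * t).
Proof.
by have := deriveD (deriveC 1 t) (derive_sqr t); rewrite add0r.
Qed.

Lemma is_derive_halfdisc (t : R) :
  is_derive t 1 halfdisc (2 * (1 + t ^+ 2) ^- 2).
Proof.
have t0 : 1 + t ^+ 2 != 0 by rewrite gt_eqF// sqr1D_gt0.
have := deriveD (is_derive1_atan t)
  (deriveM (is_derive_id t 1) (deriveinv (f := fun t => 1 + t ^+ 2) t0 (is_derive_oneDsqr t))).
by move=> h; apply: is_derive_eq h _; field.
Qed.

(** The cosine of the angle whose tangent is t. *)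
Definition icos (t : R) : R := (Num.sqrt (1 + t ^+ 2))^-1.

Lemma icos_gt0 t : 0 < icos t.
Proof. by rewrite invr_gt0 sqrtr_gt0 sqr1D_gt0. Qed.

Lemma icos_sqr t : icos t ^+ 2 = (1 + t ^+ 2)^-1.
Proof. by rewrite exprVn sqr_sqrtr// ltW// sqr1D_gt0. Qed.

Lemma is_derive_icos (t : R) : is_derive t 1 icos (- t * icos t ^+ 3).
Proof.
have s0 : Num.sqrt (1 + t ^+ 2) != 0 by rewrite gt_eqF// sqrtr_gt0 sqr1D_gt0.
have ds := is_derive1_comp (g := fun t => 1 + t ^+ 2) (is_derive1_sqrt (sqr1D_gt0 t)) (is_derive_oneDsqr t).
have := deriveinv (f := fun t => Num.sqrt (1 + t ^+ 2)) s0 ds => h; apply: is_derive_eq h _.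
by rewrite /icos; field.
Qed.

Lemma is_derive_sin_atan (t : R) : is_derive t 1 (fun t => t * icos t) (icos t ^+ 3).
Proof.
have h := deriveM (is_derive_id t 1) (is_derive_icos t).
apply: is_derive_eq h _.
have e : icos t = icos t ^+ 3 * (1 + t ^+ 2).
  by rewrite exprS icos_sqr; field; rewrite gt_eqF// sqr1D_gt0.
have -> : t * (- t * icos t ^+ 3) + icos t * 1 = icos t - t ^+ 2 * icos t ^+ 3 by ring.
by rewrite {1}e; ring.
Qed.

Lemma halfdiscN (t : R) : halfdisc (- t) = - halfdisc t.
Proof. by rewrite /halfdisc atanN sqrrN opprD mulNr. Qed.

Lemma cvg_halfdisc : halfdisc t @[t --> +oo] --> (pi / 2 : R).
Proof.
rewrite -[pi / 2]addr0; apply: cvgD; first exact: cvgy_atan.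
apply/cvgrPdist_lt => e e0; near=> t.
have t0 : 0 < t by near: t; exact: nbhs_pinfty_gt.
have et : e^-1 < t by near: t; by apply: nbhs_pinfty_gt; rewrite num_real.
rewrite sub0r normrN ger0_norm ?divr_ge0 ?ltW// ?sqr1D_gt0//.
rewrite ltr_pdivrMr ?sqr1D_gt0//.
have : 1 < e * t by rewrite -ltr_pdivrMl// mulr1.
nra.
Unshelve. all: by end_near. Qed.

Lemma halfdisc_lt (t : R) : halfdisc t < pi / 2.
Proof.
have H x y : x < y -> halfdisc x < halfdisc y.
  move=> xy; have [//| |c _ /eqP] := @MVT R halfdisc (fun t => 2 * (1 + t ^+ 2) ^- 2) _ _ xy.
    by move=> z _; exact: is_derive_halfdisc.
    apply: derivable_within_continuous => z _.
    by have [] := is_derive_halfdisc z.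
  rewrite subr_eq => /eqP ->; rewrite ltrDr mulr_gt0 ?subr_gt0//.
  by rewrite mulr_gt0// invr_gt0 exprn_gt0// ltr_wpDr// sqr_ge0.
apply: (lt_le_trans (H t (t + 1) _)); first by rewrite ltrDl.
apply: (cvgr_to_ge cvg_halfdisc).
near=> z; apply/ltW/H; near: z; by apply: nbhs_pinfty_gt; rewrite num_real.
Unshelve. all: by end_near. Qed.

(** To the left of u t lies, under the graph of ell, the area that the disc of
    radius r has to the left of its abscissa - r sin (atan t); the derivative
    of u results from differentiating this equality. *)
Lemma exists_knothe_map (a b r : R) (ell : R -> R) : a < b -> 0 < r ->
  (forall x, x \in `]a, b[ -> {for x, continuous ell}) ->
  (forall x, x \in `]a, b[ -> 0 < ell x) ->
  mu.-integrable `[a, b] (EFin \o ell) ->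
  (\int[mu]_(x in `[a, b]) (ell x)%:E = (pi * r ^+ 2)%:E)%E ->
  exists u : R -> R, forall t, (u t \in `]a, b[) /\
    is_derive t 1 u (- (2 * r ^+ 2 * icos t ^+ 4 / ell (u t))).
Proof.
move=> ab r0 cell ell0 iell Iell.
pose A x := parameterized_integral mu a x ell.
have dA x : x \in `]a, b[ -> is_derive x 1 A (ell x).
  rewrite in_itv/= => /andP[ax xb].
  have [|dAx dE] := @continuous_FTC1_closed _ ell a x b xb iell ax.
    by apply: cell; rewrite in_itv/= ax.
  by apply: DeriveDef; [exact: dAx|rewrite -derive1E; exact: dE].
have cA : {within `[a, b], continuous A}.
  by apply: parameterized_integral_continuous => //; exact: ltW.
have Aa : A a = 0 by rewrite /A /parameterized_integral set_itv1 Rintegral_set1.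
have Ab : A b = pi * r ^+ 2 by rewrite /A /parameterized_integral /Rintegral Iell.
clearbody A.
have Ainc x y : a <= x -> x < y -> y <= b -> A x < A y.
  move=> ax xy yb.
  have dxy : forall z, z \in `]x, y[ -> is_derive z 1 A (ell z).
    move=> z; rewrite in_itv/= => /andP[xz zy]; apply: dA.
    by rewrite in_itv/= (le_lt_trans ax xz) (lt_le_trans zy yb).
  have cxy : {within `[x, y], continuous A}.
    by apply: continuous_subspaceW cA; apply: subset_itv; rewrite bnd_simp.
  have [c + /eqP] := MVT xy dxy cxy.
  rewrite in_itv/= => /andP[xc cy]; rewrite subr_eq => /eqP ->.
  rewrite ltrDr mulr_gt0 ?subr_gt0// ell0// in_itv/=.
  by rewrite (le_lt_trans ax xc) (lt_le_trans cy yb).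
have Ainj x y : x \in `]a, b[ -> y \in `]a, b[ -> A x = A y -> x = y.
  wlog xy : x y / x < y.
    move=> W xab yab Axy; have [xy|yx|//] := ltgtP x y; first exact: W.
    by apply/esym/W.
  rewrite !in_itv/= => /andP[ax xb] /andP[ay yb] Axy.
  by have := Ainc x y (ltW ax) xy (ltW yb); rewrite Axy ltxx.
have Asurj v : 0 < v < pi * r ^+ 2 -> exists2 x, x \in `]a, b[ & A x = v.
  move=> /andP[v0 v1]; have [|x] := @IVT R A a b v (ltW ab) cA.
    by rewrite Aa Ab minEle maxEle (ltW (lt_trans v0 v1)) !ltW.
  rewrite in_itv/= => /andP[ax xb] Axv; exists x => //.
  rewrite in_itv/= !lt_neqAle ax xb !andbT; apply/andP; split; apply/eqP => e.
    by move: v0; rewrite -Axv -e Aa ltxx.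
  by move: v1; rewrite -Axv e Ab ltxx.
pose B v := xget a [set x | (x \in `]a, b[) /\ A x = v].
have BP v : 0 < v < pi * r ^+ 2 -> (B v \in `]a, b[) /\ A (B v) = v.
  move=> /Asurj[x xab Axv].
  exact: (@xgetPex _ a [set x | (x \in `]a, b[) /\ A x = v]
    (ex_intro _ x (conj xab Axv))).
pose v t := r ^+ 2 * (pi / 2 - halfdisc t).
have v_itv t : 0 < v t < pi * r ^+ 2.
  have h1 := halfdisc_lt t; have := halfdisc_lt (- t); rewrite halfdiscN => h2.
  have r2 : 0 < r ^+ 2 by rewrite exprn_gt0.
  rewrite /v mulr_gt0 ?subr_gt0//= mulrC ltr_pM2r//; lra.
exists (B \o v) => t; have [Bt ABt] := BP _ (v_itv t).
split => //=.
have dB : is_derive (A (B (v t))) 1 B (ell (B (v t)))^-1.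
  have nB : \forall x \near B (v t), x \in `]a, b[.
    by move: Bt; rewrite in_itv/=; exact: near_in_itvoo.
  apply: is_derive_inverse.
  - near=> x.
    have xab : x \in `]a, b[ by near: x.
    have Ax : 0 < A x < pi * r ^+ 2.
      move: xab; rewrite in_itv/= => /andP[ax xb].
      by rewrite -Aa -Ab !Ainc// ltW.
    have [BAx ABAx] := BP _ Ax; exact: Ainj.
  - near=> x; have xab : x \in `]a, b[ by near: x.
    exact: is_derive_continuous (dA x xab).
  - exact: dA.
  - by rewrite gt_eqF// ell0.
rewrite ABt in dB.
have dv : is_derive t 1 v (- (2 * r ^+ 2 * icos t ^+ 4)).
  have := deriveZ (r ^+ 2) (deriveB (deriveC (pi / 2) t) (is_derive_halfdisc t)) => h.
  apply: is_derive_eq h _; rewrite sub0r mulrN; congr (- _).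
  have -> : icos t ^+ 4 = (icos t ^+ 2) ^+ 2 by rewrite -exprM.
  by rewrite icos_sqr exprVn; ring.
have := is_derive1_comp dB dv => h; apply: is_derive_eq h _.
by rewrite mulrN mulrC.
Unshelve. all: by end_near. Qed.

End knothe.

(** * Auxiliary real analysis *)

Section analysis.
Variable R : realType.
Local Notation mu := (@lebesgue_measure R).

(** Over [0, T] the integral of f is at least that of h, which is H T. If the
    limiting bound is attained, the nonnegative function f - h has integral
    zero over every bounded interval, and so it vanishes at a dense set of
    points. *)
Lemma integral_ge_antiderivative (f h H : R -> R) (l : R) :
  measurable_fun setT f -> (forall t, 0 <= f t) ->
  (forall t : R, is_derive t 1 H (h t)) -> continuous h -> H 0 = 0 ->
  (forall t, 0 <= t -> h t <= f t) -> H t @[t --> +oo] --> l ->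
  (l%:E <= \int[mu]_(t in `[0%R, +oo[) (f t)%:E)%E /\
  ((\int[mu]_(t in `[0%R, +oo[) (f t)%:E <= l%:E)%E ->
   forall a b, 0 <= a -> a < b -> exists2 t, a < t < b & f t = h t).
Proof.
move=> mf f0 dH ch H0 hf Hl.
have mfE : measurable_fun setT (EFin \o f) by exact/measurable_EFinP.
have [Ioo|] := ltP (\int[mu]_(t in `[0%R, +oo[) (f t)%:E)%E +oo%E; last first.
  by rewrite leye_eq => /eqP ->; split; [rewrite leey|rewrite leye_eq].
have fint T : mu.-integrable `[0%R, T] (EFin \o f).
  apply/integrableP; split; first exact: measurable_funTS.
  apply: le_lt_trans Ioo.
  under eq_integral do rewrite /= ger0_norm//.
  apply: ge0_subset_integral => //; first exact: measurable_funTS.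
    by move=> t _; rewrite lee_fin.
  by apply: subset_itv; rewrite bnd_simp.
have hint T : mu.-integrable `[0%R, T] (EFin \o h).
  apply: continuous_compact_integrable; first exact: segment_compact.
  exact: continuous_subspaceT.
have hI T : 0 < T -> (\int[mu]_(t in `[0%R, T]) (h t)%:E = (H T)%:E)%E.
  move=> T0; rewrite (@continuous_FTC2 _ h H)//.
  - by rewrite H0 sube0.
  - exact: continuous_subspaceT.
  - split.
    + by move=> x _; have [] := dH x.
    + exact/cvg_at_right_filter/(is_derive_continuous (dH 0)).
    + exact/cvg_at_left_filter/(is_derive_continuous (dH T)).
  - by move=> x _; rewrite derive1E; exact: (@derive_val _ _ _ _ _ _ _ (dH x)).
pose D T := (\int[mu]_(t in `[0%R, T]) ((f t)%:E - (h t)%:E))%E.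
have DE T : 0 < T -> D T = (\int[mu]_(t in `[0%R, T]) (f t)%:E - (H T)%:E)%E.
  by move=> T0; rewrite /D integralB_EFin// hI.
have D0 T : (0 <= D T)%E.
  apply: integral_ge0 => t; rewrite /= in_itv/= => /andP[t0 _].
  by rewrite -EFinB lee_fin subr_ge0 hf.
have fI T : (\int[mu]_(t in `[0%R, T]) (f t)%:E <=
             \int[mu]_(t in `[0%R, +oo[) (f t)%:E)%E.
  apply: ge0_subset_integral => //; first exact: measurable_funTS.
    by move=> t _; rewrite lee_fin.
  by apply: subset_itv; rewrite bnd_simp.
have Ifin : (\int[mu]_(t in `[0%R, +oo[) (f t)%:E)%E \is a fin_num.
  by rewrite ge0_fin_numE//; apply: integral_ge0 => t _; rewrite lee_fin.
split.
  rewrite -(fineK Ifin) lee_fin; apply: (cvgr_to_le Hl).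
  near=> T; have T0 : 0 < T by near: T; apply: nbhs_pinfty_gt; rewrite num_real.
  have := D0 T; rewrite DE// sube_ge0// => HT.
  by rewrite -lee_fin fineK//; exact: le_trans HT (fI T).
move=> Il a b a0 ab; apply: contrapT => /forall2NP Nt.
have mfh (T : R) : measurable_fun (`[0%R, T]%classic : set R) (fun t : R => ((f t)%:E - (h t)%:E)%E).
  apply: emeasurable_funB; first exact: measurable_funTS.
  by apply/measurable_EFinP/measurable_funTS; exact: continuous_measurable_fun.
have Db : D b = 0%E.
  apply/eqP; rewrite eq_le D0 andbT.
  have le0 : forall T, b <= T -> (D b <= (l - H T)%:E)%E.
    move=> T bT; have T0 : 0 < T by rewrite (lt_le_trans _ bT)// (le_lt_trans a0 ab).
    apply: (@le_trans _ _ (D T)).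
      apply: ge0_subset_integral => //; first exact: mfh.
        move=> t; rewrite /= in_itv/= => /andP[t0 _].
        by rewrite -EFinB lee_fin subr_ge0 hf.
      by apply: subset_itv; rewrite bnd_simp.
    by rewrite DE// EFinB leeB// (le_trans (fI T)).
  have Dfin : D b \is a fin_num.
    by rewrite ge0_fin_numE//; apply: le_lt_trans (le0 b (lexx _)) _; rewrite ltry.
  rewrite -(fineK Dfin) lee_fin; rewrite -(subrr l).
  have cv : (l - H t) @[t --> +oo] --> l - l by apply: cvgB => //; exact: cvg_cst.
  apply: (cvgr_to_ge cv); near=> T.
  have := le0 T _; rewrite -(fineK Dfin) lee_fin; apply.
  by near: T; apply: nbhs_pinfty_ge; rewrite num_real.
have : ae_eq mu (`[0%R, b]%classic : set R) (fun t : R => ((f t)%:E - (h t)%:E)%E) (cst 0%E).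
  apply/ae_eq_integral_abs => //; first exact: mfh.
  apply: (eq_trans _ Db); apply: eq_integral => t.
  rewrite inE/= in_itv/= => /andP[t0 _].
  by rewrite /= ger0_norm ?subr_ge0 ?hf.
move=> [N [mN N0 Nsub]].
have : (mu (`]a, b[%classic : set R) <= mu N)%E.
  apply: le_measure; rewrite ?inE//.
  move=> t /=; rewrite in_itv/= => /andP[at_ tb]; apply: Nsub => /= Hfh.
  have := Hfh; rewrite in_itv/= (ltW (le_lt_trans a0 at_)) (ltW tb) => /(_ isT).
  rewrite -EFinB => -[/eqP]; rewrite subr_eq0 => /eqP fh.
  by have [|] := Nt t; rewrite ?at_ ?tb.
rewrite N0 lebesgue_measure_itv/= lte_fin ab -EFinB lee_fin.
by rewrite subr_le0 leNgt ab.
Unshelve. all: by end_near. Qed.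

(** Chords drawn from the ends of the interval show that h is Lipschitz near x,
    with constant 2 M / d where d is half the distance from x to the ends. *)
Lemma concave_continuous (a b M : R) (h : R -> R) :
  (forall x y s, x \in `[a, b] -> y \in `[a, b] -> 0 <= s <= 1 ->
     (1 - s) * h x + s * h y <= h ((1 - s) * x + s * y)) ->
  (forall x, x \in `[a, b] -> `|h x| <= M) ->
  forall x, x \in `]a, b[ -> {for x, continuous h}.
Proof.
move=> hconc hM x; rewrite in_itv/= => /andP[ax xb].
have M0 : 0 <= M by apply: le_trans (hM x _) => //; rewrite in_itv/= !ltW.
pose d := Num.min (x - a) (b - x) / 2.
have d0 : 0 < d by rewrite divr_gt0// lt_min !subr_gt0 ax.
have dxa : d * 2 <= x - a by rewrite divfK// ge_min lexx.
have dbx : d * 2 <= b - x by rewrite divfK// ge_min lexx orbT.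
clearbody d.
have step p q s : p \in `[a, b] -> q \in `[a, b] -> 0 <= s <= 1 ->
    h p - h ((1 - s) * p + s * q) <= s * (2 * M).
  move=> pab qab s01; have := hconc p q s pab qab s01.
  have := hM p pab; have := hM q qab; rewrite !ler_norml => /andP[b1 b2] /andP[y1 y2] H.
  by move: s01 => /andP[s0 s1]; nra.
have frac u v : 0 <= u -> u <= v -> d <= v -> [/\ 0 <= u / v <= 1 & u / v <= u / d].
  move=> u0 uv dv; have v0 : 0 < v := lt_le_trans d0 dv.
  split; last by rewrite ler_wpM2l// lef_pV2.
  by rewrite ler_pdivrMr// mul1r uv andbT divr_ge0// ltW.
have key y z : a <= y -> y < z -> z <= b - d -> h y - h z <= (z - y) / d * (2 * M).
  move=> ay yz zb.
  have [||| s01 sd] := frac (z - y) (b - y); [lra..|].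
  have := step y b ((z - y) / (b - y)) _ _ s01.
  rewrite (_ : (1 - _) * y + _ = z); last by field; lra.
  move=> /(_ ltac:(by rewrite in_itv/=; lra) ltac:(by rewrite in_itv/=; lra)).
  by move=> /le_trans; apply; rewrite ler_wpM2r// mulr_ge0.
have key' y z : a + d <= y -> y < z -> z <= b -> h z - h y <= (z - y) / d * (2 * M).
  move=> ay yz zb.
  have [||| s01 sd] := frac (z - y) (z - a); [lra..|].
  have := step z a ((z - y) / (z - a)) _ _ s01.
  rewrite (_ : (1 - _) * z + _ = y); last by field; lra.
  move=> /(_ ltac:(by rewrite in_itv/=; lra) ltac:(by rewrite in_itv/=; lra)).
  by move=> /le_trans; apply; rewrite ler_wpM2r// mulr_ge0.
have lip y : `|x - y| < d -> `|h x - h y| <= `|x - y| / d * (2 * M).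
  rewrite ltr_distl => /andP[yd dy].
  have [xy|yx|->] := ltgtP x y; last by rewrite !subrr !normr0 !mul0r.
  - rewrite ler_norml (ltr0_norm (x := x - y)) ?subr_lt0// opprB.
    have := key x y; have := key' x y; lra.
  - rewrite ler_norml (gtr0_norm (x := x - y)) ?subr_gt0//.
    have := key y x; have := key' y x; lra.
apply/cvgrPdist_lt => e e0; near=> y.
have yd : `|x - y| < d by near: y; apply: (@nbhsx_ballx _ _ x d).
apply: (le_lt_trans (lip y yd)).
have : `|x - y| < e * d / (2 * M + 1).
  near: y; apply: (@nbhsx_ballx _ _ x); by rewrite divr_gt0 ?mulr_gt0 ?ltr_wpDl ?mulr_ge0.
rewrite ltr_pdivlMr; last by rewrite ltr_wpDl ?mulr_ge0.
move=> h1; rewrite mulrAC ltr_pdivrMr//; apply: le_lt_trans h1.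
by rewrite ler_wpM2l// lerDl.
Unshelve. all: by end_near. Qed.

(** The derivative vanishes everywhere. *)
Lemma cst_of_quadratic_bound (phi : R -> R) (k : R) :
  (forall x y, `|phi x - phi y| <= k * (x - y) ^+ 2) -> forall x y, phi x = phi y.
Proof.
move=> H x y; apply: is_derive_0_is_cst => z.
apply/is_derive1_caratheodory.
exists (fun w => (phi w - phi z) / (w - z)); split.
- move=> w; have [->|wz] := eqVneq w z; first by rewrite !subrr mulr0.
  by rewrite divfK// subr_eq0.
- apply/cvgrPdist_lt => e e0; near=> w.
  rewrite subrr mul0r sub0r normrN normf_div; have [->|wz] := eqVneq w z.
    by rewrite !subrr normr0 mul0r.
  rewrite ltr_pdivrMr ?normr_gt0 ?subr_eq0//; apply: (le_lt_trans (H w z)).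
  rewrite -real_normK ?num_real// expr2 mulrA ltr_pM2r ?normr_gt0 ?subr_eq0//.
  apply: (@le_lt_trans _ _ (`|k| * `|w - z|)); first by rewrite ler_wpM2r// ler_norm.
  have : `|z - w| < e / (`|k| + 1).
    by near: w; apply: (@nbhsx_ballx _ _ z); rewrite divr_gt0// ltr_wpDl.
  rewrite ltr_pdivlMr ?ltr_wpDl// distrC mulrC; apply: le_lt_trans.
  by rewrite ler_wpM2r// lerDl.
- by rewrite subrr mul0r.
Unshelve. all: by end_near. Qed.

Lemma ge0_of_dense (phi : R -> R) :
  continuous phi -> (forall a b, a < b -> exists2 t, a < t < b & 0 <= phi t) ->
  forall t, 0 <= phi t.
Proof.
move=> cphi H t; rewrite leNgt; apply/negP => phit.
have : \forall z \near t, phi z < 0 by apply: (cvgr_lt _ (cphi t)).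
move=> /nbhs_ballP[e /= e0 He].
have [z /andP[z1 z2]] := H (t - e) (t + e) ltac:(by rewrite ltrD2l gtrN).
by rewrite leNgt He// /ball/= ltr_distlC z1 z2.
Qed.

End analysis.

(** * Planar convex bodies *)

Lemma compact_argmax (R : realType) (T : topologicalType) (A : set T) (phi : T -> R) :
  compact A -> A !=set0 -> continuous phi ->
  exists2 p, A p & forall q, A q -> phi q <= phi p.
Proof.
move=> cA A0 cphi.
have cI : compact (phi @` A).
  by apply: continuous_compact => //; exact: continuous_subspaceT.
have I0 : phi @` A !=set0 by case: A0 => x Ax; exists (phi x), x.
have hs := compact_has_sup I0 cI.
have : closure (phi @` A) (sup (phi @` A)) by apply: closure_sup => //; case: hs.
rewrite -(closure_id _).1; last exact: compact_closed (@Rhausdorff R) cI.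
move=> [p Ap pE]; exists p => // q Aq; rewrite pE.
by apply: sup_upper_bound => //; exists q.
Qed.

Definition convex2 (R : realType) (C : set (R * R)) := forall p q s,
  C p -> C q -> 0 <= s <= 1 ->
  C ((1 - s) * p.1 + s * q.1, (1 - s) * p.2 + s * q.2).

Section planar_set.
Variables (R : realType) (C : set (R * R)).
Hypotheses (cC : compact C) (vC : convex2 C).
Local Notation mu := (@lebesgue_measure R).

Lemma planar_bounded : exists2 M, 0 <= M & forall x y, C (x, y) -> `|x| <= M /\ `|y| <= M.
Proof.
have [M [_ HM]] := compact_bounded cC.
exists (`|M| + 1) => [|x y Cxy]; first by rewrite addr_ge0.
have : `|(x, y)| <= `|M| + 1.
  by apply: HM => //; rewrite (le_lt_trans (ler_norm _))// ltrDl.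
by rewrite prod_normE/= ge_max => /andP.
Qed.

Lemma exists_top x : (exists y, C (x, y)) ->
  exists2 y, C (x, y) & forall y', C (x, y') -> y' <= y.
Proof.
move=> [y Cxy].
have cCx : compact (C `&` fst @^-1` [set x]).
  apply: compact_closedI => //; apply: preimage_closed.
    by move=> p _; exact: cvg_fst.
  exact: compact_closed (@Rhausdorff R) (@compact_set1 _ x).
have [||[x' y'] [Cx'y' /= xx'] ub] := compact_argmax (phi := snd) cCx.
- by exists (x, y).
- by move=> p; exact: cvg_snd.
- by subst x'; exists y' => // y'' Cxy''; apply: (ub (x, y'')).
Qed.

Lemma exists_bot x : (exists y, C (x, y)) ->
  exists2 y, C (x, y) & forall y', C (x, y') -> y <= y'.
Proof.
move=> [y Cxy].
have cCx : compact (C `&` fst @^-1` [set x]).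
  apply: compact_closedI => //; apply: preimage_closed.
    by move=> p _; exact: cvg_fst.
  exact: compact_closed (@Rhausdorff R) (@compact_set1 _ x).
have [||[x' y'] [Cx'y' /= xx'] ub] := compact_argmax (phi := fun p : R * R => - p.2) cCx.
- by exists (x, y).
- by move=> p; apply: cvgN; exact: cvg_snd.
- by subst x'; exists y' => // y'' Cxy''; have := ub (x, y'') (conj Cxy'' erefl); rewrite lerN2.
Qed.

Definition top x := xget 0 [set y | C (x, y) /\ forall y', C (x, y') -> y' <= y].
Definition bot x := xget 0 [set y | C (x, y) /\ forall y', C (x, y') -> y <= y'].
Definition chord x := top x - bot x.

Lemma topP x y : C (x, y) -> C (x, top x) /\ y <= top x.
Proof.
move=> Cxy; have [y' Cy' My'] := exists_top (ex_intro _ y Cxy).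
have [H1 H2] := @xgetPex _ 0 [set y | C (x, y) /\ forall y', C (x, y') -> y' <= y]
  (ex_intro _ y' (conj Cy' My')).
by split => //; exact: H2.
Qed.

Lemma botP x y : C (x, y) -> C (x, bot x) /\ bot x <= y.
Proof.
move=> Cxy; have [y' Cy' My'] := exists_bot (ex_intro _ y Cxy).
have [H1 H2] := @xgetPex _ 0 [set y | C (x, y) /\ forall y', C (x, y') -> y <= y']
  (ex_intro _ y' (conj Cy' My')).
by split => //; exact: H2.
Qed.

Lemma vsectionE x y : C (x, y) -> [set y' | C (x, y')] = `[bot x, top x]%classic.
Proof.
move=> Cxy; have [Ct _] := topP Cxy; have [Cb _] := botP Cxy.
apply/seteqP; split => y' /=; rewrite in_itv/=.
  by move=> Cy'; have [_ ->] := topP Cy'; have [_ ->] := botP Cy'.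
move=> /andP[by' y't]; have [tb|bt] := leP (top x) (bot x).
  have -> : y' = top x by apply/eqP; rewrite eq_le y't (le_trans tb by').
  by [].
have := vC Cb Ct (s := (y' - bot x) / (top x - bot x)).
rewrite /= (_ : (1 - _) * x + _ = x); last by ring.
rewrite (_ : (1 - _) * bot x + _ = y'); last by field; rewrite subr_eq0 gt_eqF.
apply; rewrite divr_ge0 ?subr_ge0 ?(ltW bt)//=.
by rewrite ler_pdivrMr ?subr_gt0// mul1r lerD2r.
Qed.

Lemma measure_vsection x y : C (x, y) -> mu [set y' | C (x, y')] = (chord x)%:E.
Proof.
move=> Cxy; rewrite (vsectionE Cxy).
have [_ yt] := topP Cxy; have [_ by_] := botP Cxy.
rewrite lebesgue_measure_itv/= lte_fin; case: ltP => // tb.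
by rewrite /chord (@le_anti _ _ (top x) (bot x)) ?subrr// tb (le_trans by_ yt).
Qed.

(** The intercepts of the lines of slope t that meet C, that is, the projection
    of C to the vertical axis in the direction of slope t. *)
Definition shadow t := [set v : R | exists2 p, C p & p.2 - t * p.1 - v = 0].

Lemma measurable_shadow2 :
  measurable ([set tv | shadow tv.1 tv.2] : set (measurableTypeR R * measurableTypeR R)).
Proof.
apply: (@measurable_compact_exists _ R (measurableTypeR R * measurableTypeR R)%type _ C
  (fun tv p => p.2 - tv.1 * p.1 - tv.2)) => //.
- by apply: dense_seq_prod; exact: dense_seq_real.
- move=> q; apply: measurable_funB => //; apply: measurable_funB => //.
  exact: measurable_funM.
- move=> p q; apply: cvgB; last exact: cvg_cst.
  apply: cvgB; first exact: cvg_snd.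
  by apply: cvgM; [exact: cvg_cst|exact: cvg_fst].
Qed.

Lemma measurable_shadow t : measurable (shadow t : set (measurableTypeR R)).
Proof.
have := measurable_xsection (t : measurableTypeR R) measurable_shadow2.
by congr measurable; apply/seteqP; split => v; rewrite /xsection/= inE.
Qed.

Lemma measurable_planar :
  measurable (C : set (measurableTypeR R * measurableTypeR R)).
Proof.
have := @measurable_compact_exists _ R (measurableTypeR R * measurableTypeR R)%type _ C
  (fun p q => `|p.1 - q.1| + `|p.2 - q.2|).
have -> : [set p : R * R | exists2 X, C X & `|p.1 - X.1| + `|p.2 - X.2| = 0] = C.
  apply/seteqP; split => [p /= [q Cq /eqP]|p Cp /=].
    rewrite paddr_eq0// !normr_eq0 !subr_eq0 => /andP[/eqP p1 /eqP p2].
    by rewrite (surjective_pairing p) p1 p2 -surjective_pairing.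
  by exists p => //; rewrite !subrr normr0 addr0.
apply => //.
- by apply: dense_seq_prod; exact: dense_seq_real.
- move=> q; apply: measurable_funD => //; apply: measurableT_comp => //;
  exact: measurable_funB.
- move=> p q; apply: cvgD; apply: cvg_norm; apply: cvgB; try exact: cvg_cst.
    exact: cvg_fst.
  exact: cvg_snd.
Qed.

Lemma measurable_fun_shadow : measurable_fun setT (fun t : R => mu (shadow t)).
Proof.
have := @measurable_fun_xsection _ _ (measurableTypeR R) (measurableTypeR R) R mu _ measurable_shadow2.
apply: eq_measurable_fun => t _ /=; congr (mu _).
by apply/seteqP; split => v; rewrite /xsection/= inE.
Qed.

Lemma measurable_fun_vsection : measurable_fun setT (fun x : R => mu [set y | C (x, y)]).
Proof.
have := @measurable_fun_xsection _ _ (measurableTypeR R) (measurableTypeR R) R mu _ measurable_planar.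
apply: eq_measurable_fun => t _ /=; congr (mu _).
by apply/seteqP; split => v; rewrite /xsection/= inE.
Qed.

Lemma shadow_itv t v w : shadow t v -> shadow t w -> ((w - v)%:E <= mu (shadow t))%E.
Proof.
move=> [p Cp /eqP]; rewrite subr_eq0 => /eqP <- [q Cq /eqP]; rewrite subr_eq0 => /eqP <-.
set a := p.2 - _; set b := q.2 - _.
have [ba|ab] := leP b a; first by apply: le_trans (measure_ge0 _ _); rewrite lee_fin subr_le0.
have -> : (b - a)%:E = mu (`[a, b]%classic : set R).
  by rewrite lebesgue_measure_itv/= lte_fin ab EFinB.
apply: le_measure; rewrite ?inE//; first exact: measurable_shadow.
move=> c; rewrite /= in_itv/= => /andP[ac cb].
have ba0 : 0 < b - a by rewrite subr_gt0.
exists ((1 - (c - a) / (b - a)) * p.1 + (c - a) / (b - a) * q.1,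
        (1 - (c - a) / (b - a)) * p.2 + (c - a) / (b - a) * q.2).
  apply: vC => //; rewrite divr_ge0 ?subr_ge0 ?(ltW ab)//=.
  by rewrite ler_pdivrMr// mul1r lerD2r.
rewrite /=.
transitivity ((1 - (c - a) / (b - a)) * a + (c - a) / (b - a) * b - c).
  by rewrite /a /b; ring.
by field; rewrite gt_eqF.
Qed.

Lemma shadow_fin t : (mu (shadow t) < +oo)%E.
Proof.
have [M M0 HM] := planar_bounded.
apply: (@le_lt_trans _ _ (mu (`[- (M + `|t| * M), (M + `|t| * M)]%classic : set R))).
  apply: le_measure; rewrite ?inE//; first exact: measurable_shadow.
  move=> v [[x y] Cxy /= /eqP]; rewrite subr_eq0 => /eqP <-.
  have [xM yM] := HM x y Cxy; rewrite in_itv/= -ler_norml.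
  apply: (le_trans (ler_normB _ _)); rewrite lerD// normrM ler_wpM2l//.
by rewrite lebesgue_measure_itv/=; case: ifP => // _; rewrite -EFinB ltry.
Qed.

(** [area] and [shadow_length] are iterated integrals; the second one is the
    perimeter of C when C is convex, because a line of slope t at an angle with
    cosine icos t contributes the width icos t * mu (shadow t), and the angle
    has density icos t ^+ 2 in t. *)
Definition area : \bar R := \int[mu]_x mu [set y | C (x, y)].
Definition shadow_length : \bar R :=
  \int[mu]_t ((icos t ^+ 3)%:E * mu (shadow t))%E.

Lemma planar_domain : C !=set0 -> exists a b : R, a <= b /\
  (forall x y, C (x, y) -> x \in `[a, b]) /\
  (forall x, x \in `[a, b] -> exists y, C (x, y)).
Proof.
move=> C0.
have [|[b yb] Cb ub] := compact_argmax (phi := fst) cC C0.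
  by move=> p; exact: cvg_fst.
have [|[a ya] Ca lb] := compact_argmax (phi := fun p : R * R => - p.1) cC C0.
  by move=> p; apply: cvgN; exact: cvg_fst.
have ab : a <= b by exact: (ub (a, ya)).
exists a, b; split => //; split => [x y Cxy|x].
  have /= := lb (x, y) Cxy; rewrite lerN2 in_itv/= => ->.
  exact: (ub (x, y)).
rewrite in_itv/= => /andP[ax xb]; have [ba|{}ab] := leP b a.
  have -> : x = a by apply/eqP; rewrite eq_le ax (le_trans xb ba).
  by exists ya.
have ba0 : 0 < b - a by rewrite subr_gt0.
have := vC Ca Cb (s := (x - a) / (b - a)); rewrite /=.
rewrite (_ : (1 - _) * a + _ = x); last by field; rewrite gt_eqF.
move=> H; eexists; apply: H; rewrite divr_ge0 ?subr_ge0 ?(ltW ab)//=.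
by rewrite ler_pdivrMr// mul1r lerD2r.
Qed.

Lemma top_concave x y s : (exists z, C (x, z)) -> (exists z, C (y, z)) -> 0 <= s <= 1 ->
  (1 - s) * top x + s * top y <= top ((1 - s) * x + s * y).
Proof.
move=> [zx /topP[Cx _]] [zy /topP[Cy _]] s01.
by have /topP[] := vC Cx Cy s01.
Qed.

Lemma bot_convex x y s : (exists z, C (x, z)) -> (exists z, C (y, z)) -> 0 <= s <= 1 ->
  bot ((1 - s) * x + s * y) <= (1 - s) * bot x + s * bot y.
Proof.
move=> [zx /botP[Cx _]] [zy /botP[Cy _]] s01.
by have /botP[] := vC Cx Cy s01.
Qed.

Lemma area_chord a b : (forall x y, C (x, y) -> x \in `[a, b]) ->
  (forall x, x \in `[a, b] -> exists y, C (x, y)) ->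
  (area = \int[mu]_(x in `[a, b]) (chord x)%:E)%E.
Proof.
move=> Dab Dex; rewrite [RHS]integral_mkcond; apply: eq_integral => x _.
rewrite patchE; case: ifPn => [|/negP xab].
  by rewrite inE/= => /Dex[y]; exact: measure_vsection.
rewrite (_ : [set y | C (x, y)] = set0) ?measure0//.
by apply/seteqP; split => // y /= /Dab xab'; apply: xab; rewrite inE/=.
Qed.

End planar_set.

(** * Knothe's proof of the planar isoperimetric inequality *)

Section circle_param.
Variable R : realType.
Implicit Types t x y : R.

Lemma icosN t : icos (- t) = icos t.
Proof. by rewrite /icos sqrrN. Qed.

Lemma icos_le1 t : icos t <= 1.
Proof.
by rewrite invf_le1 ?sqrtr_gt0 ?sqr1D_gt0// -{1}sqrtr1 ler_wsqrtr// lerDl sqr_ge0.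
Qed.

Lemma icos_circle t : icos t ^+ 2 + (t * icos t) ^+ 2 = 1.
Proof. by rewrite exprMn icos_sqr; field; rewrite gt_eqF// sqr1D_gt0. Qed.

Lemma continuous_icos : continuous (@icos R).
Proof. by move=> t; exact: is_derive_continuous (is_derive_icos t). Qed.

Lemma cvg_icos : icos t @[t --> +oo] --> (0 : R).
Proof.
apply/cvgrPdist_lt => e e0; near=> t.
have t0 : 0 < t by near: t; apply: nbhs_pinfty_gt; rewrite num_real.
have et : e^-1 < t by near: t; apply: nbhs_pinfty_gt; rewrite num_real.
rewrite sub0r normrN gtr0_norm ?icos_gt0//.
rewrite -(invrK e) ltf_pV2 ?posrE ?invr_gt0 ?sqrtr_gt0 ?sqr1D_gt0//.
apply: (lt_le_trans et); rewrite -{1}(gtr0_norm t0) -sqrtr_sqr.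
by rewrite ler_wsqrtr// lerDr.
Unshelve. all: by end_near. Qed.

Lemma sin_atan_lip x y : `|x * icos x - y * icos y| <= `|x - y|.
Proof.
wlog xy : x y / y < x.
  move=> W; have [xy|yx|->] := ltgtP x y; last by rewrite !subrr.
    by rewrite distrC (distrC x); exact: W.
  exact: W.
have cf : {within `[y, x], continuous (fun t => t * icos t)}.
  by apply: continuous_subspaceT => t; exact: is_derive_continuous (is_derive_sin_atan t).
have [c _ ->] := MVT xy (fun t _ => is_derive_sin_atan t) cf.
rewrite normrM ler_piMl// gtr0_norm ?exprn_gt0 ?icos_gt0//.
by rewrite exprn_ile1 ?icos_le1// ltW ?icos_gt0.
Qed.

(** The hypothesis says that the curve of height P t above the abscissa
    - r sin (atan t) lies below its line of slope t for every t, as does the circle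
    of height r icos t. Playing the inequalities for t and t' against each other bounds
    the increments of the difference quadratically, so that it is constant. *)
Lemma support_circle (r : R) (P : R -> R) : 0 <= r ->
  (forall t t', P t' - P t <= t * (r * (t * icos t) - r * (t' * icos t'))) ->
  exists c, forall t, P t = c + r * icos t.
Proof.
move=> r0 HP.
have Hc t t' : r * icos t' - r * icos t <= t * (r * (t * icos t) - r * (t' * icos t')).
  rewrite -!mulrBr mulrCA ler_wpM2l// -(ler_pM2l (icos_gt0 t)).
  have := icos_circle t; have := icos_circle t'.
  set c := icos t; set c' := icos t'; set s := t * c; set s' := t' * c' => h1 h2.
  have -> : c * (t * (s - s')) = s * (s - s') by rewrite /s; ring.
  have := sqr_ge0 (c - c'); have := sqr_ge0 (s - s'); nra.
exists (P 0 - r * icos 0) => t.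
suff H : forall x y, P x - r * icos x = P y - r * icos y by have := H 0 t; lra.
apply: (@cst_of_quadratic_bound _ _ r) => x y.
have h1 := HP x y; have h2 := HP y x; have h3 := Hc x y; have h4 := Hc y x.
have L := sin_atan_lip x y; rewrite -real_normK ?num_real//.
set sx := x * icos x in h1 h2 h3 h4 L *; set sy := y * icos y in h1 h2 h3 h4 L *.
apply: (@le_trans _ _ (`|(x - y) * (r * sx - r * sy)|)).
  have [d0|d0] := leP 0 ((x - y) * (r * sx - r * sy)).
    by rewrite (ger0_norm d0) ler_norml; apply/andP; split; nra.
  rewrite (ltr0_norm d0) ler_norml; apply/andP; split; nra.
rewrite -mulrBr !normrM (ger0_norm r0) expr2 mulrCA ler_wpM2l//.
by rewrite ler_wpM2l.
Qed.

End circle_param.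

Section planar_main.
Variables (R : realType) (C : set (R * R)).
Hypotheses (cC : compact C) (vC : convex2 C).
Local Notation mu := (@lebesgue_measure R).
Local Notation top := (top C).
Local Notation bot := (bot C).
Local Notation chord := (chord C).
Local Notation shadow := (shadow C).

(** The slopes t and -t are put together because the lower bound for the width
    in direction t involves the points above u t and u (-t), and only the sum
    of the two bounds is controlled by the chords there. *)
Definition folded_shadow (t : R) : R :=
  icos t ^+ 3 * (fine (mu (shadow t)) + fine (mu (shadow (- t)))).

Lemma measurable_folded_shadow : measurable_fun setT folded_shadow.
Proof.
have mf : measurable_fun setT (fun t : R => fine (mu (shadow t))).
  by apply: measurableT_comp => //; exact: measurable_fun_shadow.
apply: measurable_funM.
  apply: measurable_funX; apply: continuous_measurable_fun; exact: continuous_icos.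
apply: measurable_funD => //.
by apply: (measurableT_comp mf); exact: oppr_measurable.
Qed.

Lemma fine_shadow_ge0 t : 0 <= fine (mu (shadow t)).
Proof. exact/fine_ge0/measure_ge0. Qed.

Lemma folded_shadow_ge0 t : 0 <= folded_shadow t.
Proof.
by rewrite mulr_ge0 ?exprn_ge0 ?addr_ge0 ?fine_shadow_ge0// ltW ?icos_gt0.
Qed.

Lemma fineK_shadow t : (fine (mu (shadow t)))%:E = mu (shadow t).
Proof. by rewrite fineK// ge0_fin_numE ?shadow_fin. Qed.

Lemma shadow_lengthE :
  (shadow_length C = \int[mu]_(t in `[0%R, +oo[) (folded_shadow t)%:E)%E.
Proof.
rewrite /shadow_length ge0_integral_even_odd.
- apply: eq_integral => t _; rewrite icosN -(fineK_shadow t) -(fineK_shadow (- t)) -!EFinM -EFinD.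
  by rewrite /folded_shadow mulrDr.
- apply: emeasurable_funM; last exact: measurable_fun_shadow.
  apply/measurable_EFinP/measurable_funX; apply: continuous_measurable_fun.
  exact: continuous_icos.
- by move=> t; rewrite mule_ge0// lee_fin exprn_ge0// ltW ?icos_gt0.
Qed.

Lemma chord_ge0 x : (exists y, C (x, y)) -> 0 <= chord x.
Proof.
move=> [y Cxy]; have [_ yt] := topP cC Cxy; have [_ by_] := botP cC Cxy.
by rewrite subr_ge0 (le_trans by_ yt).
Qed.

(** Data of a planar convex body of positive area, as needed to run Knothe's
    argument on its vertical chords. *)
Lemma chord_data : (0 < area C)%E -> exists a b r, [/\ a < b, 0 < r,
  area C = (pi * r ^+ 2)%:E,
  (forall x, x \in `]a, b[ -> (exists y, C (x, y)) /\ 0 < chord x) &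
  [/\ (forall x, x \in `]a, b[ -> {for x, continuous top}),
   (forall x, x \in `]a, b[ -> {for x, continuous bot}),
   mu.-integrable `[a, b] (EFin \o chord) &
   (\int[mu]_(x in `[a, b]) (chord x)%:E = (pi * r ^+ 2)%:E)%E]].
Proof.
move=> area0.
have [C0|C0] := pselect (C !=set0); last first.
  exfalso; move: area0; rewrite /area integral0_eq ?ltxx// => x _.
  rewrite (_ : [set y | C (x, y)] = set0) ?measure0//.
  by apply/seteqP; split => // y Cxy; apply: C0; exists (x, y).
have [a [b [ab [Dab Dex]]]] := planar_domain cC vC C0.
have areaE := area_chord cC vC Dab Dex.
have [M M0 HM] := planar_bounded cC.
have topM x : x \in `[a, b] -> `|top x| <= M.
  by move=> /Dex[y /(topP cC)[/HM[]]].
have botM x : x \in `[a, b] -> `|bot x| <= M.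
  by move=> /Dex[y /(botP cC)[/HM[]]].
have ctop x : x \in `]a, b[ -> {for x, continuous top}.
  apply: (@concave_continuous _ a b M) => // x1 x2 s /Dex e1 /Dex e2.
  exact: top_concave.
have cbot x : x \in `]a, b[ -> {for x, continuous bot}.
  move=> xab; have cN : {for x, continuous (fun z => - bot z)}.
    apply: (@concave_continuous _ a b M) => // [x1 x2 s /Dex e1 /Dex e2 s01|z zab].
      have := bot_convex cC vC e1 e2 s01; lra.
    by rewrite normrN botM.
  have -> : bot = (fun z => - (- bot z)) by apply/funext => z; rewrite opprK.
  exact: continuousN.
have [x0 x0ab ch0] : exists2 x, x \in `[a, b] & 0 < chord x.
  apply: contrapT => /forall2NP H; move: area0; rewrite areaE integral0_eq ?ltxx//.
  move=> x; rewrite /= => xab; have [//|/negP] := H x.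
  by rewrite -leNgt => ch; congr EFin; apply: le_anti; rewrite ch chord_ge0//; exact: Dex.
have {}ab : a < b.
  rewrite lt_neqAle ab andbT; apply/eqP => e; move: area0.
  by rewrite areaE e set_itv1 integral_set1 ltxx.
have chM x : x \in `[a, b] -> `|chord x| <= 2 * M.
  move=> xab; have := topM x xab; have := botM x xab => h1 h2.
  by apply: (le_trans (ler_normB _ _)); lra.
have ichord : mu.-integrable `[a, b] (EFin \o chord).
  apply: measurable_bounded_integrable => //.
  - by rewrite /= lebesgue_measure_itv/= lte_fin ab -EFinB ltry.
  - apply: (@measurable_fun_itv_cc _ a b false true).
    apply: open_continuous_measurable_fun; first exact: interval_open.
    move=> x; rewrite inE/= => xab; apply: continuousB; [exact: ctop|exact: cbot].
  - exists (2 * M); split; first exact: num_real.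
    by move=> N MN x /= xab; apply: le_trans (ltW MN); apply: chM.
have Ifin : area C \is a fin_num by rewrite areaE; exact: integrable_fin_num.
pose r := Num.sqrt (fine (area C) / pi).
have A0 : 0 < fine (area C) by rewrite fine_gt0// area0 -ge0_fin_numE// ltW.
have rE : (pi * r ^+ 2)%:E = area C.
  rewrite sqr_sqrtr ?divr_ge0 ?ltW ?pi_gt0// mulrCA divff ?gt_eqF ?pi_gt0//.
  by rewrite mulr1 fineK.
exists a, b, r; split => //.
- by rewrite sqrtr_gt0 divr_gt0 ?pi_gt0.
- move=> x xab; have xab' : x \in `[a, b].
    by move: xab; rewrite !in_itv/= => /andP[/ltW -> /ltW ->].
  split; first exact: Dex.
  move: xab x0ab; rewrite !in_itv/= => /andP[ax xb] /andP[ax0 x0b].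
  have [z zab [s s01 xE]] : exists2 z, z \in `[a, b] &
      exists2 s, 0 <= s < 1 & x = (1 - s) * x0 + s * z.
    have [xx0|x0x] := leP x x0.
      exists a; first by rewrite in_itv/= lexx ltW.
      exists ((x0 - x) / (x0 - a)); last by field; rewrite subr_eq0 gt_eqF// (lt_le_trans ax).
      have h : 0 < x0 - a by rewrite subr_gt0 (lt_le_trans ax).
      by rewrite divr_ge0 ?subr_ge0//= ltr_pdivrMr// mul1r; lra.
    exists b; first by rewrite in_itv/= lexx ltW.
    exists ((x - x0) / (b - x0)); last by field; rewrite subr_eq0 gt_eqF// (lt_trans x0x).
    have h : 0 < b - x0 by rewrite subr_gt0 (lt_trans x0x).
    by rewrite divr_ge0 ?subr_ge0 ?(ltW x0x) ?(ltW h)//= ltr_pdivrMr// mul1r; lra.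
  have e1 : exists y, C (x0, y) by apply: Dex; rewrite in_itv/= ax0.
  have e2 := Dex z zab.
  have s01' : 0 <= s <= 1 by move: s01 => /andP[-> /ltW].
  have := top_concave cC vC e1 e2 s01'; have := bot_convex cC vC e1 e2 s01'.
  have chE w : chord w = top w - bot w by [].
  have := chord_ge0 e2; move: ch0; rewrite -xE !chE => h1 h2 h3 h4.
  by move: s01 => /andP[s0 s1]; nra.
- by split=> //; rewrite rE areaE.
Qed.

(** Knothe's argument. The top of the chord at u t and the bottom of the chord
    at u (-t) bound the shadow of slope t from below, and symmetrically for -t;
    the weighted sum of the two bounds exceeds by two squares the derivative h
    of H t = 2 icos t (u t - u (-t)) + 4 r halfdisc t, which runs from 0 to the
    length 2 pi r of the circle. If nothing is lost, the squares vanish, so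
    that the chord at u t is as long as that of the disc, which determines u;
    moreover the tops and bottoms are the points of contact of the supporting
    lines, so that they run along a circle. *)
Lemma area_le_shadow_length_disc : (0 < area C)%E -> exists r, [/\ 0 < r,
  area C = (pi * r ^+ 2)%:E, ((2 * pi * r)%:E <= shadow_length C)%E &
  (shadow_length C <= (2 * pi * r)%:E)%E -> exists xc yc,
    (forall x y, (x - xc) ^+ 2 + (y - yc) ^+ 2 < r ^+ 2 -> C (x, y)) /\
    (forall x y, C (x, y) -> (x - xc) ^+ 2 + (y - yc) ^+ 2 <= r ^+ 2)].
Proof.
move=> /chord_data[a [b [r [ab r0 areaE Dch [ctop cbot ichord Ichord]]]]].
have cchord x : x \in `]a, b[ -> {for x, continuous chord}.
  by move=> xab; apply: continuousB; [exact: ctop|exact: cbot].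
have [u uP] := exists_knothe_map ab r0 cchord (fun x xab => (Dch x xab).2) ichord Ichord.
have uab t : u t \in `]a, b[ by have [] := uP t.
pose l t := chord (u t).
have l0 t : 0 < l t by have [_] := Dch _ (uab t).
pose du t := - (2 * r ^+ 2 * icos t ^+ 4 / l t).
have dtu (t : R) : is_derive t 1 u (du t) by have [] := uP t.
have cu : continuous u by move=> t; exact: is_derive_continuous (dtu t).
have cl : continuous l by move=> t; apply: (@continuous_comp _ _ _ u chord); [exact: cu|exact: cchord].
have ct : continuous (fun t => top (u t)).
  by move=> t; apply: (@continuous_comp _ _ _ u top); [exact: cu|exact: ctop].
have cb : continuous (fun t => bot (u t)).
  by move=> t; apply: (@continuous_comp _ _ _ u bot); [exact: cu|exact: cbot].
have Ctop t : C (u t, top (u t)).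
  by have [[y Cy] _] := Dch _ (uab t); have [] := topP cC Cy.
have Cbot t : C (u t, bot (u t)).
  by have [[y Cy] _] := Dch _ (uab t); have [] := botP cC Cy.
pose f := folded_shadow.
pose w t := u t - u (- t).
pose H t := 2 * (icos t * w t) + 4 * r * halfdisc t.
pose h t := 2 * (icos t * (du t + du (- t)) + w t * (- t * icos t ^+ 3)) +
            4 * r * (2 * (1 + t ^+ 2) ^- 2).
have dw (t : R) : is_derive t 1 w (du t + du (- t)).
  have := deriveB (dtu t) (deriveNarg (dtu (- t))) => d.
  by apply: is_derive_eq d _; rewrite opprK.
have dH (t : R) : is_derive t 1 H (h t).
  apply: deriveD; last by apply: deriveZ; exact: is_derive_halfdisc.
  by apply: deriveZ; apply: deriveM => //; exact: is_derive_icos.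
(* Completing squares: each chord length l enters as l + (2 r icos t) ^ 2 / l. *)
pose j t := icos t ^+ 3 * (l t + l (- t) - 2 * t * w t).
have jh t : j t = h t + icos t ^+ 3 / l t * (l t - 2 * r * icos t) ^+ 2
                + icos t ^+ 3 / l (- t) * (l (- t) - 2 * r * icos t) ^+ 2.
  rewrite /j /h /du icosN.
  have -> : (1 + t ^+ 2) ^- 2 = icos t ^+ 4.
    have -> : icos t ^+ 4 = (icos t ^+ 2) ^+ 2 by rewrite -exprM.
    by rewrite icos_sqr exprVn.
  field.
  by rewrite !gt_eqF// ?l0.
have sq0 t : 0 <= icos t ^+ 3 / l t * (l t - 2 * r * icos t) ^+ 2.
  by rewrite mulr_ge0 ?sqr_ge0// divr_ge0 ?exprn_ge0// ltW ?icos_gt0.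
have sq0' t : 0 <= icos t ^+ 3 / l (- t) * (l (- t) - 2 * r * icos t) ^+ 2.
  by have := sq0 (- t); rewrite icosN.
have sh t v v' : shadow t v -> shadow t v' -> v' - v <= fine (mu (shadow t)).
  by move=> tv tw; rewrite -lee_fin fineK_shadow; exact: shadow_itv.
have sht t x y : C (x, y) -> shadow t (y - t * x).
  by move=> Cxy; exists (x, y) => //=; rewrite subrr.
have fj t : j t <= f t.
  rewrite /j /f /folded_shadow ler_wpM2l ?exprn_ge0 ?(ltW (icos_gt0 _))//.
  have := sh t _ _ (sht t _ _ (Cbot (- t))) (sht t _ _ (Ctop t)).
  have := sh (- t) _ _ (sht (- t) _ _ (Cbot t)) (sht (- t) _ _ (Ctop (- t))).
  have lE z : l z = top (u z) - bot (u z) by [].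
  rewrite !lE /w; lra.
have hf t : h t <= f t.
  by apply: le_trans (fj t); rewrite jh; have := sq0 t; have := sq0' t; lra.
have Hl : H t @[t --> +oo] --> 2 * pi * r.
  have -> : 2 * pi * r = 2 * 0 + 4 * r * (pi / 2) by field.
  apply: cvgD; last by apply: cvgM; [exact: cvg_cst|exact: cvg_halfdisc].
  apply: cvgM; first exact: cvg_cst.
  apply/cvgrPdist_lt => e e0; near=> t.
  have wab : `|w t| <= b - a.
    have := uab t; have := uab (- t); rewrite !in_itv/= => /andP[? ?] /andP[? ?].
    by rewrite ler_norml /w; apply/andP; split; lra.
  have : `|0 - icos t| < e / (b - a).
    near: t; have /cvgrPdist_lt := @cvg_icos R; apply.
    by rewrite divr_gt0// subr_gt0.
  rewrite !sub0r !normrN normrM ltr_pdivlMr ?subr_gt0//; apply: le_lt_trans.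
  by rewrite ler_wpM2l.
have cicos n : continuous (fun t : R => icos t ^+ n).
  move=> t; apply: (@continuous_comp _ _ _ (@icos R) (fun x => x ^+ n)).
    exact: continuous_icos.
  exact: exprn_continuous.
have cdu : continuous du.
  move=> t; apply: cvgN; apply: cvgM; first by apply: cvgM; [exact: cvg_cst|exact: cicos].
  by apply: cvgV; [rewrite gt_eqF|exact: cl].
have coppr (g : R -> R) : continuous g -> continuous (fun t => g (- t)).
  by move=> cg t; apply: (@continuous_comp _ _ _ -%R g); [exact: opp_continuous|exact: cg].
have ch : continuous h.
  have h2 (t : R) : 2 * (1 + t ^+ 2) ^- 2 = 2 * icos t ^+ 4.
    have -> : icos t ^+ 4 = (icos t ^+ 2) ^+ 2 by rewrite -exprM.
    by rewrite icos_sqr exprVn.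
  rewrite /h; under eq_fun do rewrite h2.
  move=> t; apply: cvgD; last first.
    by apply: cvgM; [exact: cvg_cst|apply: cvgM; [exact: cvg_cst|exact: cicos]].
  apply: cvgM; first exact: cvg_cst.
  apply: cvgD; apply: cvgM.
  - exact: continuous_icos.
  - by apply: cvgD; [exact: cdu|exact: (coppr _ cdu)].
  - by apply: cvgB; [exact: cu|exact: (coppr _ cu)].
  - by apply: cvgM; [apply: cvgN; exact: cvg_id|exact: cicos].
have H0 : H 0 = 0.
  by rewrite /H /w oppr0 subrr mulr0 /halfdisc atan0 !mul0r addr0 !mulr0 addr0.
have [Lge Leq] := integral_ge_antiderivative measurable_folded_shadow
  folded_shadow_ge0 dH ch H0 (fun t _ => hf t) Hl.
exists r; split => //; first by rewrite shadow_lengthE.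
rewrite shadow_lengthE => /Leq {Leq}Leq.
(* Slopes at which both squares vanish and both shadows end at the chosen points. *)
pose good t := [/\ l t = 2 * r * icos t, l (- t) = 2 * r * icos t &
  forall x y, C (x, y) ->
   [/\ bot (u (- t)) - t * u (- t) <= y - t * x, y - t * x <= top (u t) - t * u t,
      bot (u t) + t * u t <= y + t * x & y + t * x <= top (u (- t)) + t * u (- t)]].
have goodN t : good t -> good (- t).
  move=> [g1 g2 g3]; rewrite /good icosN opprK; split=> // x y Cxy.
  by have [k1 k2 k3 k4] := g3 x y Cxy; rewrite !mulNr !opprK.
have gooddense p q : p < q -> exists2 t, p < t < q & good t.
  wlog q0 : p q / 0 < q.
    move=> W pq; have [q0|q0] := ltP 0 q; first exact: W.
    have [||t /andP[t1 t2] gt] := W (- q) (- p); [lra..|].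
    by exists (- t); [apply/andP; split; lra|exact: goodN].
  move=> pq; have m0 : 0 <= Num.max p 0 by rewrite le_max lexx orbT.
  have mq : Num.max p 0 < q by rewrite gt_max pq.
  have [t /andP[t1 t2] ft] := Leq (Num.max p 0) q m0 mq.
  have tpq : p < t < q by rewrite (le_lt_trans _ t1) ?t2// le_max lexx.
  exists t => //.
  have ic3 : 0 < icos t ^+ 3 by rewrite exprn_gt0// icos_gt0.
  have sqE z : 0 < z -> icos t ^+ 3 / z * (z - 2 * r * icos t) ^+ 2 = 0 ->
      z = 2 * r * icos t.
    move=> z0 /eqP; rewrite mulf_eq0 gt_eqF ?divr_gt0//= sqrf_eq0 subr_eq0.
    by move=> /eqP.
  have := fj t; rewrite -/f in ft; rewrite ft jh => ft1.
  have s1 := sq0 t; have s2 := sq0' t.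
  have fjE : f t = j t by rewrite ft jh; lra.
  split; [by apply: sqE => //; lra|by apply: sqE => //; lra|].
  have {}fjE : fine (mu (shadow t)) + fine (mu (shadow (- t))) = l t + l (- t) - 2 * t * w t.
    by apply: (@mulfI _ (icos t ^+ 3)); rewrite ?gt_eqF.
  have lE z : l z = top (u z) - bot (u z) by [].
  rewrite !lE /w in fjE.
  move=> x y Cxy.
  have a1 := sh t _ _ (sht t _ _ (Cbot (- t))) (sht t _ _ (Ctop t)).
  have a2 := sh (- t) _ _ (sht (- t) _ _ (Cbot t)) (sht (- t) _ _ (Ctop (- t))).
  have b1 := sh t _ _ (sht t _ _ (Cbot (- t))) (sht t _ _ Cxy).
  have b2 := sh t _ _ (sht t _ _ Cxy) (sht t _ _ (Ctop t)).
  have b3 := sh (- t) _ _ (sht (- t) _ _ Cxy) (sht (- t) _ _ (Ctop (- t))).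
  have b4 := sh (- t) _ _ (sht (- t) _ _ (Cbot t)) (sht (- t) _ _ Cxy).
  by split; lra.
have lE t : l t = 2 * r * icos t.
  have [h1 h2] : 0 <= l t - 2 * r * icos t /\ 0 <= 2 * r * icos t - l t; last lra.
  have cr : continuous (fun t : R => 2 * r * icos t).
    by move=> z; apply: cvgM; [exact: cvg_cst|exact: continuous_icos].
  split; move: t; apply: ge0_of_dense.
  - by move=> z; apply: cvgB; [exact: cl|exact: cr].
  - by move=> p q /gooddense[t tpq [g1 _ _]]; exists t => //; rewrite /= g1 subrr.
  - by move=> z; apply: cvgB; [exact: cr|exact: cl].
  - by move=> p q /gooddense[t tpq [g1 _ _]]; exists t => //; rewrite /= g1 subrr.
have ctu : continuous (fun t : R => t * u t).
  by move=> t; apply: cvgM; [exact: cvg_id|exact: cu].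
have clin x y : continuous (fun t : R => y - t * x).
  by move=> t; apply: cvgB; [exact: cvg_cst|apply: cvgM; [exact: cvg_id|exact: cvg_cst]].
have uptop t x y : C (x, y) -> y - t * x <= top (u t) - t * u t.
  move=> Cxy; rewrite -subr_ge0; move: t; apply: ge0_of_dense => [z|p q].
    by apply: cvgB; [apply: cvgB; [exact: ct|exact: ctu]|exact: clin].
  by move=> /gooddense[t tpq [_ _ /(_ x y Cxy)[_ h2 _ _]]]; exists t; rewrite ?subr_ge0.
have lobot t x y : C (x, y) -> bot (u (- t)) - t * u (- t) <= y - t * x.
  move=> Cxy; rewrite -subr_ge0; move: t; apply: ge0_of_dense => [z|p q].
    apply: cvgB; first exact: clin.
    apply: cvgB; first exact: (coppr (fun t => bot (u t)) cb).
    by apply: cvgM; [exact: cvg_id|exact: (coppr u cu)].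
  by move=> /gooddense[t tpq [_ _ /(_ x y Cxy)[h1 _ _ _]]]; exists t; rewrite ?subr_ge0.
have [xc uE] : exists xc, forall t, u t = xc - r * (t * icos t).
  exists (u 0) => t.
  suff H1 : forall x y, u x + r * (x * icos x) = u y + r * (y * icos y).
    by have := H1 t 0; rewrite mul0r mulr0 addr0; lra.
  move=> x y; apply: (@is_derive_0_is_cst R (fun z => u z + r * (z * icos z))) => z.
  have d := deriveD (dtu z) (deriveZ r (is_derive_sin_atan z)).
  apply: is_derive_eq d _; rewrite /du lE; field.
  by rewrite !gt_eqF ?icos_gt0.
have [yc topE] : exists c, forall t, top (u t) = c + r * icos t.
  apply: support_circle; first exact: ltW.
  move=> t t'; have := uptop t _ _ (Ctop t'); rewrite !uE -!uE; rewrite (uE t) (uE t'); lra.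
have [c botE] : exists c, forall t, - bot (u (- t)) = c + r * icos t.
  apply: support_circle; first exact: ltW.
  move=> t t'; have := lobot t _ _ (Cbot (- t')).
  rewrite (uE (- t)) (uE (- t')) !icosN !mulNr; lra.
have cE : c = - yc.
  have := lE 0; have := topE 0; have := botE 0; rewrite oppr0.
  have -> : l 0 = top (u 0) - bot (u 0) by []; lra.
exists xc, yc; split => x y.
- set X := x - xc; set Y := y - yc => XYr.
  (* The slope t for which u t = x. *)
  have rX : 0 < r ^+ 2 - X ^+ 2 by have := sqr_ge0 Y; lra.
  pose q := Num.sqrt (r ^+ 2 - X ^+ 2); pose t := - X / q.
  have q0 : 0 < q by rewrite sqrtr_gt0.
  have qE : q ^+ 2 = r ^+ 2 - X ^+ 2 by rewrite sqr_sqrtr// ltW.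
  have icE : icos t = q / r.
    rewrite /icos; have -> : 1 + t ^+ 2 = (r / q) ^+ 2.
      by rewrite /t !expr_div_n sqrrN qE; field; rewrite gt_eqF.
    by rewrite sqrtr_sqr gtr0_norm ?divr_gt0// invf_div.
  have utE : u t = x.
    by rewrite uE icE /t /X; field; rewrite !gt_eqF.
  have Cx := Ctop t; have := vsectionE cC vC Cx; rewrite utE => vE.
  have : [set y' | C (x, y')] y; last by [].
  rewrite vE/= in_itv/= -utE topE.
  have -> : bot (u t) = yc - r * icos t.
    by have := botE (- t); rewrite opprK icosN cE; lra.
  rewrite icE (_ : r * (q / r) = q); last by field; rewrite gt_eqF.
  have : `|Y| <= q.
    rewrite -(ler_pXn2r (n := 2)) ?nnegrE ?normr_ge0 ?(ltW q0)//.
    by rewrite real_normK ?num_real// qE; lra.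
  by rewrite ler_norml /Y => /andP[h1 h2]; apply/andP; split; lra.
- move=> Cxy; set X := x - xc; set Y := y - yc.
  have key t : (Y - t * X) ^+ 2 <= r ^+ 2 * (1 + t ^+ 2).
    have hh : `|(Y - t * X) * icos t| <= r.
      rewrite normrM (gtr0_norm (icos_gt0 t)).
      have h1 := uptop t _ _ Cxy; have h2 := lobot t _ _ Cxy.
      rewrite topE uE in h1.
      have bE : bot (u (- t)) = yc - r * icos t by have := botE t; lra.
      rewrite bE (uE (- t)) icosN in h2.
      have ci := icos_circle t; have i0 := icos_gt0 t.
      have : `|Y - t * X| <= r * (icos t + t * (t * icos t)).
        by rewrite ler_norml /X /Y; apply/andP; split; lra.
      move=> /(ler_wpM2r (ltW i0)) => k; apply: (le_trans k).
      rewrite -[leRHS]mulr1 -ci; lra.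
    have := ler_pM (normr_ge0 _) (normr_ge0 _) hh hh.
    rewrite -!expr2 real_normK ?num_real// exprMn icos_sqr ler_pdivrMr ?sqr1D_gt0//.
  have [Y0|Y0] := eqVneq Y 0.
    rewrite Y0 expr0n addr0 leNgt; apply/negP => rX.
    (* A slope large enough for the line through (X, 0) to miss the disc. *)
    pose d := X ^+ 2 - r ^+ 2; have d0 : 0 < d by rewrite /d; lra.
    have := key (r ^+ 2 / d + 1); rewrite Y0 sub0r sqrrN exprMn.
    have t1 : 1 <= r ^+ 2 / d + 1 by rewrite lerDr divr_ge0 ?sqr_ge0// ltW.
    have : (r ^+ 2 / d + 1) * d = r ^+ 2 + d by field; rewrite gt_eqF.
    set t := _ / d + 1 in t1 *; rewrite /d in d0 *; nra.
  have N0 : 0 < X ^+ 2 + Y ^+ 2 by rewrite ltr_wpDl ?sqr_ge0// exprn_even_gt0.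
  (* The line through (X, Y) tangent to the circle around the centre through it. *)
  have := key (- X / Y).
  have -> : Y - - X / Y * X = (X ^+ 2 + Y ^+ 2) / Y by field.
  have -> : 1 + (- X / Y) ^+ 2 = (X ^+ 2 + Y ^+ 2) / Y ^+ 2 by field.
  rewrite expr_div_n mulrA ler_pM2r ?invr_gt0 ?exprn_even_gt0//.
  by rewrite expr2 ler_pM2r.
Unshelve. all: by end_near. Qed.

End planar_main.

Section planar_isoperimetry.
Variables (R : realType) (C : set (R * R)).
Hypotheses (cC : compact C) (vC : convex2 C).
Local Notation mu := (@lebesgue_measure R).

Lemma area_ge0 : (0 <= area C)%E.
Proof. exact: integral_ge0. Qed.

Lemma shadow_length_ge0 : (0 <= shadow_length C)%E.
Proof.
apply: integral_ge0 => t _; rewrite mule_ge0// lee_fin exprn_ge0// ltW//.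
exact: icos_gt0.
Qed.

Lemma planar_isoperimetric_inequality :
  ((4 * pi)%:E * area C <= shadow_length C ^+ 2)%E.
Proof.
have := area_ge0; rewrite le_eqVlt => /predU1P[<-|].
  by rewrite mule0 sqre_ge0.
move=> /(area_le_shadow_length_disc cC vC)[r [r0 -> Lr _]].
have -> : ((4 * pi)%:E * (pi * r ^+ 2)%:E = (2 * pi * r)%:E ^+ 2)%E.
  by rewrite -EFinM -EFin_expe; congr EFin; ring.
rewrite lee_sqr ?shadow_length_ge0// lee_fin.
by rewrite !mulr_ge0 ?pi_ge0// ltW.
Qed.

(** Almost every shadow is then a null interval, so p and q have equal
    projections in two different directions. *)
Lemma shadow_length0 : shadow_length C = 0%E -> forall p q, C p -> C q -> p = q.
Proof.
move=> L0 [px py] [qx qy] Cp Cq.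
have mf : measurable_fun setT (fun t : R => (icos t ^+ 3)%:E * mu (shadow C t))%E.
  apply: emeasurable_funM; last exact: measurable_fun_shadow.
  apply/measurable_EFinP/measurable_funX; apply: continuous_measurable_fun.
  exact: continuous_icos.
have f0 t : (0 <= (icos t ^+ 3)%:E * mu (shadow C t))%E.
  by rewrite mule_ge0// lee_fin exprn_ge0// ltW// icos_gt0.
have [N [mN N0 Nsub]] : ae_eq mu setT (fun t => (icos t ^+ 3)%:E * mu (shadow C t))%E (cst 0%E).
  apply/ae_eq_integral_abs => //; apply: (eq_trans _ L0).
  by apply: eq_integral => t _; rewrite gee0_abs.
have key (a : R) : exists2 t, a < t < a + 1 & py - t * px = qy - t * qx.
  apply: contrapT => /forall2NP H.
  have : (mu (`]a, (a + 1)%R[%classic : set R) <= mu N)%E.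
    apply: le_measure; rewrite ?inE// => t /=; rewrite in_itv/= => at_.
    apply: Nsub => /= /(_ I) Z.
    have {Z}Z : mu (shadow C t) = 0%E.
      move: Z => /eqP; rewrite mule_eq0 => /orP[|/eqP//].
      by rewrite eqe expf_eq0/= gt_eqF ?icos_gt0.
    have [//|] := H t.
    have sp : shadow C t (py - t * px) by exists (px, py) => //=; rewrite subrr.
    have sq : shadow C t (qy - t * qx) by exists (qx, qy) => //=; rewrite subrr.
    have := shadow_itv cC vC sp sq; have := shadow_itv cC vC sq sp.
    by rewrite Z !lee_fin => h1 h2; case; lra.
  rewrite N0 lebesgue_measure_itv/= lte_fin ltrDl ltr01 -EFinB lee_fin; lra.
clear N mN N0 Nsub L0 f0 mf.
have [t /andP[t0 t1] h1] := key 0; have [t' /andP[t2 t3] h2] := key 2.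
have : (t' - t) * (px - qx) = 0 by lra.
move=> /eqP; rewrite mulf_eq0 => /orP[/eqP e|]; first by exfalso; lra.
by rewrite subr_eq0 => /eqP e; subst px; congr pair; lra.
Qed.

Lemma planar_isoperimetric_equality :
  (shadow_length C ^+ 2 <= (4 * pi)%:E * area C)%E ->
  (forall p q, C p -> C q -> p = q) \/
  exists r xc yc, [/\ 0 < r,
    forall x y, (x - xc) ^+ 2 + (y - yc) ^+ 2 < r ^+ 2 -> C (x, y) &
    forall x y, C (x, y) -> (x - xc) ^+ 2 + (y - yc) ^+ 2 <= r ^+ 2].
Proof.
have := area_ge0; rewrite le_eqVlt => /predU1P[<-|].
  rewrite mule0 => L0; left; apply: shadow_length0; apply/eqP.
  rewrite -[_ == _]/((0 < 2)%N && _) -expe_eq0; apply/eqP/le_anti.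
  by rewrite L0 sqre_ge0.
move=> /(area_le_shadow_length_disc cC vC)[r [r0 -> Lr Leq]].
have -> : ((4 * pi)%:E * (pi * r ^+ 2)%:E = (2 * pi * r)%:E ^+ 2)%E.
  by rewrite -EFinM -EFin_expe; congr EFin; ring.
rewrite lee_sqr ?shadow_length_ge0//; last first.
  by rewrite lee_fin !mulr_ge0 ?pi_ge0// ltW.
by move=> /Leq[xc [yc [H1 H2]]]; right; exists r, xc, yc; split.
Qed.

End planar_isoperimetry.

(** * Discs are extremal *)

Section disc.
Variable R : realType.
Local Notation mu := (@lebesgue_measure R).

(** Substitution of sin x for z; outside [-1, 1] the square root is zero. *)
Lemma integral_half_circle :
  (\int[mu]_z (Num.sqrt (1 - z ^+ 2))%:E = (pi / 2)%:E)%E.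
Proof.
have cG : continuous (fun z : R => Num.sqrt (1 - z ^+ 2)).
  move=> z; apply: (@continuous_comp _ _ _ (fun z : R => 1 - z ^+ 2) Num.sqrt).
    by apply: cvgB; [exact: cvg_cst|exact: exprn_continuous].
  exact: sqrt_continuous.
have pi2 : - (pi / 2) < pi / 2 :> R by rewrite gtrN// divr_gt0// pi_gt0.
transitivity (\int[mu]_(z in `[sin (- (pi / 2)), sin (pi / 2)]) (Num.sqrt (1 - z ^+ 2))%:E)%E.
  rewrite sinN sin_pihalf [RHS]integral_mkcond; apply: eq_integral => z _.
  rewrite patchE; case: ifPn => //; rewrite notin_setE/= in_itv/= => zN.
  congr EFin; apply: ler0_sqrtr; rewrite subr_le0 leNgt; apply/negP.
  move=> z1; apply: zN; apply/andP; split; nra.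
have dsinE : (@sin R)^`()%classic = @cos R.
  by apply/funext => z; rewrite derive1E; exact: derive_val.
rewrite integration_by_substitution_increasing ?dsinE.
- transitivity (\int[mu]_(x in `[(- (pi / 2))%R, (pi / 2)%R]) (cos x ^+ 2)%:E)%E.
    apply: eq_integral => x; rewrite inE/= in_itv/= => /andP[x1 x2].
    rewrite /GRing.mul/= -cos2sin2 sqrtr_sqr ger0_norm ?expr2//.
    by apply: cos_ge0_pihalf; rewrite x1.
  have dF (x : R) : is_derive x 1 (fun x => 2^-1 * (x + sin x * cos x)) (cos x ^+ 2).
    have d := deriveZ (2^-1) (deriveD (is_derive_id x 1)
      (deriveM (is_derive_sin x) (is_derive_cos x))).
    apply: is_derive_eq d _; have := cos2Dsin2 x; lra.
  rewrite (@continuous_FTC2 _ _ (fun x => 2^-1 * (x + sin x * cos x))) //.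
  + by rewrite cosN cos_pihalf !mulr0 !addr0 -EFinB; congr EFin; field.
  + apply: continuous_subspaceT => x.
    apply: (@continuous_comp _ _ _ cos (fun y : R => y ^+ 2)).
      exact: continuous_cos.
    exact: exprn_continuous.
  + split.
    * by move=> x _; have [] := dF x.
    * exact/cvg_at_right_filter/(is_derive_continuous (dF _)).
    * exact/cvg_at_left_filter/(is_derive_continuous (dF _)).
  + by move=> x _; rewrite derive1E; exact: (@derive_val _ _ _ _ _ _ _ (dF x)).
- exact: ltW.
- move=> x y; rewrite !in_itv/= => /andP[x1 x2] /andP[y1 y2] xy.
  have cs : {within `[x, y], continuous (@sin R)}.
    by apply: continuous_subspaceT; exact: continuous_sin.
  have [c] := MVT xy (fun z _ => is_derive_sin z) cs.
  rewrite in_itv/= => /andP[xc cy] /eqP; rewrite subr_eq => /eqP ->.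
  by rewrite ltrDr mulr_gt0 ?subr_gt0// cos_gt0_pihalf// (le_lt_trans x1 xc) (lt_le_trans cy y2).
- by move=> z _; exact: continuous_cos.
- by apply/cvg_ex; eexists; apply: cvg_at_right_filter; exact: continuous_cos.
- by apply/cvg_ex; eexists; apply: cvg_at_left_filter; exact: continuous_cos.
- split.
  + by move=> x _; exact: derivable_sin.
  + exact/cvg_at_right_filter/continuous_sin.
  + exact/cvg_at_left_filter/continuous_sin.
- exact: continuous_subspaceT.
Qed.

Variables (xc yc w : R).
Let disc : set (R * R) := [set p | (p.1 - xc) ^+ 2 + (p.2 - yc) ^+ 2 <= w].

Lemma area_disc : 0 <= w -> area disc = (pi * w)%:E.
Proof.
move=> w_ge0.
have sE x : mu [set y | disc (x, y)] = (2 * Num.sqrt (w - (x - xc) ^+ 2))%:E.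
  have [h|h] := leP 0 (w - (x - xc) ^+ 2); last first.
    rewrite ltr0_sqrtr// mulr0 (_ : [set y | _] = set0) ?measure0//.
    apply/seteqP; split => // y; rewrite /disc/= => h'.
    have := sqr_ge0 (y - yc); lra.
  set q := Num.sqrt _; have q0 : 0 <= q by exact: sqrtr_ge0.
  have qE : q ^+ 2 = w - (x - xc) ^+ 2 by rewrite sqr_sqrtr.
  have -> : [set y | disc (x, y)] = `[yc - q, yc + q]%classic.
    apply/seteqP; split => y; rewrite /disc/= in_itv/= -ler_distlC => h1.
      rewrite -(ler_pXn2r (n := 2)) ?nnegrE ?normr_ge0//.
      by rewrite real_normK ?num_real// qE -sqrrN opprB; lra.
    have : `|yc - y| ^+ 2 <= q ^+ 2 by rewrite ler_pXn2r ?nnegrE ?normr_ge0.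
    by rewrite real_normK ?num_real// qE -sqrrN opprB; lra.
  rewrite lebesgue_measure_itv/= lte_fin; case: ltP => h2.
    by rewrite -EFinB; congr EFin; ring.
  have -> : q = 0 by lra.
  by rewrite mulr0.
rewrite /area; under eq_integral do rewrite sE.
move: w_ge0; rewrite le_eqVlt => /predU1P[w0|w0].
  rewrite -w0 mulr0; apply: integral0_eq => x _.
  by rewrite ler0_sqrtr ?mulr0// sub0r oppr_le0 sqr_ge0.
have sw0 : 0 < Num.sqrt w by rewrite sqrtr_gt0.
have mS : measurable_fun setT (fun x : R => (2 * Num.sqrt (w - (x - xc) ^+ 2))%:E).
  apply/measurable_EFinP; apply: measurable_funM => //.
  apply: (measurableT_comp (@measurable_sqrt R)); apply: measurable_funB => //.
  by apply: measurable_funX; exact: measurable_funB.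
rewrite (@ge0_integral_affine _ (Num.sqrt w) xc _ _ mS); first last.
- by move=> x; rewrite lee_fin mulr_ge0// sqrtr_ge0.
- by rewrite gt_eqF.
under eq_integral => x _.
  rewrite addrK exprMn sqr_sqrtr ?(ltW w0)// -{1}(mulr1 w) -mulrBr sqrtrM ?(ltW w0)//.
  rewrite mulrA EFinM; over.
rewrite ge0_integralZl_EFin//=.
- rewrite integral_half_circle -!EFinM; congr EFin.
  by rewrite gtr0_norm// -[in RHS](sqr_sqrtr (ltW w0)); field.
- apply/measurable_EFinP; apply: (measurableT_comp (@measurable_sqrt R)).
  by apply: measurable_funB => //; exact: measurable_funX.
Qed.

Lemma shadow_length_disc : 0 <= w -> shadow_length disc = (2 * pi * Num.sqrt w)%:E.
Proof.
move=> w0; rewrite /shadow_length.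
transitivity (\int[mu]_t ((2 * Num.sqrt w)%:E * ((1 + t ^+ 2)^-1)%:E))%E; last first.
  rewrite ge0_integralZl_EFin//.
  - by rewrite integral_Cauchy_kernel -EFinM; congr EFin; ring.
  - by move=> t _; rewrite lee_fin invr_ge0 ltW// sqr1D_gt0.
  - apply/measurable_EFinP; apply: continuous_measurable_fun.
    exact: continuous_oneDsqrV.
apply: eq_integral => t _.
have i0 := icos_gt0 t; have tt := sqr1D_gt0 t.
pose q := Num.sqrt w / icos t; have q0 : 0 <= q by rewrite divr_ge0 ?sqrtr_ge0 ?ltW.
have qE : q ^+ 2 = w * (1 + t ^+ 2).
  by rewrite expr_div_n sqr_sqrtr// icos_sqr invrK.
have -> : shadow disc t = `[yc - t * xc - q, yc - t * xc + q]%classic.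
  apply/seteqP; split => v; rewrite /= in_itv/= -ler_distlC.
    move=> [[x y]]; rewrite /disc/= => h /eqP; rewrite subr_eq0 => /eqP <-.
    rewrite -(ler_pXn2r (n := 2)) ?nnegrE ?normr_ge0//.
    rewrite real_normK ?num_real// qE.
    have := sqr_ge0 ((x - xc) + t * (y - yc)); nra.
  move=> h.
  have h2 : (yc - t * xc - v) ^+ 2 <= w * (1 + t ^+ 2).
    by rewrite -qE -real_normK ?num_real// ler_pXn2r ?nnegrE ?normr_ge0.
  pose d := (v - (yc - t * xc)) / (1 + t ^+ 2).
  exists (xc - t * d, yc + d); rewrite /disc/=.
    have -> : (xc - t * d - xc) ^+ 2 + (yc + d - yc) ^+ 2 = d ^+ 2 * (1 + t ^+ 2) by ring.
    have -> : d ^+ 2 * (1 + t ^+ 2) = (v - (yc - t * xc)) ^+ 2 / (1 + t ^+ 2).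
      by rewrite /d; field; rewrite gt_eqF.
    by rewrite ler_pdivrMr// -sqrrN opprB.
  by rewrite /d; field; rewrite gt_eqF.
have -> : mu `[yc - t * xc - q, yc - t * xc + q]%classic = (2 * q)%:E.
  rewrite lebesgue_measure_itv/= lte_fin; case: ltP => h2.
    by rewrite -EFinB; congr EFin; ring.
  have -> : q = 0 by lra.
  by rewrite mulr0.
rewrite -!EFinM; congr EFin; rewrite -icos_sqr /q; field.
by rewrite gt_eqF.
Qed.

Lemma disc_isoperimetric_equality :
  (shadow_length disc ^+ 2 = (4 * pi)%:E * area disc)%E.
Proof.
have [w0|w0] := leP 0 w.
  rewrite area_disc// shadow_length_disc// -EFin_expe -EFinM; congr EFin.
  by rewrite -{2}(sqr_sqrtr w0); ring.
have d0 : disc = set0.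
  apply/seteqP; split => // -[x y]; rewrite /disc/= => h.
  have := sqr_ge0 (x - xc); have := sqr_ge0 (y - yc); lra.
rewrite d0 /shadow_length /area integral0_eq ?integral0_eq ?mule0//.
- by rewrite expe2 mule0.
- by move=> x _; rewrite (_ : [set y | _] = set0) ?measure0//; exact/seteqP.
- move=> t _; rewrite (_ : shadow _ _ = set0) ?measure0 ?mule0//.
  by apply/seteqP; split => // v [].
Qed.

End disc.

(** * Lines meeting a body *)

Section measurability.
Context d (T : measurableType d) (R : realType).
Context d1 d2 (U : measurableType d1) (V : measurableType d2).

Lemma mfst (f : T -> U * V) : measurable_fun setT f -> measurable_fun setT (fun x => (f x).1).
Proof. by move=> mf; apply: measurableT_comp mf; exact: measurable_fst. Qed.

Lemma msnd (f : T -> U * V) : measurable_fun setT f -> measurable_fun setT (fun x => (f x).2).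
Proof. by move=> mf; apply: measurableT_comp mf; exact: measurable_snd. Qed.

Implicit Types f g : T -> R.

Lemma mnorm f : measurable_fun setT f -> measurable_fun setT (fun x => `|f x|).
Proof. by move=> mf; exact: measurableT_comp. Qed.

Lemma mopp f : measurable_fun setT f -> measurable_fun setT (fun x => - f x).
Proof. by move=> mf; apply: measurableT_comp mf; exact: oppr_measurable. Qed.

Lemma minv f : measurable_fun setT f -> measurable_fun setT (fun x => (f x)^-1).
Proof. by move=> mf; apply: measurableT_comp mf; exact: measurable_invr. Qed.

Lemma msqrt f : measurable_fun setT f -> measurable_fun setT (fun x => Num.sqrt (f x)).
Proof. by move=> mf; apply: measurableT_comp mf; exact: measurable_sqrt. Qed.

End measurability.

Ltac mfun := repeat first
  [ assumption
  | lazymatch goal with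
    | |- measurable_fun _ (fun _ => ?c) => exact: measurable_cst
    | |- measurable_fun _ (fun x => x) => exact: measurable_id
    | |- measurable_fun _ (fun x => (@?f x, @?g x)) => apply: measurable_fun_pair
    | |- measurable_fun _ (fun x => fst (@?f x)) => apply: mfst
    | |- measurable_fun _ (fun x => snd (@?f x)) => apply: msnd
    | |- measurable_fun _ (fun x => GRing.add (@?f x) (@?g x)) => apply: measurable_funD
    | |- measurable_fun _ (fun x => GRing.mul (@?f x) (@?g x)) => apply: measurable_funM
    | |- measurable_fun _ (fun x => GRing.opp (@?f x)) => apply: mopp
    | |- measurable_fun _ (fun x => GRing.inv (@?f x)) => apply: minv
    | |- measurable_fun _ (fun x => GRing.exp (@?f x) _) => apply: measurable_funX
    | |- measurable_fun _ (fun x => Num.norm (@?f x)) => apply: mnorm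
    | |- measurable_fun _ (fun x => Num.sqrt (@?f x)) => apply: msqrt
    end
  | exact: measurable_cst | exact: measurable_id
  | apply: mfst | apply: msnd
  | apply: measurable_fun_pair
  | apply: measurable_funD | apply: measurable_funB | apply: mnorm | apply: mopp
  | apply: minv | apply: msqrt | apply: measurable_funM | apply: measurable_funX ].

Section rays.
Variable R : realType.
Local Notation rT := (measurableTypeR R).
Local Notation T2 := (rT * rT)%type.
Local Notation T3 := (rT * rT * rT)%type.
Local Notation mu := (@lebesgue_measure R).
Local Notation mu2 := (mu \x mu)%E.

Definition convex3 (K : set (E3 R)) := forall p q s,
  K p -> K q -> 0 <= s <= 1 ->
  K ((1 - s) * p.1.1 + s * q.1.1, (1 - s) * p.1.2 + s * q.1.2,
     (1 - s) * p.2 + s * q.2).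

Lemma continuous_x : continuous (fun X : E3 R => X.1.1).
Proof. by move=> X; apply: (@continuous_comp _ _ _ fst fst); exact: cvg_fst. Qed.

Lemma continuous_y : continuous (fun X : E3 R => X.1.2).
Proof.
move=> X; apply: (@continuous_comp _ _ _ fst snd); first exact: cvg_fst.
exact: cvg_snd.
Qed.

Lemma dense_seq_E3 : exists D : nat -> E3 R, dense_seq D.
Proof.
apply: (@dense_seq_prod R (R * R)%type R); last exact: dense_seq_real.
by apply: (@dense_seq_prod R R R); exact: dense_seq_real.
Qed.

(** The area element of the sphere of directions (1, a, b) in the coordinates
    (a, b). *)
Definition gdens (a b : R) : R := Num.sqrt (1 + a ^+ 2 + b ^+ 2) ^- 3.

(** The line P + R (1, a, b) meets K at X; the two equations are merged into
    the vanishing of one continuous function of X, the form required by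
    [measurable_compact_exists]. *)
Definition hits (K : set (E3 R)) : set (T3 * T2) := [set Pv | exists2 X, K X &
  `|(X.1.2 - Pv.1.1.2) - Pv.2.1 * (X.1.1 - Pv.1.1.1)| +
  `|(X.2 - Pv.1.2) - Pv.2.2 * (X.1.1 - Pv.1.1.1)| = 0].

Variable K : set (E3 R).
Hypotheses (cK : compact K) (vK : convex3 K).

Lemma measurable_hits : measurable (hits K).
Proof.
apply: (@measurable_compact_exists _ R (T3 * T2)%type _ K
  (fun Pv X => `|(X.1.2 - Pv.1.1.2) - Pv.2.1 * (X.1.1 - Pv.1.1.1)| +
  `|(X.2 - Pv.1.2) - Pv.2.2 * (X.1.1 - Pv.1.1.1)|)) => //.
- exact: dense_seq_E3.
- by move=> X; mfun.
- move=> Pv X.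
  have c11 : (fun X : E3 R => X.1.1) Y @[Y --> X] --> X.1.1 by exact: continuous_x.
  have c12 : (fun X : E3 R => X.1.2) Y @[Y --> X] --> X.1.2 by exact: continuous_y.
  have c2 : (fun X : E3 R => X.2) Y @[Y --> X] --> X.2 by exact: cvg_snd.
  apply: cvgD; apply: cvg_norm; apply: cvgB.
  + by apply: cvgB; [exact: c12|exact: cvg_cst].
  + by apply: cvgM; [exact: cvg_cst|apply: cvgB; [exact: c11|exact: cvg_cst]].
  + by apply: cvgB; [exact: c2|exact: cvg_cst].
  + by apply: cvgM; [exact: cvg_cst|apply: cvgB; [exact: c11|exact: cvg_cst]].
Qed.

Lemma measurable_body : measurable (K : set T3).
Proof.
have := @measurable_compact_exists _ R T3 _ K
  (fun p X => `|p.1.1 - X.1.1| + `|p.1.2 - X.1.2| + `|p.2 - X.2|).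
have -> : [set p : E3 R | exists2 X, K X &
   `|p.1.1 - X.1.1| + `|p.1.2 - X.1.2| + `|p.2 - X.2| = 0] = K.
  apply/seteqP; split => [[[x y] z] /= [[[X Y] Z] KX /eqP]|p Kp /=].
    rewrite paddr_eq0// ?addr_ge0// => /andP[] /=.
    rewrite paddr_eq0// !normr_eq0 !subr_eq0.
    by move=> /andP[/eqP -> /eqP ->] /eqP ->.
  by exists p => //; rewrite !subrr normr0 !addr0.
apply => //.
- exact: dense_seq_E3.
- by move=> X; mfun.
- move=> Pv X.
  have c11 : (fun X : E3 R => X.1.1) Y @[Y --> X] --> X.1.1 by exact: continuous_x.
  have c12 : (fun X : E3 R => X.1.2) Y @[Y --> X] --> X.1.2 by exact: continuous_y.
  have c2 : (fun X : E3 R => X.2) Y @[Y --> X] --> X.2 by exact: cvg_snd.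
  apply: cvgD; [apply: cvgD|]; apply: cvg_norm; apply: cvgB; try exact: cvg_cst.
  + exact: c11.
  + exact: c12.
  + exact: c2.
Qed.

End rays.

(** * Integration over planes *)

(** The product measure on the plane under a name of its own, so that it can be
    recognized as sigma-finite. *)
Definition lebesgue2 (R : realType) :
    set (measurableTypeR R * measurableTypeR R)%type -> \bar R :=
  (@lebesgue_measure R \x @lebesgue_measure R)%E.

HB.instance Definition _ (R : realType) := Measure.copy (@lebesgue2 R)
  (@lebesgue_measure R \x @lebesgue_measure R)%E.

Lemma sigma_finite_lebesgue2 (R : realType) : sigma_finite setT (@lebesgue2 R).
Proof.
pose F n : set R := `[(- n%:R)%R, n%:R]%classic.
exists (fun n => F n `*` F n).
  apply/seteqP; split => // -[x y] _.
  pose z := Num.max `|x| `|y|; have := @bigcup_itvT R false false.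
  move=> /seteqP[_ /(_ z I)] [n _ /=]; rewrite in_itv/= ge_max => /andP[_ /andP[xn yn]].
  by exists n => //=; rewrite /F/= !in_itv/= -!ler_norml.
move=> n; have mF : measurable (F n : set (measurableTypeR R)) by exact: measurable_itv.
split; first exact: measurableX.
have Foo : (@lebesgue_measure R (F n) < +oo)%E.
  by rewrite /F lebesgue_measure_itv/=; case: ifP => _; rewrite -?EFinB ltry.
rewrite /lebesgue2 product_measure1E//.
by rewrite lte_mul_pinfty// ge0_fin_numE.
Qed.

HB.instance Definition _ (R : realType) :=
  Measure_isSigmaFinite.Build _ _ _ (@lebesgue2 R) (@sigma_finite_lebesgue2 R).

(** Likewise for the product measure on space. *)
Definition space_measure (R : realType) :
    set (measurableTypeR R * measurableTypeR R * measurableTypeR R)%type -> \bar R :=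
  lebesgue3 R.

HB.instance Definition _ (R : realType) :=
  Measure.copy (@space_measure R) (lebesgue3 R).

Lemma sigma_finite_space_measure (R : realType) : sigma_finite setT (@space_measure R).
Proof.
pose F n : set R := `[(- n%:R)%R, n%:R]%classic.
exists (fun n => (F n `*` F n) `*` F n).
  apply/seteqP; split => // -[[x y] z] _.
  pose w := Num.max `|x| (Num.max `|y| `|z|); have := @bigcup_itvT R false false.
  move=> /seteqP[_ /(_ w I)] [n _ /=]; rewrite in_itv/= !ge_max.
  move=> /andP[_ /and3P[xn yn zn]].
  by exists n => //=; rewrite /F/= !in_itv/= -!ler_norml.
move=> n; have mF : measurable (F n : set (measurableTypeR R)) by exact: measurable_itv.
have Foo : (@lebesgue_measure R (F n) < +oo)%E.
  by rewrite /F lebesgue_measure_itv/=; case: ifP => _; rewrite -?EFinB ltry.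
split; first by do 2 apply: measurableX => //.
have F2oo : (@lebesgue2 R (F n `*` F n) < +oo)%E.
  rewrite /lebesgue2 product_measure1E//.
  by rewrite lte_mul_pinfty// ge0_fin_numE.
rewrite /space_measure /lebesgue3/= product_measure1E//; last exact: measurableX.
apply: lte_mul_pinfty => //; rewrite ?ge0_fin_numE//.
Qed.

HB.instance Definition _ (R : realType) :=
  Measure_isSigmaFinite.Build _ _ _ (@space_measure R) (@sigma_finite_space_measure R).

Section change_of_variables.
Variable R : realType.
Local Notation rT := (measurableTypeR R).
Local Notation T2 := (rT * rT)%type.
Local Notation T3 := (rT * rT * rT)%type.
Local Notation mu := (@lebesgue_measure R).
Local Notation mu2 := (@lebesgue2 R).
Local Notation mus := (@lebesgue_measure R : {sigma_finite_measure set rT -> \bar R}).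
Local Notation mu2s := (@lebesgue2 R : {sigma_finite_measure set T2 -> \bar R}).
Local Open Scope ereal_scope.

Lemma ge0_integral_mul (f g : R -> \bar R) :
  measurable_fun setT f -> measurable_fun setT g ->
  (forall x, 0 <= f x) -> (forall x, 0 <= g x) ->
  (\int[mu]_x f x) * (\int[mu]_x g x) = \int[mu2]_p (f p.1 * g p.2).
Proof.
move=> mf mg f0 g0; have I0 : 0 <= \int[mu]_x g x by exact: integral_ge0.
rewrite -ge0_integralZr//.
rewrite (fubini_tonelli1 (fun p : T2 => f p.1 * g p.2)) /fubini_F/=.
- by apply: eq_integral => x _; rewrite ge0_integralZl.
- apply: emeasurable_funM; apply: measurableT_comp => //.
- by move=> p; exact: mule_ge0.
Qed.

Lemma diagonal_null : mu2 [set p : T2 | p.1 = p.2] = 0.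
Proof.
rewrite /lebesgue2 /product_measure1; apply: integral0_eq => x _ /=.
rewrite (_ : xsection _ x = [set x]) ?lebesgue_measure_set1//.
by apply/seteqP; split => y; rewrite /xsection/= inE/= => ->.
Qed.

Lemma measurable_diagonal : measurable [set p : T2 | p.1 = p.2].
Proof.
rewrite (_ : [set p : T2 | p.1 = p.2] = (fun p : T2 => (p.1 - p.2)%R) @^-1` [set 0%R]).
  rewrite -[X in measurable X]setTI.
  have mB : measurable_fun setT (fun p : T2 => (p.1 - p.2)%R) by mfun.
  by apply: mB => //; exact: measurable_set1.
by apply/seteqP; split => p /= => [->|/eqP]; rewrite ?subrr// subr_eq0 => /eqP.
Qed.

(** The diagonal is a null set. *)
Lemma eq_integral_offdiagonal (f g : T2 -> \bar R) :
  measurable_fun setT f -> measurable_fun setT g ->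
  (forall a c, a != c -> f (a, c) = g (a, c)) ->
  \int[mu2]_p f p = \int[mu2]_p g p.
Proof.
move=> mf mg fg; apply: ae_eq_integral => //.
exists [set p : T2 | p.1 = p.2]; split.
- exact: measurable_diagonal.
- exact: diagonal_null.
- move=> [a c] /= H; apply: contrapT => /eqP ac; apply: H => _; exact: fg.
Qed.

(** In the plane of slopes (m, k) the lines over the directions (1, a) and (1, c) rise
    with slopes k + m a and k + m c; the Jacobian of this change of variables is
    |a - c|. *)
Lemma integral_plane_slopes (phi : T2 -> \bar R) (a c : R) :
  a != c -> measurable_fun setT phi -> (forall p, 0 <= phi p) ->
  \int[mu]_b \int[mu]_d phi (b, d) =
  `|a - c|%:E * \int[mu]_m \int[mu]_k phi (k + m * a, k + m * c)%R.
Proof.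
move=> ac mphi phi0; rewrite (fubini_tonelli phi)//.
transitivity (\int[mu]_d (`|a - c|%:E *
    \int[mu]_m phi ((a - c) * m + d, d)%R)).
  have ac0 : (a - c)%R != 0%R by rewrite subr_eq0.
  apply: eq_integral => d _; rewrite [LHS](ge0_integral_affine d ac0)//.
  by apply: (measurableT_comp mphi); mfun.
have mphi1 : measurable_fun setT (fun p : T2 => phi ((a - c) * p.2 + p.1, p.1)%R).
  by apply: measurableT_comp => //; mfun.
rewrite ge0_integralZl//; last 2 first.
- exact: (measurable_fun_fubini_tonelli_F (fun p : T2 => phi ((a - c) * p.2 + p.1, p.1)%R)).
- by move=> d _; exact: integral_ge0.
congr (_ * _).
rewrite (fubini_tonelli (fun p : T2 => phi ((a - c) * p.2 + p.1, p.1)%R))//=.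
apply: eq_integral => m _; rewrite [LHS](ge0_integral_affine (m * c) (oner_neq0 R))//.
- rewrite normr1 mul1e; apply: eq_integral => k _.
  by rewrite mul1r; congr (phi (_, _)); ring.
- by apply: measurableT_comp => //; mfun.
Qed.

(** The linear map (x, y) |-> (y - a x, y - c x) has the Jacobian |a - c|. *)
Lemma integral_parallelogram (a c : R) (I J : set rT) : a != c ->
  measurable I -> measurable J ->
  \int[mu]_x \int[mu]_y ((\1_I (y - a * x)%R)%:E * (\1_J (y - c * x)%R)%:E) =
  (`|a - c|^-1)%:E * (mu I * mu J).
Proof.
move=> ac mI mJ.
have mI1 : measurable_fun setT (\1_I : rT -> R) by exact: measurable_indic.
have mJ1 : measurable_fun setT (\1_J : rT -> R) by exact: measurable_indic.
pose f (p : T2) : \bar R := (\1_I p.2)%:E * (\1_J (p.2 + (a - c) * p.1)%R)%:E.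
have mf : measurable_fun setT f.
  apply: emeasurable_funM; apply/measurable_EFinP.
    by apply: (measurableT_comp mI1); mfun.
  by apply: (measurableT_comp mJ1); mfun.
have f0 p : 0 <= f p by rewrite mule_ge0// lee_fin.
transitivity (\int[mu]_x \int[mu]_s f (x, s)).
  apply: eq_integral => x _; rewrite [LHS](ge0_integral_affine (a * x) (oner_neq0 R))//.
  - rewrite normr1 mul1e; apply: eq_integral => s _; rewrite /f/= mul1r.
    by congr (_ * _); congr EFin; congr (\1__ _); ring.
  - apply: emeasurable_funM; apply/measurable_EFinP.
      by apply: (measurableT_comp mI1); mfun.
    by apply: (measurableT_comp mJ1); mfun.
rewrite (fubini_tonelli f)//.
have intJ s : \int[mu]_x (\1_J (s + (a - c) * x)%R)%:E = (`|a - c|^-1)%:E * mu J.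
  have ac0 : (a - c)%R != 0%R by rewrite subr_eq0.
  have -> : mu J = `|a - c|%:E * \int[mu]_x (\1_J (s + (a - c) * x)%R)%:E.
    rewrite -(setIT J) -integral_indic// setIT [LHS](ge0_integral_affine s ac0)//.
    - by congr (_ * _); apply: eq_integral => x _; rewrite addrC.
    - exact/measurable_EFinP.
  by rewrite muleA -EFinM mulVf ?mul1e ?normr_eq0.
transitivity (\int[mu]_s ((\1_I s)%:E * ((`|a - c|^-1)%:E * mu J))).
  apply: eq_integral => s _; rewrite /f/= ge0_integralZl ?intJ//.
  - by apply/measurable_EFinP; apply: (measurableT_comp mJ1); mfun.
rewrite ge0_integralZr//.
- by rewrite integral_indic// setIT muleCA.
- exact/measurable_EFinP.
- by rewrite mule_ge0// lee_fin invr_ge0.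
Qed.

Lemma integral_lebesgue3E (f : T3 -> \bar R) :
  \int[lebesgue3 R]_P f P = \int[(mu2 \x mu)]_P f P.
Proof. by []. Qed.

Lemma integral_lebesgue2E (f : T2 -> \bar R) :
  \int[mu2]_p f p = \int[(mu \x mu)]_p f p.
Proof. by []. Qed.

(** The shear that moves the plane z = k x + m y to the horizontal one
    preserves volume. *)
Lemma lebesgue3_planes (f : T3 -> \bar R) (m k : R) :
  measurable_fun setT f -> (forall P, 0 <= f P) ->
  \int[lebesgue3 R]_P f P =
  \int[mu]_e \int[mu2]_p f (p, k * p.1 + m * p.2 + e)%R.
Proof.
move=> mf f0.
rewrite integral_lebesgue3E (fubini_tonelli1 (m1 := mu2s) (m2 := mus) f)//.
transitivity (\int[mu2]_p \int[mu]_e f (p, k * p.1 + m * p.2 + e)%R).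
  apply: eq_integral => p _; rewrite /fubini_F.
  rewrite [LHS](ge0_integral_affine (k * p.1 + m * p.2)%R (oner_neq0 R))//.
  - rewrite normr1 mul1e; apply: eq_integral => e _.
    by rewrite mul1r addrC.
  - by apply: (measurableT_comp mf); mfun.
rewrite (fubini_tonelli (m1 := mu2s) (m2 := mus)
  (fun q : T2 * rT => f (q.1, k * q.1.1 + m * q.1.2 + q.2)%R))//.
by apply: measurableT_comp => //; mfun.
Qed.

End change_of_variables.

(** * The measure of the lines through a point *)

Section line_measure.
Variables (R : realType) (K : set (E3 R)).
Hypotheses (cK : compact K) (vK : convex3 K).
Local Notation rT := (measurableTypeR R).
Local Notation T2 := (rT * rT)%type.
Local Notation T3 := (rT * rT * rT)%type.
Local Notation mu := (@lebesgue_measure R).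
Local Notation mu2 := (@lebesgue2 R).
Local Notation mu3 := (lebesgue3 R).
Local Notation mus := (@lebesgue_measure R : {sigma_finite_measure set rT -> \bar R}).
Local Notation mu2s := (@lebesgue2 R : {sigma_finite_measure set T2 -> \bar R}).

Definition psi (P : T3) (a b : R) : R := gdens a b * \1_(hits K) (P, (a, b)).

(** Measure of the set of lines through P that meet K, the directions being
    parametrized as (1, a, b). *)
Definition line_measure (P : T3) : \bar R := (\int[mu]_a \int[mu]_b (psi P a b)%:E)%E.

Lemma gdens_ge0 (a b : R) : 0 <= gdens a b.
Proof. by rewrite invr_ge0 exprn_ge0// sqrtr_ge0. Qed.

Lemma psi_ge0 P a b : 0 <= psi P a b.
Proof. by rewrite mulr_ge0// gdens_ge0. Qed.

Lemma measurable_psi d (T : measurableType d) (f : T -> T3) (g h : T -> R) :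
  measurable_fun setT f -> measurable_fun setT g -> measurable_fun setT h ->
  measurable_fun setT (fun x => psi (f x) (g x) (h x)).
Proof.
move=> mf mg mh; apply: measurable_funM; first by rewrite /gdens; mfun.
have mI : measurable_fun setT (\1_(hits K) : T3 * T2 -> R).
  exact: measurable_indic (measurable_hits cK).
by apply: (measurableT_comp mI); mfun.
Qed.

Lemma measurable_psi_b (P : T3) : measurable_fun setT (fun p : T2 => (psi P p.1 p.2)%:E).
Proof. by apply/measurable_EFinP; apply: measurable_psi; mfun. Qed.

Definition inner_measure (P : T3) (a : R) : \bar R := (\int[mu]_b (psi P a b)%:E)%E.

Lemma measurable_inner (P : T3) : measurable_fun setT (inner_measure P).
Proof.
exact: (measurable_fun_fubini_tonelli_F (m2 := mus) _ (measurable_psi_b P)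
  (fun p => psi_ge0 P p.1 p.2)).
Qed.

Lemma inner_ge0 P a : (0 <= inner_measure P a)%E.
Proof. by apply: integral_ge0 => b _; rewrite lee_fin psi_ge0. Qed.

Lemma measurable_line_measure : measurable_fun setT line_measure.
Proof.
have m1 : measurable_fun setT (fun q : T3 * rT * rT => (psi q.1.1 q.1.2 q.2)%:E).
  by apply/measurable_EFinP; apply: measurable_psi; mfun.
have m2 := measurable_fun_fubini_tonelli_F (m2 := mus) _ m1
  (fun q => psi_ge0 q.1.1 q.1.2 q.2).
have := measurable_fun_fubini_tonelli_F (m2 := mus) _ m2 (fun q => inner_ge0 q.1 q.2).
exact.
Qed.

(** The integrand over pairs of lines through P, of directions (1, A.1) and
    (1, A.2) over the horizontal plane, spanning a plane of slopes Q = (m, k); the line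
    over (1, a) in this plane rises with slope k + m a. *)
Definition pairs (P : T3) (A Q : T2) : R :=
  `|A.1 - A.2| * (psi P A.1 (Q.2 + Q.1 * A.1) * psi P A.2 (Q.2 + Q.1 * A.2)).

Lemma pairs_ge0 P A Q : 0 <= pairs P A Q.
Proof. by apply: mulr_ge0 => //; apply: mulr_ge0; exact: psi_ge0. Qed.

Lemma measurable_pairs d (T : measurableType d) (f : T -> T3) (g h : T -> T2) :
  measurable_fun setT f -> measurable_fun setT g -> measurable_fun setT h ->
  measurable_fun setT (fun x => (pairs (f x) (g x) (h x))%:E).
Proof.
move=> mf mg mh; apply/measurable_EFinP; apply: measurable_funM; first by mfun.
by apply: measurable_funM; apply: measurable_psi => //; mfun.
Qed.

(** The square is an integral over pairs of lines through P. For given A, the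
    two rises are exchanged for the slopes of the plane spanned, at the cost of
    the Jacobian of [integral_plane_slopes]. *)
Lemma line_measure_sqr P :
  (line_measure P ^+ 2 = \int[mu2]_A \int[mu2]_Q (pairs P A Q)%:E)%E.
Proof.
rewrite expe2 /line_measure ge0_integral_mul//; last 4 first.
- exact: measurable_inner.
- exact: measurable_inner.
- exact: inner_ge0.
- exact: inner_ge0.
apply: eq_integral_offdiagonal.
- by apply: emeasurable_funM; apply: (measurableT_comp (measurable_inner P)); mfun.
- have mp : measurable_fun setT (fun q : T2 * T2 => (pairs P q.1 q.2)%:E).
    by apply: measurable_pairs; mfun.
  exact: (measurable_fun_fubini_tonelli_F (m2 := mu2s) _ mp (fun q => pairs_ge0 P q.1 q.2)).
- move=> a c ac /=.
  transitivity (\int[mu]_b \int[mu]_d ((psi P a b)%:E * (psi P c d)%:E))%E.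
    rewrite -ge0_integralZr//.
    + apply: eq_integral => b _; rewrite ge0_integralZl//.
      * by apply/measurable_EFinP; apply: measurable_psi; mfun.
      * by move=> d _; rewrite lee_fin psi_ge0.
      * by rewrite lee_fin psi_ge0.
    + by apply/measurable_EFinP; apply: measurable_psi; mfun.
    + by move=> b _; rewrite lee_fin psi_ge0.
    + exact: inner_ge0.
  pose phi (p : T2) : \bar R := ((psi P a p.1)%:E * (psi P c p.2)%:E)%E.
  have phi0 p : (0 <= phi p)%E by rewrite mule_ge0// lee_fin psi_ge0.
  have mphi : measurable_fun setT phi.
    by apply: emeasurable_funM; apply/measurable_EFinP; apply: measurable_psi; mfun.
  rewrite (integral_plane_slopes ac mphi phi0).
  rewrite integral_lebesgue2E fubini_tonelli1; last 2 first.
  - by apply: measurable_pairs; mfun.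
  - by move=> Q; rewrite lee_fin pairs_ge0.
  have mQ : measurable_fun setT (fun Q : T2 => phi (Q.2 + Q.1 * a, Q.2 + Q.1 * c)).
    by apply: (measurableT_comp mphi); mfun.
  rewrite -ge0_integralZl//; last 2 first.
  - exact: (measurable_fun_fubini_tonelli_F (m2 := mus) _ mQ (fun Q => phi0 _)).
  - by move=> m _; exact: integral_ge0.
  apply: eq_integral => m _; rewrite -ge0_integralZl//.
  by apply: (measurableT_comp mphi); mfun.
Qed.

End line_measure.

(** * Plane sections *)

Section plane_sections.
Variables (R : realType) (K : set (E3 R)).
Hypotheses (cK : compact K) (vK : convex3 K).
Local Notation rT := (measurableTypeR R).
Local Notation T2 := (rT * rT)%type.
Local Notation T3 := (rT * rT * rT)%type.
Local Notation mu := (@lebesgue_measure R).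
Local Notation mu2 := (@lebesgue2 R).
Local Notation mu3 := (@space_measure R).
Local Notation mus := (@lebesgue_measure R : {sigma_finite_measure set rT -> \bar R}).
Local Notation mu2s := (@lebesgue2 R : {sigma_finite_measure set T2 -> \bar R}).
Local Notation mu3s := (@space_measure R : {sigma_finite_measure set T3 -> \bar R}).

(** The plane with slopes Q = (m, k) at height e, whose points (x, y, k x + m y + e)
    are recorded by (x, y). *)
Definition section (Q : R * R) (e : R) : set (R * R) :=
  [set p | K (p, Q.2 * p.1 + Q.1 * p.2 + e)].

Lemma compact_section Q e : compact (section Q e).
Proof.
have -> : section Q e = fst @` (K `&` [set X | X.2 - (Q.2 * X.1.1 + Q.1 * X.1.2 + e) = 0]).
  apply/seteqP; split => [p Kp|_ [[p z] [Kp /= zE]] <-].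
    by exists (p, Q.2 * p.1 + Q.1 * p.2 + e) => //; split => //=; rewrite subrr.
  by rewrite /section/= -(subr0_eq zE).
apply: continuous_compact.
  by apply: continuous_subspaceT => X; exact: cvg_fst.
apply: (subclosed_compact _ cK); last by move=> X [].
apply: closedI; first by apply: compact_closed => //; exact: norm_hausdorff.
have cf : continuous (fun X : E3 R => X.2 - (Q.2 * X.1.1 + Q.1 * X.1.2 + e)).
  move=> X.
  have c11 : (fun X : E3 R => X.1.1) Y @[Y --> X] --> X.1.1 by exact: continuous_x.
  have c12 : (fun X : E3 R => X.1.2) Y @[Y --> X] --> X.1.2 by exact: continuous_y.
  apply: cvgB; first exact: cvg_snd.
  apply: cvgD; last exact: cvg_cst.
  by apply: cvgD; (apply: cvgM; first exact: cvg_cst).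
have -> : [set X : E3 R | X.2 - (Q.2 * X.1.1 + Q.1 * X.1.2 + e) = 0] =
  (fun X : E3 R => X.2 - (Q.2 * X.1.1 + Q.1 * X.1.2 + e)) @^-1` [set 0] by [].
by apply: closed_comp => // X _; exact: cf.
Qed.

Lemma convex_section Q e : convex2 (section Q e).
Proof.
move=> p q s Kp Kq s01; have := vK Kp Kq s01; rewrite /section/=.
by congr (K (_, _)); ring.
Qed.

Definition width (Q : R * R) (e a : R) : \bar R := mu (shadow (section Q e) a).

Lemma shadow_sectionE Q e a v : shadow (section Q e) a v <-> exists2 X, K X &
  `|X.1.2 - a * X.1.1 - v| + `|X.2 - (Q.2 * X.1.1 + Q.1 * X.1.2 + e)| = 0.
Proof.
split=> [[p Kp /eqP h]|[[p z] Kp /eqP]].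
  exists (p, Q.2 * p.1 + Q.1 * p.2 + e) => //=.
  by rewrite subrr normr0 addr0; apply/eqP; rewrite normr_eq0.
rewrite paddr_eq0// !normr_eq0 => /andP[/eqP h]; rewrite subr_eq0 => /eqP zE.
by exists p => //; rewrite /section/= -zE.
Qed.

Lemma measurable_width d (T : measurableType d) (f : T -> T2) (g h : T -> R) :
  measurable_fun setT f -> measurable_fun setT g -> measurable_fun setT h ->
  measurable_fun setT (fun x => width (f x) (g x) (h x)).
Proof.
move=> mf mg mh.
have m1 : measurable ([set q | shadow (section q.1.1.1 q.1.1.2) q.1.2 q.2] :
    set (T2 * rT * rT * rT)).
  pose Phi (q : T2 * rT * rT * rT) (X : E3 R) : R := `|X.1.2 - q.1.2 * X.1.1 - q.2| +
    `|X.2 - (q.1.1.1.2 * X.1.1 + q.1.1.1.1 * X.1.2 + q.1.1.2)|.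
  rewrite (_ : mkset _ = [set q | exists2 X, K X & Phi q X = 0]); last first.
    by apply/seteqP; split => q; apply shadow_sectionE.
  apply: measurable_compact_exists => //; first exact: dense_seq_E3.
  - by move=> X; rewrite /Phi; mfun.
  - move=> q X; rewrite /Phi.
    have c11 : (fun X : E3 R => X.1.1) Y @[Y --> X] --> X.1.1 by exact: continuous_x.
    have c12 : (fun X : E3 R => X.1.2) Y @[Y --> X] --> X.1.2 by exact: continuous_y.
    apply: cvgD; apply: cvg_norm; apply: cvgB; try exact: cvg_cst.
    + by apply: cvgB; [exact: c12|apply: cvgM; [exact: cvg_cst|exact: c11]].
    + exact: cvg_snd.
    + apply: cvgD; last exact: cvg_cst.
      by apply: cvgD; (apply: cvgM; first exact: cvg_cst).
have := @measurable_fun_xsection _ _ (T2 * rT * rT)%type rT R mu _ m1.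
move=> m2; have m3 : measurable_fun setT (fun x => (f x, g x, h x)) by mfun.
have := measurableT_comp m2 m3; apply: eq_measurable_fun => x _ /=.
by congr (mu _); apply/seteqP; split => v; rewrite /xsection/= inE.
Qed.

Lemma psi_plane Q e (a : R) (p : T2) :
  psi K (p, Q.2 * p.1 + Q.1 * p.2 + e) a (Q.2 + Q.1 * a) =
  gdens a (Q.2 + Q.1 * a) * \1_(shadow (section Q e) a) (p.2 - a * p.1).
Proof.
rewrite /psi; congr (_ * _); rewrite !indicE; congr (_%:R); congr nat_of_bool.
apply/idP/idP; rewrite !inE/=.
  move=> [X KX /=]; rewrite /hits/= => /eqP; rewrite paddr_eq0// !normr_eq0 => /andP[/eqP h1 /eqP h2].
  apply/shadow_sectionE; exists X => //; apply/eqP; rewrite paddr_eq0// !normr_eq0.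
  by apply/andP; split; apply/eqP; [lra|nra].
move=> /shadow_sectionE[X KX] /eqP; rewrite paddr_eq0// !normr_eq0 => /andP[/eqP h1 /eqP h2].
exists X => //=; apply/eqP; rewrite paddr_eq0// !normr_eq0.
by apply/andP; split; apply/eqP; [lra|nra].
Qed.

Definition weighted_width (Q : R * R) (e a : R) : \bar R :=
  ((gdens a (Q.2 + Q.1 * a))%:E * width Q e a)%E.

Lemma measurable_weighted_width d (T : measurableType d) (f : T -> T2) (g h : T -> R) :
  measurable_fun setT f -> measurable_fun setT g -> measurable_fun setT h ->
  measurable_fun setT (fun x => weighted_width (f x) (g x) (h x)).
Proof.
move=> mf mg mh; apply: emeasurable_funM; last exact: measurable_width.
by apply/measurable_EFinP; rewrite /gdens; mfun.
Qed.

Lemma weighted_width_ge0 Q e a : (0 <= weighted_width Q e a)%E.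
Proof. by rewrite mule_ge0// lee_fin gdens_ge0. Qed.

(** The measure of the lines in the plane that meet K, each direction having the
    weight that it has in space. *)
Definition section_measure (Q : R * R) (e : R) : \bar R :=
  (\int[mu]_a weighted_width Q e a)%E.

(** The Jacobian that comes from the slopes of the plane cancels the one of
    [integral_parallelogram]. *)
Lemma integral_pairs_plane (a c : R) Q e : a != c ->
  (\int[mu2]_p (pairs K (p, Q.2 * p.1 + Q.1 * p.2 + e) (a, c) Q)%:E =
   weighted_width Q e a * weighted_width Q e c)%E.
Proof.
move=> ac.
pose I := shadow (section Q e) a; pose J := shadow (section Q e) c.
have mI : measurable (I : set rT) by apply: measurable_shadow; exact: compact_section.
have mJ : measurable (J : set rT) by apply: measurable_shadow; exact: compact_section.
pose g := gdens a (Q.2 + Q.1 * a) * gdens c (Q.2 + Q.1 * c).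
have g0 : 0 <= g by rewrite mulr_ge0 ?gdens_ge0.
have mI1 : measurable_fun setT (\1_I : rT -> R) by exact: measurable_indic.
have mJ1 : measurable_fun setT (\1_J : rT -> R) by exact: measurable_indic.
transitivity ((`|a - c| * g)%:E * \int[mu2]_p
  ((\1_I (p.2 - a * p.1))%:E * (\1_J (p.2 - c * p.1))%:E))%E.
  rewrite -ge0_integralZl//.
  - apply: eq_integral => p _; rewrite /pairs/= !psi_plane -!EFinM -/I -/J /g.
    by congr EFin; ring.
  - by apply: emeasurable_funM; apply/measurable_EFinP;
      [apply: (measurableT_comp mI1)|apply: (measurableT_comp mJ1)]; mfun.
  - by rewrite lee_fin mulr_ge0.
rewrite integral_lebesgue2E fubini_tonelli1/=; first last.
- by move=> p; rewrite mule_ge0// lee_fin.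
- by apply: emeasurable_funM; apply/measurable_EFinP;
    [apply: (measurableT_comp mI1)|apply: (measurableT_comp mJ1)]; mfun.
have -> := integral_parallelogram ac mI mJ.
rewrite muleA -EFinM mulrAC mulfV ?mul1r ?normr_eq0 ?subr_eq0//.
by rewrite /weighted_width /width /g EFinM; rewrite !muleA; congr (_ * _)%E; rewrite muleAC.
Qed.

(** Pairs of lines through a common point are sorted by the plane that they
    span. Within a plane the pair is free, so that the integral over pairs
    factors into a square. *)
Lemma integral_line_measure_sqr :
  (\int[lebesgue3 R]_P line_measure K P ^+ 2 =
   \int[mu2]_Q \int[mu]_e section_measure Q e ^+ 2)%E.
Proof.
pose F Q e A := (weighted_width Q e A.1 * weighted_width Q e A.2)%E.
have F0 Q e A : (0 <= F Q e A)%E by rewrite mule_ge0// weighted_width_ge0.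
transitivity (\int[mu3]_P \int[mu2]_A \int[mu2]_Q (pairs K P A Q)%:E)%E.
  by apply: eq_integral => P _; exact: line_measure_sqr.
have p0 P A Q : (0 <= (pairs K P A Q)%:E)%E by rewrite lee_fin pairs_ge0.
have mPAQ : measurable_fun setT (fun q : T3 * T2 * T2 => (pairs K q.1.1 q.1.2 q.2)%:E).
  by apply: measurable_pairs; mfun.
have mPA := measurable_fun_fubini_tonelli_F (m2 := mu2s) _ mPAQ (fun q => p0 _ _ _).
rewrite (fubini_tonelli (m1 := mu3s) (m2 := mu2s)
  (fun q => \int[mu2]_Q (pairs K q.1 q.2 Q)%:E)%E mPA); last first.
  by move=> q; exact: integral_ge0.
have mQeA : measurable_fun setT (fun q : T2 * rT * T2 => F q.1.1 q.1.2 q.2).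
  by apply: emeasurable_funM; apply: measurable_weighted_width; mfun.
have mAQe : measurable_fun setT (fun q : T2 * T2 * rT => F q.1.2 q.2 q.1.1).
  by apply: emeasurable_funM; apply: measurable_weighted_width; mfun.
have mAQ := measurable_fun_fubini_tonelli_F (m2 := mus) _ mAQe (fun q => F0 _ _ _).
transitivity (\int[mu2]_A \int[mu2]_Q \int[mu]_e F Q e A)%E.
  apply: eq_integral_offdiagonal.
  - exact: (measurable_fun_fubini_tonelli_G (m1 := mu3s) _ mPA
      (fun q => integral_ge0 _ (fun Q _ => p0 _ _ _))).
  - exact: (measurable_fun_fubini_tonelli_F (m2 := mu2s) _ mAQ
      (fun q => integral_ge0 _ (fun Q _ => F0 _ _ _))).
  move=> a c ac.
  have mPQ : measurable_fun setT (fun q : T3 * T2 => (pairs K q.1 (a, c) q.2)%:E).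
    by apply: measurable_pairs; mfun.
  rewrite (fubini_tonelli (m1 := mu3s) (m2 := mu2s)
    (fun q => (pairs K q.1 (a, c) q.2)%:E) mPQ (fun q => p0 _ _ _)).
  apply: eq_integral => Q _.
  rewrite (lebesgue3_planes Q.1 Q.2)//.
    by apply: eq_integral => e _; rewrite /= (integral_pairs_plane _ _ ac).
  by apply: measurable_pairs; mfun.
rewrite (fubini_tonelli (m1 := mu2s) (m2 := mu2s)
  (fun q => \int[mu]_e F q.2 e q.1)%E mAQ); last first.
  by move=> q; exact: integral_ge0.
apply: eq_integral => Q _ /=.
have mAe : measurable_fun setT (fun q : T2 * rT => F Q q.2 q.1).
  by apply: emeasurable_funM; apply: measurable_weighted_width; mfun.
rewrite (fubini_tonelli (m1 := mu2s) (m2 := mus) (fun q => F Q q.2 q.1) mAe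
  (fun q => F0 _ _ _)).
apply: eq_integral => e _; rewrite /section_measure ge0_integral_mul//.
- by apply: measurable_weighted_width; mfun.
- by apply: measurable_weighted_width; mfun.
- by move=> a; exact: weighted_width_ge0.
- by move=> a; exact: weighted_width_ge0.
Qed.

Lemma measurable_section_measure :
  measurable_fun setT (fun q : T2 * rT => section_measure q.1 q.2).
Proof.
have m1 : measurable_fun setT (fun q : T2 * rT * rT => weighted_width q.1.1 q.1.2 q.2).
  by apply: measurable_weighted_width; mfun.
exact: (measurable_fun_fubini_tonelli_F (m2 := mus) _ m1
  (fun q => weighted_width_ge0 _ _ _)).
Qed.

Lemma area_sectionE Q e : area (section Q e) =
  (\int[mu2]_p (\1_K (p, Q.2 * p.1 + Q.1 * p.2 + e)%R)%:E)%E.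
Proof.
have mS : measurable (section Q e : set T2).
  by apply: measurable_planar; exact: compact_section.
transitivity (mu2 (section Q e)).
  apply: eq_integral => x _; congr (mu _).
  by apply/seteqP; split => y; rewrite /xsection/= inE.
by rewrite -(setIT (section Q e)) -integral_indic// setIT.
Qed.

Lemma volume_sections Q : lebesgue3 R K = (\int[mu]_e area (section Q e))%E.
Proof.
have mK := measurable_body cK.
transitivity (\int[lebesgue3 R]_P (\1_K P)%:E)%E.
  by rewrite integral_indic// setIT.
rewrite (lebesgue3_planes Q.1 Q.2).
- by apply: eq_integral => e _; rewrite area_sectionE.
- by apply/measurable_EFinP; exact: measurable_indic.
- by move=> P; rewrite lee_fin.
Qed.

Lemma measurable_area_section :
  measurable_fun setT (fun q : T2 * rT => area (section q.1 q.2)).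
Proof.
have mK := measurable_body cK.
have m1 : measurable_fun setT (fun q : T2 * rT * T2 =>
    (\1_K (q.2, q.1.1.2 * q.2.1 + q.1.1.1 * q.2.2 + q.1.2)%R : R)%:E).
  apply/measurable_EFinP.
  have mI : measurable_fun setT (\1_K : T3 -> R) by exact: measurable_indic.
  by apply: (measurableT_comp mI); mfun.
have := measurable_fun_fubini_tonelli_F (m2 := mu2s) _ m1 (fun q => ltac:(by rewrite lee_fin)).
by apply: eq_measurable_fun => q _; rewrite area_sectionE.
Qed.

End plane_sections.

(** * The isoperimetric inequality in a plane section *)

Section shear.
Variables (R : realType) (C : set (R * R)) (c a0 : R).
Hypotheses (cC : compact C) (vC : convex2 C) (c_gt0 : 0 < c).
Local Notation rT := (measurableTypeR R).
Local Notation mu := (@lebesgue_measure R).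

Definition shear : set (R * R) := [set p | C (p.1 / c, p.2 + a0 * (p.1 / c))].

Lemma compact_shear : compact shear.
Proof.
have c0 : c != 0 by rewrite gt_eqF.
have -> : shear = (fun p => (c * p.1, p.2 - a0 * p.1)) @` C.
  apply/seteqP; split => [[x y] Cp|_ [[x y] Cp] <-]; rewrite /shear/= in Cp *.
    exists (x / c, y + a0 * (x / c)) => //=; congr pair; first by rewrite mulrC divfK.
    by rewrite addrK.
  by rewrite mulrAC mulfV// mul1r subrK.
apply: continuous_compact => //; apply: continuous_subspaceT => p.
have c1 : (fun p : R * R => p.1) q @[q --> p] --> p.1 by exact: cvg_fst.
have c2 : (fun p : R * R => p.2) q @[q --> p] --> p.2 by exact: cvg_snd.
have h1 : (fun p : R * R => c * p.1) q @[q --> p] --> c * p.1.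
  by apply: cvgM; [exact: cvg_cst|exact: c1].
have h2 : (fun p : R * R => p.2 - a0 * p.1) q @[q --> p] --> p.2 - a0 * p.1.
  by apply: cvgB; [exact: c2|apply: cvgM; [exact: cvg_cst|exact: c1]].
exact: (cvg_pair h1 h2).
Qed.

Lemma convex_shear : convex2 shear.
Proof.
move=> p q s Cp Cq s01; have := vC Cp Cq s01; rewrite /shear/=.
by congr (C (_, _)); ring.
Qed.

Lemma shadow_shear t : shadow shear t = shadow C (a0 + c * t).
Proof.
have c0 : c != 0 by rewrite gt_eqF.
apply/seteqP; split => v [[x y]]; rewrite /shear/= => Cp h.
  exists (x / c, y + a0 * (x / c)) => //=; rewrite -[RHS]h.
  by field.
exists (c * x, y - a0 * x) => /=.
  by rewrite mulrAC mulfV// mul1r subrK.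
by rewrite -[RHS]h; ring.
Qed.

Lemma area_shear : area shear = (c%:E * area C)%E.
Proof.
have c0 : c != 0 by rewrite gt_eqF.
pose h (x : R) : \bar R := mu [set y | C (x, y)].
have mh : measurable_fun setT h by exact: measurable_fun_vsection.
have h0 x : (0 <= h x)%E by [].
have hT (x d : R) : mu [set y | C (x, y + d)] = h x.
  have mS : measurable ([set y | C (x, y)] : set rT).
    have := measurable_xsection (x : rT) (measurable_planar cC).
    by congr measurable; apply/seteqP; split => v; rewrite /xsection/= inE.
  have mI : measurable_fun setT (\1_[set y | C (x, y)] : rT -> R) by exact: measurable_indic.
  have mSd : measurable ([set y | C (x, y + d)] : set rT).
    have mT : measurable_fun setT (fun y : rT => y + d) by mfun.
    by have := mT measurableT _ mS; rewrite setTI.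
  rewrite /h -(setIT [set y | C (x, y)]) -integral_indic// (ge0_integral_affine d (oner_neq0 R))//.
    rewrite normr1 mul1e -(setIT [set y | C (x, y + d)]) -integral_indic//.
    by apply: eq_integral => y _; rewrite !indicE mul1r.
  exact/measurable_EFinP.
rewrite {2}/area -/h (ge0_integral_affine 0 (invr_neq0 c0) mh h0).
rewrite muleA -EFinM ger0_norm ?invr_ge0 ?ltW// mulfV// mul1e.
apply: eq_integral => x _; rewrite -(hT _ (a0 * (x / c))).
by rewrite addr0 [in RHS]mulrC.
Qed.

End shear.

Section normalized_section.
Variables (R : realType) (K : set (E3 R)).
Hypotheses (cK : compact K) (vK : convex3 K).
Local Notation rT := (measurableTypeR R).
Local Notation T2 := (rT * rT)%type.
Local Notation mu := (@lebesgue_measure R).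
Local Notation mu2 := (@lebesgue2 R).
Local Notation mus := (@lebesgue_measure R : {sigma_finite_measure set rT -> \bar R}).
Local Notation mu2s := (@lebesgue2 R : {sigma_finite_measure set T2 -> \bar R}).
Implicit Types (Q : R * R) (e : R).

Definition tilt Q : R := 1 + Q.1 ^+ 2 + Q.2 ^+ 2.
Definition stretch Q : R := Num.sqrt (tilt Q) / (1 + Q.1 ^+ 2).
Definition slant Q : R := - (Q.2 * Q.1) / (1 + Q.1 ^+ 2).

(** An affine image of the plane section that is similar to the section for the
    Euclidean metric of its plane. *)
Definition normal_section Q e := shear (section K Q e) (stretch Q) (slant Q).

Lemma tilt_gt0 Q : 0 < tilt Q.
Proof. by rewrite /tilt -addrA ltr_wpDr ?addr_ge0 ?sqr_ge0. Qed.

Lemma stretch_gt0 Q : 0 < stretch Q.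
Proof. by rewrite divr_gt0 ?sqrtr_gt0 ?tilt_gt0// sqr1D_gt0. Qed.

Lemma compact_normal_section Q e : compact (normal_section Q e).
Proof. by apply: compact_shear (stretch_gt0 Q); exact: compact_section. Qed.

Lemma convex_normal_section Q e : convex2 (normal_section Q e).
Proof. by apply: convex_shear; exact: convex_section. Qed.

(** The direction (1, a, k + m a) has a square length that is a sum of squares
    up to the factor found here, once the slope a is measured in the coordinate
    t of the normalized section. *)
Lemma normalized_form Q (t : R) (a := slant Q + stretch Q * t) :
  1 + a ^+ 2 + (Q.2 + Q.1 * a) ^+ 2 = tilt Q / (1 + Q.1 ^+ 2) * (1 + t ^+ 2).
Proof.
have := sqr_sqrtr (ltW (tilt_gt0 Q)).
have : 1 + Q.1 ^+ 2 != 0 by rewrite gt_eqF// sqr1D_gt0.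
rewrite {}/a /slant /stretch; case: Q => m k /=; set s := Num.sqrt _.
rewrite /tilt/= => m0 sE; rewrite -sE.
have -> : 1 + (- (k * m) / (1 + m ^+ 2) + s / (1 + m ^+ 2) * t) ^+ 2 +
  (k + m * (- (k * m) / (1 + m ^+ 2) + s / (1 + m ^+ 2) * t)) ^+ 2 =
  1 + k ^+ 2 / (1 + m ^+ 2) + s ^+ 2 / (1 + m ^+ 2) * t ^+ 2 by field.
by rewrite sE; field.
Qed.

(** In normalized coordinates [gdens] becomes a constant multiple of the weight
    icos ^+ 3 in [shadow_length]. *)
Lemma section_measureE Q e : section_measure K Q e =
  ((Num.sqrt (1 + Q.1 ^+ 2) / tilt Q)%:E * shadow_length (normal_section Q e))%E.
Proof.
have m0 := sqr1D_gt0 Q.1; have D0 := tilt_gt0 Q; have c0 := stretch_gt0 Q.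
have mW : measurable_fun setT (weighted_width K Q e).
  by apply: measurable_weighted_width => //; mfun.
rewrite /section_measure (ge0_integral_affine (slant Q) (lt0r_neq0 c0) mW); last first.
  by move=> a; exact: weighted_width_ge0.
set B := Num.sqrt (1 + Q.1 ^+ 2); have B0 : 0 < B by rewrite sqrtr_gt0.
set s := Num.sqrt (tilt Q); have s0 : 0 < s by rewrite sqrtr_gt0.
have sE : s ^+ 2 = tilt Q by rewrite sqr_sqrtr// ltW.
have BE : B ^+ 2 = 1 + Q.1 ^+ 2 by rewrite sqr_sqrtr// ltW.
transitivity ((stretch Q)%:E * \int[mu]_t (((B / s) ^+ 3)%:E *
    ((icos t ^+ 3)%:E * mu (shadow (normal_section Q e) t))))%E.
  rewrite gtr0_norm//; congr (_ * _)%E; apply: eq_integral => t _.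
  rewrite /weighted_width /width /normal_section shadow_shear//.
  rewrite [stretch Q * t + slant Q]addrC muleA -EFinM; congr (_%:E * _)%E.
  rewrite /gdens normalized_form sqrtrM ?divr_ge0 ?ltW// sqrtrM ?ltW// sqrtrV ?ltW//.
  rewrite -/B -/s -exprVn -exprMn /icos; congr (_ ^+ 3); field.
  by rewrite !gt_eqF// sqrtr_gt0 sqr1D_gt0.
rewrite ge0_integralZl//.
- rewrite muleA -EFinM -/(shadow_length _); congr (_%:E * _)%E.
  by rewrite /stretch -/s -BE -sE; field; rewrite !gt_eqF.
- apply: emeasurable_funM; last first.
    by apply: measurable_fun_shadow; exact: compact_normal_section.
  apply/measurable_EFinP/measurable_funX; apply: continuous_measurable_fun.
  exact: continuous_icos.
- by move=> t _; rewrite mule_ge0// lee_fin exprn_ge0// ltW// icos_gt0.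
- by rewrite lee_fin exprn_ge0// divr_ge0 ?ltW.
Qed.

(** The square of the factor in [section_measureE]; by [area_normal_section] it
    is also the factor of the areas multiplied by [gdens]. *)
Definition section_weight Q : R := (1 + Q.1 ^+ 2) / tilt Q ^+ 2.

Lemma section_weight_gt0 Q : 0 < section_weight Q.
Proof. by rewrite divr_gt0 ?sqr1D_gt0// exprn_gt0// tilt_gt0. Qed.

Lemma section_measure_sqrE Q e : (section_measure K Q e ^+ 2 =
  (section_weight Q)%:E * shadow_length (normal_section Q e) ^+ 2)%E.
Proof.
have L0 := shadow_length_ge0 (normal_section Q e).
rewrite section_measureE; move: L0; case: (shadow_length _) => [L L0|_|//].
  rewrite -EFinM -!EFin_expe -EFinM; congr EFin; rewrite exprMn exprMn.
  by rewrite sqr_sqrtr ?exprVn// ltW// sqr1D_gt0.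
have r0 : 0 < Num.sqrt (1 + Q.1 ^+ 2) / tilt Q.
  by rewrite divr_gt0 ?tilt_gt0// sqrtr_gt0 sqr1D_gt0.
by rewrite !expe2 !mulyy gt0_muley ?lte_fin// mulyy gt0_muley// lte_fin section_weight_gt0.
Qed.

Lemma area_normal_section Q e : ((gdens Q.1 Q.2)%:E * area (section K Q e) =
  (section_weight Q)%:E * area (normal_section Q e))%E.
Proof.
rewrite area_shear ?stretch_gt0//; last exact: compact_section.
rewrite muleA -EFinM; congr (_%:E * _)%E.
rewrite /gdens -/(tilt Q) /section_weight /stretch -(sqr_sqrtr (ltW (tilt_gt0 Q))).
have := sqr1D_gt0 Q.1; have : 0 < Num.sqrt (tilt Q) by rewrite sqrtr_gt0 tilt_gt0.
set s := Num.sqrt _ => s0 m0; rewrite sqrtr_sqr gtr0_norm//.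
by field; rewrite !gt_eqF.
Qed.

Lemma section_isoperimetric Q e :
  ((4 * pi * gdens Q.1 Q.2)%:E * area (section K Q e) <= section_measure K Q e ^+ 2)%E.
Proof.
rewrite EFinM -muleA area_normal_section muleCA section_measure_sqrE.
apply: lee_wpmul2l; first by rewrite lee_fin ltW// section_weight_gt0.
by apply: planar_isoperimetric_inequality;
  [exact: compact_normal_section|exact: convex_normal_section].
Qed.

Definition dist2 (X Y : E3 R) : R :=
  (X.1.1 - Y.1.1) ^+ 2 + (X.1.2 - Y.1.2) ^+ 2 + (X.2 - Y.2) ^+ 2.

Definition on_plane Q e (X : E3 R) : Prop := X.2 = Q.2 * X.1.1 + Q.1 * X.1.2 + e.

(** The section is a disc up to its boundary circle, which is as much as the
    equality case provides. *)
Definition round_section Q e : Prop :=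
  (forall X Y, K X -> K Y -> on_plane Q e X -> on_plane Q e Y -> X = Y) \/
  exists O r, [/\ 0 < r, on_plane Q e O,
    forall X, on_plane Q e X -> dist2 X O < r -> K X &
    forall X, on_plane Q e X -> K X -> dist2 X O <= r].

Definition plane_coord Q (X : E3 R) : R * R :=
  (stretch Q * X.1.1, X.1.2 - slant Q * X.1.1).

Lemma normal_section_coord Q e X : on_plane Q e X ->
  normal_section Q e (plane_coord Q X) = K X.
Proof.
case: X => [[x y] z]; rewrite /on_plane /normal_section /shear /section/= => ->.
have c0 : stretch Q != 0 by rewrite gt_eqF ?stretch_gt0.
by rewrite mulrAC mulfV// mul1r subrK.
Qed.

(** The coordinates of [normal_section] are Euclidean coordinates of the plane
    up to the scale sqrt (1 + m ^ 2). *)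
Lemma dist2_coord Q e X Y : on_plane Q e X -> on_plane Q e Y ->
  dist2 X Y = (1 + Q.1 ^+ 2) * (((plane_coord Q X).1 - (plane_coord Q Y).1) ^+ 2 +
    ((plane_coord Q X).2 - (plane_coord Q Y).2) ^+ 2).
Proof.
case: X Y => [[x y] z] [[x' y'] z']; rewrite /on_plane /dist2/= => -> ->.
rewrite -mulrBr exprMn /stretch exprMn sqr_sqrtr ?ltW ?tilt_gt0// /slant /tilt.
by field; rewrite gt_eqF// sqr1D_gt0.
Qed.

Lemma section_isoperimetric_equality Q e :
  (section_measure K Q e ^+ 2 <= (4 * pi * gdens Q.1 Q.2)%:E * area (section K Q e))%E ->
  round_section Q e.
Proof.
have m0 := sqr1D_gt0 Q.1; have c0 := stretch_gt0 Q.
rewrite EFinM -muleA area_normal_section muleCA section_measure_sqrE.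
rewrite lee_pmul2l ?lte_fin ?section_weight_gt0//.
move=> /planar_isoperimetric_equality[].
- exact: compact_normal_section.
- exact: convex_normal_section.
- move=> H; left=> X Y KX KY pX pY.
  have := H (plane_coord Q X) (plane_coord Q Y).
  rewrite !(normal_section_coord (e := e))// => /(_ KX KY)[/(mulfI (lt0r_neq0 c0)) h1 h2].
  case: X Y {KX KY} pX pY h1 h2 => [[x y] z] [[x' y'] z']; rewrite /on_plane/=.
  move=> -> -> h1; rewrite {}h1 => h2.
  by have -> : y = y' by lra.
move=> [r [xc [yc [r0 H1 H2]]]]; right.
pose O : E3 R := (xc / stretch Q, yc + slant Q * (xc / stretch Q),
  Q.2 * (xc / stretch Q) + Q.1 * (yc + slant Q * (xc / stretch Q)) + e).
have pO : on_plane Q e O by [].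
have OE : plane_coord Q O = (xc, yc).
  by rewrite /plane_coord/= addrK mulrC divfK// gt_eqF.
exists O, ((1 + Q.1 ^+ 2) * r ^+ 2); split => //.
- by rewrite mulr_gt0// exprn_gt0.
- move=> X pX; rewrite (dist2_coord pX pO) OE ltr_pM2l//= => /H1.
  by rewrite -(normal_section_coord pX).
- move=> X pX KX; rewrite (dist2_coord pX pO) OE ler_pM2l//=; apply: H2.
  by rewrite -(normal_section_coord pX) in KX.
Qed.

(** The section is a disc around the foot of the perpendicular from the centre. *)
Lemma ball_section_equality (O : E3 R) (w : R) Q e :
  K = [set X | dist2 X O <= w] ->
  (section_measure K Q e ^+ 2 = (4 * pi * gdens Q.1 Q.2)%:E * area (section K Q e))%E.
Proof.
move=> KE; have m0 := sqr1D_gt0 Q.1; have D0 := tilt_gt0 Q; have c0 := stretch_gt0 Q.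
rewrite EFinM -muleA area_normal_section muleCA section_measure_sqrE; congr (_ * _)%E.
(* F is the foot of the perpendicular from O to the plane, at squared distance v ^ 2 * tilt Q. *)
pose v := (Q.2 * O.1.1 + Q.1 * O.1.2 + e - O.2) / tilt Q.
pose F : E3 R := (O.1.1 - v * Q.2, O.1.2 - v * Q.1, O.2 + v).
have pF : on_plane Q e F.
  by rewrite /on_plane /F /v /tilt/=; field; rewrite gt_eqF.
have dF X : on_plane Q e X -> dist2 X O = dist2 X F + v ^+ 2 * tilt Q.
  move=> pX.
  have vE : v * tilt Q = Q.2 * O.1.1 + Q.1 * O.1.2 + e - O.2 by rewrite /v divfK// gt_eqF.
  have eE : e = X.2 - Q.2 * X.1.1 - Q.1 * X.1.2 by rewrite pX; ring.
  have vE2 : v ^+ 2 * tilt Q = v * (Q.2 * (O.1.1 - X.1.1) + Q.1 * (O.1.2 - X.1.2) + (X.2 - O.2)).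
    by rewrite expr2 -mulrA vE eE; ring.
  have vE3 : v ^+ 2 * tilt Q = v ^+ 2 + v ^+ 2 * Q.1 ^+ 2 + v ^+ 2 * Q.2 ^+ 2 by rewrite /tilt; ring.
  by rewrite /dist2 /F/=; move: vE2; rewrite vE3; lra.
have -> : normal_section Q e = [set p | (p.1 - (plane_coord Q F).1) ^+ 2 +
    (p.2 - (plane_coord Q F).2) ^+ 2 <= (w - v ^+ 2 * tilt Q) / (1 + Q.1 ^+ 2)].
  apply/seteqP; have key p : exists2 X, on_plane Q e X & plane_coord Q X = p.
    exists (p.1 / stretch Q, p.2 + slant Q * (p.1 / stretch Q),
      Q.2 * (p.1 / stretch Q) + Q.1 * (p.2 + slant Q * (p.1 / stretch Q)) + e) => //.
    by rewrite /plane_coord/= addrK mulrC divfK ?gt_eqF// -surjective_pairing.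
  split=> p; have [X pX <-] := key p; rewrite (normal_section_coord pX) {1}KE /=;
    by rewrite ler_pdivlMr// mulrC -(dist2_coord pX pF) dF// lerBrDr.
exact: disc_isoperimetric_equality.
Qed.

Lemma area_section_fin Q e : area (section K Q e) \is a fin_num.
Proof.
have cS : compact (section K Q e) by exact: compact_section.
rewrite ge0_fin_numE ?area_ge0//.
have [M M0 HM] := planar_bounded cS.
pose I : set rT := `[- M, M]%classic.
have mI : measurable I by exact: measurable_itv.
have I1 : (mu I < +oo)%E.
  by rewrite /I lebesgue_measure_itv/=; case: ifP => _; rewrite -?EFinB ltry.
have -> : area (section K Q e) = mu2 (section K Q e).
  apply: eq_integral => x _; congr (mu _).
  by apply/seteqP; split => y; rewrite /xsection/= inE.
apply: (@le_lt_trans _ _ (mu2 (I `*` I))).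
  apply: le_measure; rewrite ?inE; [exact: measurable_planar|exact: measurableX|].
  by move=> [x y] /HM[x1 y1]; split; rewrite /I/= in_itv/= -ler_norml.
rewrite /lebesgue2 product_measure1E//.
by rewrite lte_mul_pinfty// ge0_fin_numE.
Qed.

Lemma volume_fin : lebesgue3 R K \is a fin_num.
Proof.
have [M [_ HM]] := compact_bounded cK.
pose I : set rT := `[- (`|M| + 1), `|M| + 1]%classic.
have mI : measurable I by exact: measurable_itv.
have I1 : (mu I < +oo)%E.
  by rewrite /I lebesgue_measure_itv/=; case: ifP => _; rewrite -?EFinB ltry.
have I2 : (mu2 (I `*` I) < +oo)%E.
  rewrite /lebesgue2 product_measure1E//.
  by rewrite lte_mul_pinfty// ge0_fin_numE.
rewrite ge0_fin_numE//; apply: (@le_lt_trans _ _ (@space_measure R ((I `*` I) `*` I))).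
  apply: le_measure; rewrite ?inE; [exact: measurable_body|by do 2 apply: measurableX => //|].
  move=> [[x y] z] KX; have : `|(x, y, z)| <= `|M| + 1.
    by apply: HM => //; rewrite (le_lt_trans (ler_norm _))// ltrDl.
  rewrite !prod_normE/= !ge_max => /andP[/andP[h1 h2] h3].
  by split; [split|]; rewrite /I/= in_itv/= -ler_norml.
rewrite /space_measure /lebesgue3/= product_measure1E//; last exact: measurableX.
apply: lte_mul_pinfty => //; rewrite ?ge0_fin_numE//.
Qed.

End normalized_section.

(** * Integration over all plane sections *)

Section line_measure_inequality.
Variables (R : realType) (K : set (E3 R)).
Hypotheses (cK : compact K) (vK : convex3 K).
Local Notation rT := (measurableTypeR R).
Local Notation T2 := (rT * rT)%type.
Local Notation T3 := (rT * rT * rT)%type.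
Local Notation mu := (@lebesgue_measure R).
Local Notation mu2 := (@lebesgue2 R).
Local Notation mu3 := (@space_measure R).
Local Notation mus := (@lebesgue_measure R : {sigma_finite_measure set rT -> \bar R}).
Local Notation mu2s := (@lebesgue2 R : {sigma_finite_measure set T2 -> \bar R}).
Local Open Scope ereal_scope.

Let f (q : T2 * rT) := (4 * pi * gdens q.1.1 q.1.2)%:E * area (section K q.1 q.2).
Let g (q : T2 * rT) := section_measure K q.1 q.2 ^+ 2.

Let c0 (Q : T2) : (0 <= 4 * pi * gdens Q.1 Q.2)%R.
Proof. by rewrite !mulr_ge0 ?pi_ge0 ?gdens_ge0. Qed.

Let f0 q : 0 <= f q.
Proof. by rewrite mule_ge0 ?area_ge0// lee_fin. Qed.

Let mf : measurable_fun setT f.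
Proof.
apply: emeasurable_funM; last exact: measurable_area_section.
by apply/measurable_EFinP; rewrite /gdens; mfun.
Qed.

Let mg : measurable_fun setT g.
Proof.
rewrite /g (_ : (fun q => _) = fun q => section_measure K q.1 q.2 * section_measure K q.1 q.2).
  by apply: emeasurable_funM; exact: measurable_section_measure.
by apply/funext => q; rewrite expe2.
Qed.

Let fg q : f q <= g q.
Proof. exact: section_isoperimetric. Qed.

Let int_f : \int[mu3]_q f q = (8 * pi ^+ 2)%:E * lebesgue3 R K.
Proof.
rewrite [LHS](fubini_tonelli1 (m1 := mu2s) (m2 := mus) f mf f0) /fubini_F.
transitivity (\int[mu2]_Q ((4 * pi * gdens Q.1 Q.2)%:E * lebesgue3 R K)).
  apply: eq_integral => Q _; rewrite (volume_sections cK Q) /f/= ge0_integralZl//.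
  - have mQ : measurable_fun setT (fun e : rT => (Q, e)) by mfun.
    exact: (measurableT_comp (measurable_area_section cK) mQ).
  - by move=> e _; exact: area_ge0.
  - by rewrite lee_fin.
have mD : measurable_fun setT (fun Q : T2 => (4 * pi * gdens Q.1 Q.2)%:E).
  by apply/measurable_EFinP; rewrite /gdens; mfun.
rewrite ge0_integralZr//; last by move=> Q _; rewrite lee_fin.
congr (_ * _); rewrite integral_lebesgue2E fubini_tonelli1//.
transitivity (\int[mu]_m ((4 * pi)%:E * \int[mu]_k (gdens m k)%:E)).
  apply: eq_integral => m _; rewrite -ge0_integralZl//.
  - by apply/measurable_EFinP; rewrite /gdens; mfun.
  - by move=> k _; rewrite lee_fin gdens_ge0.
  - by rewrite lee_fin mulr_ge0 ?pi_ge0.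
rewrite ge0_integralZl//.
- rewrite [X in _ * X]integral_gnomonic_density -EFinM; congr EFin; ring.
- have mG : measurable_fun setT (fun Q : T2 => (gdens Q.1 Q.2)%:E).
    by apply/measurable_EFinP; rewrite /gdens; mfun.
  have G0 (Q : T2) : 0 <= (gdens Q.1 Q.2)%:E by rewrite lee_fin gdens_ge0.
  exact: (measurable_fun_fubini_tonelli_F (m2 := mus) _ mG G0).
- by move=> m _; apply: integral_ge0 => k _; rewrite lee_fin gdens_ge0.
- by rewrite lee_fin mulr_ge0 ?pi_ge0.
Qed.

Let int_g : \int[lebesgue3 R]_P line_measure K P ^+ 2 = \int[mu3]_q g q.
Proof.
rewrite integral_line_measure_sqr//.
by rewrite [RHS](fubini_tonelli1 (m1 := mu2s) (m2 := mus) g mg (fun q => sqre_ge0 _)).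
Qed.

(** The isoperimetric inequality is integrated over all planes: the areas of
    parallel sections add up to the volume, and the factor [gdens] of the
    slopes has integral 2 pi. *)
Lemma volume_le_line_measure :
  (8 * pi ^+ 2)%:E * lebesgue3 R K <= \int[lebesgue3 R]_P line_measure K P ^+ 2.
Proof. by rewrite int_g -int_f; apply: ge0_le_integral => // q _; exact: sqre_ge0. Qed.

Lemma ball_line_measure (O : E3 R) (w : R) : K = [set X | (dist2 X O <= w)%R] ->
  \int[lebesgue3 R]_P line_measure K P ^+ 2 = (8 * pi ^+ 2)%:E * lebesgue3 R K.
Proof.
move=> KE; rewrite int_g -int_f; apply: eq_integral => q _.
exact: ball_section_equality KE.
Qed.

(** Between functions with the same finite integral, an inequality is an
    equality almost everywhere. *)
Lemma ae_round_section :
  \int[lebesgue3 R]_P line_measure K P ^+ 2 <= (8 * pi ^+ 2)%:E * lebesgue3 R K ->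
  {ae mu3, forall q, round_section K q.1 q.2}.
Proof.
rewrite int_g -int_f => gf.
have foo : \int[mu3]_q f q < +oo.
  rewrite int_f -ge0_fin_numE; last first.
    by apply: mule_ge0; [rewrite lee_fin mulr_ge0 ?sqr_ge0|exact: measure_ge0].
  by apply: fin_numM; [|exact: volume_fin].
have ff q : setT q -> f q \is a fin_num.
  by move=> _; apply: fin_numM; [|exact: area_section_fin].
have := ge0_integral_eq_ae measurableT mf mg (fun q _ => f0 q) ff (fun q _ => fg q) gf foo.
apply: filterS => q /(_ I) gq; apply: section_isoperimetric_equality.
- exact: cK.
- exact: vK.
- by rewrite -[X in X <= _]/(g q) gq.
Qed.

End line_measure_inequality.

(** * Integration over longitudes *)

Section angular_integrals.
Variable R : realType.
Local Notation mu := (@lebesgue_measure R).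
Local Open Scope ereal_scope.
Variable f : R -> \bar R.
Hypotheses (mf : measurable_fun setT f) (f0 : forall x, 0 <= f x).

Lemma ge0_integral_affine_on (c t : R) (D D' : set R) : c != 0%R ->
  measurable (D : set (measurableTypeR R)) -> measurable (D' : set (measurableTypeR R)) ->
  (forall x, D' x <-> D (c * x + t)%R) ->
  \int[mu]_(x in D) f x = `|c|%:E * \int[mu]_(x in D') f (c * x + t)%R.
Proof.
move=> c0 mD mD' DD'; rewrite integral_mkcond (ge0_integral_affine t c0).
- congr (_ * _); rewrite [RHS]integral_mkcond; apply: eq_integral => x _.
  rewrite !patchE; case: ifPn; case: ifPn => //; rewrite ?notin_setE ?inE/=.
    by move=> h1 /DD'.
  by move=> /DD'.
- by apply/(measurable_restrictT _ _).1 => //; exact: measurable_funTS.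
- by move=> x; rewrite patchE; case: ifP.
Qed.

Lemma ge0_integral_itv_split (a b c : R) : (a <= b)%R -> (b <= c)%R ->
  \int[mu]_(x in `[a, c]) f x = \int[mu]_(x in `[a, b]) f x + \int[mu]_(x in `[b, c]) f x.
Proof.
move=> ab bc; rewrite -[X in _ = X + _]integral_itv_bndo_bndc; last exact: measurable_funTS.
rewrite -ge0_integral_setU//.
- congr integral; apply/seteqP; split => x /=; rewrite !in_itv/=.
    by move=> /andP[-> xc]; rewrite xc !andbT /=; case: ltP; [left|right].
  by move=> [/andP[-> /ltW xb]|/andP[bx ->]]; rewrite ?(le_trans xb)// (le_trans ab).
- exact: measurable_funTS.
- apply/disj_setPRL => x /=; rewrite !in_itv/= => /andP[bx _] /andP[_].
  by rewrite ltNge bx.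
Qed.

(** Up to end points, ]-pi/2, pi/2[ and its translate by pi make up a full
    turn. *)
Lemma ge0_integral_period :
  (forall x, f (x + 2 * pi)%R = f x) ->
  \int[mu]_(x in `[0%R, (2 * pi)%R]) f x =
  \int[mu]_(x in `](- (pi / 2))%R, (pi / 2)%R[) (f x + f (x + pi)%R).
Proof.
have p0 := pi_gt0 R.
have e1 : (- (pi / 2) + pi = pi / 2 :> R)%R by lra.
have e2 : (pi / 2 + pi = 3 / 2 * pi :> R)%R by lra.
have e3 : (- (pi / 2) + 2 * pi = 3 / 2 * pi :> R)%R by lra.
move=> fper.
have shift (a b t : R) : \int[mu]_(x in `[(a + t)%R, (b + t)%R]) f x =
    \int[mu]_(x in `[a, b]) f (x + t)%R.
  rewrite (ge0_integral_affine_on (c := 1) (t := t) (D' := `[a, b]%classic))//.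
  - by rewrite normr1 mul1e; apply: eq_integral => x _; rewrite mul1r.
  - by move=> x; rewrite /= !in_itv/= mul1r !lerD2r.
rewrite (@ge0_integral_itv_split _ (pi / 2)); [|lra|lra].
rewrite (@ge0_integral_itv_split (pi / 2) (3 / 2 * pi)); [|lra|lra].
have -> : (\int[mu]_(x in `[(pi / 2)%R, (3 / 2 * pi)%R]) f x =
    \int[mu]_(x in `[(- (pi / 2))%R, (pi / 2)%R]) f (x + pi)%R).
  by rewrite -shift e1 e2.
have -> : (\int[mu]_(x in `[(3 / 2 * pi)%R, (2 * pi)%R]) f x =
    \int[mu]_(x in `[(- (pi / 2))%R, 0%R]) f x).
  transitivity (\int[mu]_(x in `[(- (pi / 2))%R, 0%R]) f (x + 2 * pi)%R).
    by rewrite -shift e3 add0r.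
  by apply: eq_integral => x _; rewrite fper.
rewrite [X in _ + X]addeC addeA [X in X + _]addeC -ge0_integral_itv_split; [|lra|lra].
have mfp : measurable_fun setT (fun x : R => f (x + pi)%R).
  by apply: (measurableT_comp mf); mfun.
rewrite ge0_integralD//; [|exact: measurable_funTS..].
by rewrite !integral_itv_bndo_bndc ?integral_itv_obnd_cbnd//; exact: measurable_funTS.
Qed.

End angular_integrals.

(** * The cone of directions towards a body *)

Section cone.
Variables (R : realType) (K : set (E3 R)) (P : E3 R).
Hypotheses (cK : compact K) (vK : convex3 K) (PK : ~ K P).
Local Notation rT := (measurableTypeR R).
Local Notation T3 := (rT * rT * rT)%type.

Definition norm1 (v : E3 R) : R := `|v.1.1| + `|v.1.2| + `|v.2|.

Definition from (X : E3 R) : E3 R := (X.1.1 - P.1.1, X.1.2 - P.1.2, X.2 - P.2).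

(** The cone over K with apex P; clearing the scalar by norms turns the half-line
    condition into the vanishing of a continuous function of the point of K. *)
Definition cone : set T3 := [set v | exists2 X, K X &
  `|norm1 v * (from X).1.1 - norm1 (from X) * v.1.1| +
  `|norm1 v * (from X).1.2 - norm1 (from X) * v.1.2| +
  `|norm1 v * (from X).2 - norm1 (from X) * v.2| = 0].

Lemma norm1_ge0 v : 0 <= norm1 v.
Proof. by rewrite !addr_ge0. Qed.

Lemma norm1_gt0 v : v.1.1 != 0 \/ v.1.2 != 0 \/ v.2 != 0 -> 0 < norm1 v.
Proof.
have [h1 [h2 h3]] := (normr_ge0 v.1.1, (normr_ge0 v.1.2, normr_ge0 v.2)).
by rewrite -3!normr_gt0 /norm1 => -[|[]]; lra.
Qed.

Lemma measurable_cone : measurable cone.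
Proof.
apply: measurable_compact_exists => //; first exact: dense_seq_E3.
  by move=> X; rewrite /norm1; mfun.
move=> v X.
have c11 : (fun X : E3 R => X.1.1 - P.1.1) Y @[Y --> X] --> X.1.1 - P.1.1.
  by apply: cvgB; [exact: continuous_x|exact: cvg_cst].
have c12 : (fun X : E3 R => X.1.2 - P.1.2) Y @[Y --> X] --> X.1.2 - P.1.2.
  by apply: cvgB; [exact: continuous_y|exact: cvg_cst].
have c2 : (fun X : E3 R => X.2 - P.2) Y @[Y --> X] --> X.2 - P.2.
  by apply: cvgB; [exact: cvg_snd|exact: cvg_cst].
have cN : (fun X : E3 R => norm1 (from X)) Y @[Y --> X] --> norm1 (from X).
  by apply: cvgD; [apply: cvgD|]; apply: cvg_norm.
by apply: cvgD; [apply: cvgD|]; apply: cvg_norm; apply: cvgB;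
  apply: cvgM; try exact: cvg_cst; assumption.
Qed.

Lemma coneP v : 0 < norm1 v -> cone v <->
  exists2 t : R, 0 <= t & K (P.1.1 + t * v.1.1, P.1.2 + t * v.1.2, P.2 + t * v.2).
Proof.
move=> v0; split=> [[X KX]|[t t0 Kt]].
  move=> /eqP; rewrite !paddr_eq0 ?addr_ge0// !normr_eq0 !subr_eq0 -andbA.
  move=> /and3P[/eqP h1 /eqP h2 /eqP h3].
  exists (norm1 (from X) / norm1 v); first by rewrite divr_ge0// norm1_ge0.
  have div a b : norm1 v * a = norm1 (from X) * b -> norm1 (from X) / norm1 v * b = a.
    by move=> e; rewrite mulrAC -e mulrAC mulfV ?mul1r// gt_eqF.
  rewrite (div _ _ h1) (div _ _ h2) (div _ _ h3) /from/= !subrKC.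
  by case: X KX {h1 h2 h3 div} => [[]].
exists (P.1.1 + t * v.1.1, P.1.2 + t * v.1.2, P.2 + t * v.2) => //.
have -> : from (P.1.1 + t * v.1.1, P.1.2 + t * v.1.2, P.2 + t * v.2) =
    (t * v.1.1, t * v.1.2, t * v.2) by rewrite /from/= ![_ + _ * _]addrC !addrK.
rewrite /norm1/= !normrM (ger0_norm t0).
have z (a b : R) : a = b -> `|a - b| = 0 by move=> ->; rewrite subrr normr0.
by rewrite !z ?addr0//; ring.
Qed.

Lemma cone_scale s v : 0 < s -> cone (s * v.1.1, s * v.1.2, s * v.2) = cone v.
Proof.
move=> s0; have nE : norm1 (s * v.1.1, s * v.1.2, s * v.2) = s * norm1 v.
  by rewrite /norm1/= !normrM (gtr0_norm s0); ring.
rewrite /cone /= propeqE.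
suff E X : `|norm1 (s * v.1.1, s * v.1.2, s * v.2) * (from X).1.1 - norm1 (from X) * (s * v.1.1)| +
  `|norm1 (s * v.1.1, s * v.1.2, s * v.2) * (from X).1.2 - norm1 (from X) * (s * v.1.2)| +
  `|norm1 (s * v.1.1, s * v.1.2, s * v.2) * (from X).2 - norm1 (from X) * (s * v.2)| =
  s * (`|norm1 v * (from X).1.1 - norm1 (from X) * v.1.1| +
  `|norm1 v * (from X).1.2 - norm1 (from X) * v.1.2| +
  `|norm1 v * (from X).2 - norm1 (from X) * v.2|).
  split=> -[X KX]; rewrite ?E => h; exists X => //; rewrite ?E ?h ?mulr0//.
  by apply/(mulfI (lt0r_neq0 s0)); rewrite h mulr0.
have z (n N a b : R) : `|s * n * a - N * (s * b)| = s * `|n * a - N * b|.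
  by rewrite -[in RHS](gtr0_norm s0) -normrM (_ : s * n * a - _ = s * (n * a - N * b))//; ring.
by rewrite nE !z -!mulrDr.
Qed.

Lemma cone_hits a b : hits K (P, (a, b)) <-> cone (1, a, b) \/ cone (-1, - a, - b).
Proof.
have n1 c d : 0 < norm1 (1, c, d) by apply: norm1_gt0; left => /=; rewrite oner_eq0.
have n2 c d : 0 < norm1 (-1, c, d).
  by apply: norm1_gt0; left => /=; rewrite oppr_eq0 oner_eq0.
rewrite !coneP//=; split.
  move=> [X KX /eqP]; rewrite paddr_eq0// !normr_eq0 /= => /andP[/eqP h1 /eqP h2].
  have XE t : X.1.1 - P.1.1 = t -> X = (P.1.1 + t * 1, P.1.2 + t * a, P.2 + t * b).
    move=> tE; rewrite (surjective_pairing X) (surjective_pairing X.1).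
    by congr (_, _, _); nra.
  have [h|h] := leP 0 (X.1.1 - P.1.1); [left|right].
    by exists (X.1.1 - P.1.1) => //; rewrite -XE.
  exists (- (X.1.1 - P.1.1)); first by lra.
  by rewrite !mulrNN -XE.
by move=> [] [t _ Kt]; [exists (P.1.1 + t * 1, P.1.2 + t * a, P.2 + t * b)|
   exists (P.1.1 + t * -1, P.1.2 + t * - a, P.2 + t * - b)] => //=; apply/eqP;
  rewrite paddr_eq0// !normr_eq0; apply/andP; split; apply/eqP; ring.
Qed.

(** If K met both half-lines, P would be on a segment between two points of K. *)
Lemma cone_opp a b : cone (1, a, b) -> cone (-1, - a, - b) -> False.
Proof.
have n1 : 0 < norm1 (1, a, b) by apply: norm1_gt0; left => /=; rewrite oner_eq0.
have n2 : 0 < norm1 (-1, - a, - b).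
  by apply: norm1_gt0; left => /=; rewrite oppr_eq0 oner_eq0.
rewrite !coneP//= => -[t t0 Kt] [s s0 Ks]; apply: PK.
have [ts|ts] := eqVneq (t + s) 0.
  have tE : t = 0 by lra.
  by move: Kt; rewrite tE !mul0r !addr0; case: P => [[]].
have ts0 : 0 < t + s by rewrite lt_neqAle eq_sym ts addr_ge0.
have h01 : 0 <= t / (t + s) <= 1.
  by rewrite divr_ge0 ?(ltW ts0)//= ler_pdivrMr// mul1r lerDl s0.
have := vK Kt Ks h01; set Z := (X in K X -> _); suff -> : Z = P by [].
rewrite /Z; case: P => [[x y] z] /=.
by congr (_, _, _); field.
Qed.

Lemma indic_hits a b :
  \1_(hits K) (P, (a, b)) = \1_cone (1, a, b) + \1_cone (-1, - a, - b) :> R.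
Proof.
rewrite !indicE; have := cone_hits a b; have := @cone_opp a b.
case: (boolP ((1, a, b) \in cone)); case: (boolP ((-1, - a, - b) \in cone));
  rewrite ?inE ?notin_setE => h1 h2 h3 h4.
- by exfalso; exact: h3.
- by rewrite addr0 mem_set//; apply/h4; left.
- by rewrite add0r mem_set//; apply/h4; right.
- by rewrite addr0 memNset// => /h4[].
Qed.

Lemma solid_angle_cone a :
  \1_(solid_angle K P) (sphere_point a) = \1_cone (sphere_point a) :> R.
Proof.
have e1 : sin a.1 ^+ 2 * cos a.2 ^+ 2 + sin a.1 ^+ 2 * sin a.2 ^+ 2 + cos a.1 ^+ 2 = 1.
  by rewrite -mulrDr cos2Dsin2 mulr1 addrC cos2Dsin2.
have n0 : 0 < norm1 (sphere_point a).
  apply: norm1_gt0; rewrite /sphere_point/=; apply: contrapT => /not_orP[].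
  move=> /negP/negPn/eqP h1 /not_orP[/negP/negPn/eqP h2 /negP/negPn/eqP h3].
  by move: e1; rewrite -!exprMn h1 h2 h3 !expr0n/= !addr0 => /esym/eqP; rewrite oner_eq0.
have eN : enorm (sphere_point a) = 1.
  by rewrite /enorm/= !exprMn e1 sqrtr1.
rewrite !indicE; congr (_%:R); congr nat_of_bool; apply/idP/idP; rewrite !inE.
  by move=> [_ [t t0 Kt]]; apply/coneP => //; exists t.
by move=> /coneP-/(_ n0)[t t0 Kt]; split => //; exists t.
Qed.

End cone.

(** * The visual angle as a measure of lines *)

Section visual_angle.
Variables (R : realType) (K : set (E3 R)) (P : E3 R).
Hypotheses (cK : compact K) (vK : convex3 K).
Local Notation rT := (measurableTypeR R).
Local Notation T2 := (rT * rT)%type.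
Local Notation T3 := (rT * rT * rT)%type.
Local Notation mu := (@lebesgue_measure R).
Local Notation mus := (@lebesgue_measure R : {sigma_finite_measure set rT -> \bar R}).

Let tau (x y z : R) : R := \1_(cone K P) (x, y, z).

Let tau0 x y z : 0 <= tau x y z.
Proof. by []. Qed.

Let mtau d (T : measurableType d) (f g h : T -> R) :
  measurable_fun setT f -> measurable_fun setT g -> measurable_fun setT h ->
  measurable_fun setT (fun x => tau (f x) (g x) (h x)).
Proof.
move=> mf mg mh.
have mI : measurable_fun setT (\1_(cone K P) : T3 -> R).
  exact: measurable_indic (measurable_cone P cK).
by apply: (measurableT_comp mI); mfun.
Qed.

Let msin : measurable_fun setT (sin : R -> R).
Proof. by apply: continuous_measurable_fun; exact: continuous_sin. Qed.

Let mcos : measurable_fun setT (cos : R -> R).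
Proof. by apply: continuous_measurable_fun; exact: continuous_cos. Qed.

Let tau_scale s x y z : 0 < s -> tau (s * x) (s * y) (s * z) = tau x y z.
Proof.
move=> s0; have /= e := cone_scale K P (x, y, z) s0.
rewrite /tau !indicE; congr (_%:R); congr nat_of_bool.
by apply/idP/idP; rewrite !inE e.
Qed.

(** The share of the visual angle on the meridian of longitude phi, in terms of
    the cotangent c of the colatitude. *)
Definition meridian (phi : R) : \bar R :=
  (\int[mu]_c (tau (cos phi) (sin phi) c * icos c ^+ 3)%:E)%E.

Let meridianE (phi : R) :
  (\int[mu]_(theta in `[0%R, pi]) (tau (sin theta * cos phi) (sin theta * sin phi) (cos theta)
     * `|sin theta|)%:E = meridian phi)%E.
Proof.
have mF : measurable_fun setT (fun theta : R => (tau (sin theta * cos phi)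
    (sin theta * sin phi) (cos theta) * `|sin theta|)%:E).
  by apply/measurable_EFinP/measurable_funM; [apply: mtau|]; mfun.
rewrite (ge0_integral_affine_on mF _ (c := -1) (t := pi / 2)
  (D' := `[(- (pi / 2))%R, (pi / 2)%R]%classic))//; first last.
- by move=> p; rewrite /= !in_itv/= mulN1r; split=> /andP[h1 h2]; apply/andP; split; lra.
- by move=> theta; rewrite lee_fin mulr_ge0.
rewrite normrN1 mul1e.
have mF2 : measurable_fun setT (fun p : R => (tau (cos p * cos phi) (cos p * sin phi) (sin p)
  * `|cos p|)%:E).
  by apply/measurable_EFinP/measurable_funM; [apply: mtau|]; mfun.
transitivity (\int[mu]_(p in `[(- (pi / 2))%R, (pi / 2)%R])
  (tau (cos p * cos phi) (cos p * sin phi) (sin p) * `|cos p|)%:E)%E.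
  apply: eq_integral => p _.
  have -> : sin (-1 * p + pi / 2) = cos p by rewrite sinDpihalf mulN1r cosN.
  by have -> : cos (-1 * p + pi / 2) = sin p by rewrite cosDpihalf mulN1r sinN opprK.
rewrite -integral_itv_bndo_bndc; last exact: measurable_funTS.
rewrite -integral_itv_obnd_cbnd; last exact: measurable_funTS.
pose f (c : R) : \bar R := (tau (cos phi) (sin phi) c * icos c)%:E.
have f0 c : (0 <= f c)%E by rewrite lee_fin mulr_ge0// ltW// icos_gt0.
have mf : measurable_fun setT f.
  by apply/measurable_EFinP/measurable_funM; [apply: mtau|rewrite /icos]; mfun.
transitivity (\int[mu]_(p in `](- (pi / 2))%R, (pi / 2)%R[) f (tan p))%E.
  apply: eq_integral => p; rewrite inE/= in_itv/= => pD.
  have cp := cos_gt0_pihalf pD; rewrite /f; congr EFin.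
  have -> : icos (tan p) = cos p.
    rewrite /icos -cos2_tan2 ?gt_eqF// -exprVn sqrtr_sqr ger0_norm ?invrK//.
    by rewrite invr_ge0 ltW.
  rewrite (gtr0_norm cp); congr (_ * _); rewrite -(tau_scale _ _ (tan p) cp).
  by rewrite /tan [in cos p * (_ / _)]mulrC divfK// gt_eqF.
rewrite ge0_integral_tan//; apply: eq_integral => c _.
by rewrite /f -icos_sqr -EFinM -mulrA -exprS.
Qed.

Let mmeridian : measurable_fun setT meridian.
Proof.
have m2 : measurable_fun setT (fun q : T2 => (tau (cos q.1) (sin q.1) q.2 * icos q.2 ^+ 3)%:E).
  apply/measurable_EFinP/measurable_funM; last by rewrite /icos; mfun.
  by apply: mtau; [apply: (measurableT_comp mcos)|apply: (measurableT_comp msin)|]; mfun.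
apply: (measurable_fun_fubini_tonelli_F (m2 := mus) _ m2) => q.
by rewrite lee_fin mulr_ge0// exprn_ge0// ltW// icos_gt0.
Qed.

Let meridian0 phi : (0 <= meridian phi)%E.
Proof. by apply: integral_ge0 => c _; rewrite lee_fin mulr_ge0// exprn_ge0// ltW// icos_gt0. Qed.

(** Central projection of the meridian to the plane x = s, for the half with s
    = 1 or s = -1. *)
Let meridian_half (phi s : R) : (0 < cos phi) -> s ^+ 2 = 1 ->
  (\int[mu]_c (tau (s * cos phi) (s * sin phi) c * icos c ^+ 3)%:E =
   (1 + tan phi ^+ 2)%:E * \int[mu]_b (gdens (tan phi) b * tau s (s * tan phi) (s * b))%:E)%E.
Proof.
move=> cp s1.
have s0 : s != 0 by apply/eqP => s0; move: s1; rewrite s0 expr0n => /esym/eqP; rewrite oner_eq0.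
have ns : `|s| = 1.
  by move/eqP: s1; rewrite sqrf_eq1 => /orP[] /eqP ->; rewrite ?normrN1 ?normr1.
have c0 : s * cos phi != 0 by rewrite mulf_neq0// gt_eqF.
have mF : measurable_fun setT (fun c : R => (tau (s * cos phi) (s * sin phi) c * icos c ^+ 3)%:E).
  by apply/measurable_EFinP/measurable_funM; [apply: mtau|rewrite /icos]; mfun.
rewrite (ge0_integral_affine 0 c0 mF); last first.
  by move=> c; rewrite lee_fin mulr_ge0// exprn_ge0// ltW// icos_gt0.
rewrite normrM ns mul1r (gtr0_norm cp).
have mG (a : R) : measurable_fun setT (fun b : R => (gdens a b * tau s (s * a) (s * b))%:E).
  by apply/measurable_EFinP/measurable_funM; [rewrite /gdens; mfun|apply: mtau; mfun].
have G0 a b : (0 <= (gdens a b * tau s (s * a) (s * b))%:E)%E.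
  by rewrite lee_fin mulr_ge0// gdens_ge0.
have tE : 1 + tan phi ^+ 2 = (cos phi)^-1 ^+ 2 by rewrite -cos2_tan2 ?exprVn// gt_eqF.
have t0 := sqr1D_gt0 (tan phi).
rewrite -!ge0_integralZl//; last by rewrite lee_fin ltW.
- apply: eq_integral => b _; rewrite -!EFinM; congr EFin.
  have -> : tau (s * cos phi) (s * sin phi) (s * cos phi * b + 0) = tau s (s * tan phi) (s * b).
    rewrite -[RHS](tau_scale _ _ _ cp) /tan.
    apply: (@f_equal3 _ _ _ _ tau); first exact: mulrC.
      by rewrite [RHS]mulrC -mulrA divfK// gt_eqF.
    by rewrite addr0 -mulrA mulrCA.
  suff -> : icos (s * cos phi * b + 0) ^+ 3 = (cos phi)^-1 ^+ 3 * gdens (tan phi) b.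
    rewrite tE.
    move: (tau _ _ _) (gdens _ _) (lt0r_neq0 cp); move: (cos phi) => C u g C0.
    by field.
  rewrite /gdens /icos addr0 -exprVn -exprMn; congr (_ ^+ 3).
  have -> : 1 + tan phi ^+ 2 + b ^+ 2 = (cos phi)^-1 ^+ 2 * (1 + (s * cos phi * b) ^+ 2).
    rewrite tE !exprMn s1; move: (lt0r_neq0 cp); move: (cos phi) => C C0.
    by field.
  rewrite sqrtrM ?sqr_ge0// sqrtr_sqr ger0_norm ?invr_ge0 ?ltW// invfM invrK mulrA.
  by rewrite mulVf ?mul1r// gt_eqF.
all: try exact: mG.
all: try by rewrite lee_fin ltW.
have mA : measurable_fun setT (fun c : R => s * cos phi * c + 0).
  by apply: measurable_funD; mfun.
exact: (measurableT_comp mF mA).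
by move=> c _; rewrite lee_fin mulr_ge0// exprn_ge0// ltW// icos_gt0.
Qed.

(** Under central projection the area element sin theta becomes [gdens]. The
    longitudes phi and phi + pi carry opposite half-lines of the same lines,
    and by convexity at most one of the two meets K, so that the two
    contributions add up to an indicator. *)
Lemma sphere_area_solid_angle : ~ K P ->
  sphere_area (solid_angle K P) = line_measure K P.
Proof.
move=> PK.
transitivity (\int[mu]_(phi in `[0%R, (2 * pi)%R]) meridian phi)%E.
  pose F (a : T2) : \bar R := (\1_(`[0%R, pi] : set R) a.1 * (\1_(`[0%R, (2 * pi)%R] : set R) a.2 *
    (tau (sin a.1 * cos a.2) (sin a.1 * sin a.2) (cos a.1) * `|sin a.1|)))%:E.
  have F0 a : (0 <= F a)%E by rewrite lee_fin !mulr_ge0.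
  have mI (I : set rT) : measurable I -> measurable_fun setT (\1_I : rT -> R).
    by move=> ?; exact: measurable_indic.
  have mF : measurable_fun setT F.
    apply/measurable_EFinP; apply: measurable_funM.
      by apply: (measurableT_comp (mI _ _)) => //; mfun.
    apply: measurable_funM; first by apply: (measurableT_comp (mI _ _)) => //; mfun.
    have m1 : measurable_fun setT (fun a : T2 => sin a.1) by apply: (measurableT_comp msin); mfun.
    have m2 : measurable_fun setT (fun a : T2 => cos a.1) by apply: (measurableT_comp mcos); mfun.
    have m3 : measurable_fun setT (fun a : T2 => sin a.2) by apply: (measurableT_comp msin); mfun.
    have m4 : measurable_fun setT (fun a : T2 => cos a.2) by apply: (measurableT_comp mcos); mfun.
    by apply: measurable_funM; [apply: mtau|]; mfun.
  transitivity (\int[(mu \x mu)%E]_a F a)%E.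
    rewrite /sphere_area [LHS]integral_mkcond; apply: eq_integral => a _.
    rewrite patchE /F; case: ifPn; rewrite ?inE ?notin_setE/=.
      move=> [a1 a2]; rewrite (_ : \1__ a.1 = 1); last by rewrite indicE mem_set.
      rewrite (_ : \1__ a.2 = 1); last by rewrite indicE mem_set.
      rewrite !mul1r solid_angle_cone ger0_norm//.
      by apply: sin_ge0_pi; move: a1; rewrite /= in_itv.
    move=> H; rewrite !indicE.
    case: (boolP (a.1 \in `[0, pi]%classic)); rewrite ?mul0r// inE => a1.
    case: (boolP (a.2 \in `[0, 2 * pi]%classic)); rewrite ?mul0r ?mulr0// inE => a2.
    by exfalso; apply: H.
  apply: (eq_trans (fubini_tonelli2 (m1 := mus) (m2 := mus) F mF F0)).
  rewrite [RHS]integral_mkcond; apply: eq_integral => phi _.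
  rewrite /fubini_G patchE.
  case: ifPn => hphi; last first.
    by apply: integral0_eq => theta _; rewrite /F/= !indicE (negbTE hphi) mul0r mulr0.
  rewrite -meridianE [RHS]integral_mkcond; apply: eq_integral => theta _.
  rewrite /F/= patchE !indicE hphi mul1r; case: ifP => _; first by rewrite mul1r.
  by rewrite mul0r.
rewrite ge0_integral_period//; last first.
  move=> phi; rewrite /meridian (_ : 2 * pi = pi *+ 2)//; last by rewrite mulr2n; ring.
  by rewrite sinD2pi cosD2pi.
pose g (a : R) := ((1 + a ^+ 2)%:E * inner_measure K P a)%E.
transitivity (\int[mu]_(p in `](- (pi / 2))%R, (pi / 2)%R[) g (tan p))%E.
  apply: eq_integral => phi; rewrite inE/= in_itv/= => pD.
  have cp := cos_gt0_pihalf pD; rewrite /meridian cosDpi sinDpi.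
  have h1 := @meridian_half phi 1 cp (expr1n _ _).
  have h2 := @meridian_half phi (-1) cp ltac:(by rewrite sqrrN expr1n).
  rewrite !mul1r in h1; rewrite !mulN1r in h2; rewrite {}h1 {}h2.
  rewrite -ge0_muleDr ?integral_ge0//; first congr (_ * _)%E; last first.
  - by move=> b _; rewrite lee_fin mulr_ge0// gdens_ge0.
  - by move=> b _; rewrite lee_fin mulr_ge0// gdens_ge0.
  have mG (u v : R) (w : R -> R) : measurable_fun setT w ->
      measurable_fun setT (fun b : R => (gdens (tan phi) b * tau u v (w b))%:E).
    by move=> mw; apply/measurable_EFinP/measurable_funM; [rewrite /gdens; mfun|apply: mtau; mfun].
  rewrite -ge0_integralD//.
  - apply: eq_integral => b _; rewrite -EFinD -mulrDr /psi (indic_hits vK PK).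
    by rewrite mul1r mulN1r.
  - by move=> b _; rewrite lee_fin mulr_ge0// gdens_ge0.
  - by apply: mG; mfun.
  - by move=> b _; rewrite lee_fin mulr_ge0// gdens_ge0.
  - by apply: mG; mfun.
rewrite (@ge0_integral_tan _ g).
- apply: eq_integral => a _; rewrite muleAC -EFinM mulfV ?mul1e//.
  by rewrite gt_eqF// sqr1D_gt0.
- by apply: emeasurable_funM; [apply/measurable_EFinP; mfun|exact: measurable_inner].
- by move=> a; rewrite mule_ge0 ?inner_ge0// lee_fin ltW// sqr1D_gt0.
Qed.

End visual_angle.

Section visual_angle_integral.
Variables (R : realType) (K : set (E3 R)).
Hypotheses (cK : compact K) (vK : convex3 K).
Local Notation rT := (measurableTypeR R).
Local Notation T3 := (rT * rT * rT)%type.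
Local Notation mu := (@lebesgue_measure R).

Lemma line_measure_inside P : K P -> line_measure K P = (2 * pi)%:E.
Proof.
move=> KP; rewrite -integral_gnomonic_density.
apply: eq_integral => a _; apply: eq_integral => b _.
rewrite /psi indicE mem_set ?mulr1//; exists P => //=.
by rewrite !subrr !mulr0 !subrr normr0 addr0.
Qed.

(** All lines through a point of K meet K, and their measure 2 pi has the
    square 4 pi ^ 2. *)
Lemma visual_angle_integral :
  (\int[lebesgue3 R]_(P in ~` K) sphere_area (solid_angle K P) ^+ 2 +
     (4 * pi ^+ 2)%:E * lebesgue3 R K =
   \int[lebesgue3 R]_P line_measure K P ^+ 2)%E.
Proof.
have mK : measurable (K : set T3) := measurable_body cK.
have mG2 : measurable_fun setT (fun P : T3 => line_measure K P ^+ 2)%E.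
  rewrite (_ : (fun P => _) = fun P : T3 => (line_measure K P * line_measure K P)%E).
    by apply: emeasurable_funM; exact: measurable_line_measure.
  by apply/funext => P; rewrite expe2.
have E : (\int[lebesgue3 R]_P line_measure K P ^+ 2 =
    \int[lebesgue3 R]_(P in ~` (K : set T3)) line_measure K P ^+ 2 +
    \int[lebesgue3 R]_(P in (K : set T3)) line_measure K P ^+ 2)%E.
  rewrite -ge0_integral_setU ?setvU//.
  - exact: measurableC.
  - by move=> P _; exact: sqre_ge0.
  - by apply/disj_setPRL => P KP NP; exact: NP.
rewrite E; congr (_ + _)%E.
  by apply: eq_integral => P; rewrite inE => /(sphere_area_solid_angle cK vK) ->.
transitivity (\int[lebesgue3 R]_(P in (K : set T3)) (cst (4 * pi ^+ 2)%:E P))%E.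
  by rewrite integral_cst.
apply: eq_integral => P; rewrite inE => KP.
by rewrite line_measure_inside// -EFin_expe; congr EFin; ring.
Qed.

End visual_angle_integral.

(** * Planes with round sections *)

Section vectors.
Variable R : realType.
Implicit Types (u v w : E3 R) (t : R).

Definition dot u v : R := u.1.1 * v.1.1 + u.1.2 * v.1.2 + u.2 * v.2.

Definition cross u v : E3 R :=
  (u.1.2 * v.2 - u.2 * v.1.2, u.2 * v.1.1 - u.1.1 * v.2, u.1.1 * v.1.2 - u.1.2 * v.1.1).

Lemma dist2E u v : dist2 u v = dot (u - v) (u - v).
Proof. by rewrite /dist2 /dot !expr2. Qed.

Lemma dotC u v : dot u v = dot v u.
Proof. by rewrite /dot; ring. Qed.

Lemma dotDr u v w : dot u (v + w) = dot u v + dot u w.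
Proof. by rewrite /dot/=; ring. Qed.

Lemma dotZr u t v : dot u (t *: v) = t * dot u v.
Proof.
rewrite /dot (_ : (t *: v).1.1 = t * v.1.1)// (_ : (t *: v).1.2 = t * v.1.2)//.
by rewrite (_ : (t *: v).2 = t * v.2)//; ring.
Qed.

Lemma dotNr u v : dot u (- v) = - dot u v.
Proof. by rewrite -scaleN1r dotZr mulN1r. Qed.

Lemma dotDl u v w : dot (u + v) w = dot u w + dot v w.
Proof. by rewrite dotC dotDr !(dotC w). Qed.

Lemma dotZl u t v : dot (t *: u) v = t * dot u v.
Proof. by rewrite dotC dotZr dotC. Qed.

Lemma dotNl u v : dot (- u) v = - dot u v.
Proof. by rewrite dotC dotNr dotC. Qed.

Definition dotE := (dotDr, dotDl, dotZr, dotZl, dotNr, dotNl).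

Lemma dot_ge0 u : 0 <= dot u u.
Proof. by rewrite /dot -!expr2 !addr_ge0 ?sqr_ge0. Qed.

Lemma dot_eq0 u : dot u u = 0 -> u = 0.
Proof.
move=> /eqP; rewrite /dot -!expr2 !paddr_eq0 ?addr_ge0 ?sqr_ge0// !sqrf_eq0 -andbA.
by case: u => [[x y] z] /and3P[/= /eqP -> /eqP -> /eqP ->].
Qed.

Lemma dot_gt0 u : u != 0 -> 0 < dot u u.
Proof.
move=> u0; rewrite lt_neqAle dot_ge0 andbT eq_sym; apply/eqP => /dot_eq0 uE.
by rewrite uE eqxx in u0.
Qed.

(** The difference of the two sides is the square length of t u - v divided by
    t. *)
Lemma dot_young u v t : 0 < t ->
  dot (u + v) (u + v) <= (1 + t) * dot u u + (1 + t^-1) * dot v v.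
Proof.
move=> t0; have := dot_ge0 (t *: u - v); rewrite !dotE (dotC v u) => h.
have : 0 <= t^-1 * (t * (t * dot u u - dot u v) - (t * dot u v - dot v v)).
  by rewrite mulr_ge0 ?invr_ge0 ?(ltW t0)//; move: h; lra.
have -> : t^-1 * (t * (t * dot u u - dot u v) - (t * dot u v - dot v v)) =
  t * dot u u - 2 * dot u v + t^-1 * dot v v by field; exact: lt0r_neq0.
lra.
Qed.

Lemma dot_cross u v : dot u (cross u v) = 0 /\ dot v (cross u v) = 0.
Proof. by split; rewrite /dot /cross/=; ring. Qed.

Lemma dot_cross_cross u v w z :
  dot (cross u v) (cross w z) = dot u w * dot v z - dot u z * dot v w.
Proof. by rewrite /dot /cross/=; ring. Qed.

Lemma cvg_dot T (F : set_system T) {FF : Filter F} (f g : T -> E3 R) u v :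
  f x @[x --> F] --> u -> g x @[x --> F] --> v -> dot (f x) (g x) @[x --> F] --> dot u v.
Proof.
move=> fu gv.
have h (h : T -> E3 R) w : h x @[x --> F] --> w -> [/\ (h x).1.1 @[x --> F] --> w.1.1,
    (h x).1.2 @[x --> F] --> w.1.2 & (h x).2 @[x --> F] --> w.2].
  move=> hw; have h1 : (h x).1 @[x --> F] --> w.1.
    by apply: (cvg_comp h fst hw); exact: cvg_fst.
  split.
  - by apply: (cvg_comp (fst \o h) fst h1); exact: cvg_fst.
  - by apply: (cvg_comp (fst \o h) snd h1); exact: cvg_snd.
  - by apply: (cvg_comp h snd hw); exact: cvg_snd.
have [f1 f2 f3] := h f u fu; have [g1 g2 g3] := h g v gv.
by apply: cvgD; [apply: cvgD|]; apply: cvgM.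
Qed.

End vectors.

Section round_planes.
Variables (R : realType) (K : set (E3 R)).
Hypotheses (cK : compact K) (vK : convex3 K).
Local Notation rT := (measurableTypeR R).
Local Notation mu := (@lebesgue_measure R).
Local Notation mu2 := (@lebesgue2 R).
Local Notation mu3 := (@space_measure R).

(** As [round_section], for a plane with an arbitrary normal vector n. *)
Definition round_plane (n : E3 R) (s : R) : Prop :=
  (forall X Y, K X -> K Y -> dot n X = s -> dot n Y = s -> X = Y) \/
  exists O r, [/\ 0 < r, dot n O = s,
    forall X, dot n X = s -> dist2 X O < r -> K X &
    forall X, dot n X = s -> K X -> dist2 X O <= r].

Lemma round_section_plane (Q : R * R) e (l : R) : l != 0 -> round_section K Q e ->
  round_plane (l * Q.2, l * Q.1, - l) (- (l * e)).
Proof.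
move=> l0; have key X : dot (l * Q.2, l * Q.1, - l) X = - (l * e) <-> on_plane Q e X.
  rewrite /dot /on_plane/=; split=> [h|->]; last by ring.
  by apply: (mulfI l0); lra.
case=> [H| [ O [r [r0 pO H1 H2]]]]; [left=> X Y KX KY /key pX /key pY; exact: H|right].
by exists O, r; split=> //; [exact/key|move=> X /key; exact: H1|move=> X /key; exact: H2].
Qed.

Hypothesis ae_round : {ae mu3, forall q, round_section K q.1 q.2}.

(** Almost all planes of finite slopes are round, and a plane parallel to the
    third axis is a limit of planes of finite slopes. *)
Lemma round_plane_dense (p : E3 R * R) (A : set (E3 R * R)) :
  (\forall q \near p, A q) -> exists2 q, A q & round_plane q.1 q.2.
Proof.
move=> /nbhs_ballP[d /= d0 Ad]; case: p Ad => [[[n1 n2] n3] s] Ad.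
have [l [l0 ln]] : exists l, l != 0 /\ `|n3 - - l| < d.
  have [->|n30] := eqVneq n3 0.
    by exists (d / 2); split; rewrite ?gt_eqF ?divr_gt0// sub0r opprK ger0_norm; lra.
  by exists (- n3); rewrite oppr_eq0 opprK subrr normr0.
pose eta := d / `|l|; have eta0 : 0 < eta by rewrite divr_gt0// normr_gt0.
pose I (c : R) : set rT := `](c - eta), (c + eta)[%classic.
have mI c : measurable (I c) by exact: measurable_itv.
have I0 c : (0 < mu (I c))%E.
  have h : c - eta < c + eta by lra.
  by rewrite /I lebesgue_measure_itv/= lte_fin h -EFinB lte_fin subr_gt0.
have IP (c x : R) : I (c / l) x -> `|c - l * x| < d.
  rewrite /I/= in_itv/= -ltr_distlC => h.
  have -> : c - l * x = l * (c / l - x) by field.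
  by rewrite normrM mulrC -ltr_pdivlMr ?normr_gt0.
pose B2 := I (n2 / l) `*` I (n1 / l); pose B := B2 `*` I (- s / l).
have : exists2 q, B q & round_section K q.1 q.2.
  apply: contrapT => /forall2NP H; have [N [mN N0 Nsub]] := ae_round.
  have B2_gt0 : (0 < mu2 B2)%E.
    by rewrite /lebesgue2 /B2 product_measure1E//; apply: mule_gt0; exact: I0.
  have : (mu3 B <= mu3 N)%E.
    apply: le_measure; rewrite ?inE//; first by do 2 apply: measurableX => //.
    by move=> q Bq; apply: Nsub => /= Hq; have [] := H q.
  rewrite N0 leNgt => /negP; apply.
  rewrite /space_measure /lebesgue3/= product_measure1E//; last exact: measurableX.
  by apply: mule_gt0; [exact: B2_gt0|exact: I0].
move=> [[[m k] e] [[Bm Bk] Be] H].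
exists ((l * k, l * m, - l), - (l * e)); last exact: (round_section_plane l0 H).
apply: Ad; split => /=; last first.
  by rewrite /ball/= opprK -normrN opprD -[- s - _]/(- s - l * e); exact: IP.
by split => //; split; exact: IP.
Qed.

End round_planes.

(** * A body with a dense set of round sections *)

Section round_body.
Variables (R : realType) (K : set (E3 R)).
Hypotheses (cK : compact K) (vK : convex3 K).
Hypothesis dense_round : forall (p : E3 R * R) (A : set (E3 R * R)),
  (\forall q \near p, A q) -> exists2 q, A q & round_plane K q.1 q.2.

Lemma E3_ext (X Y : E3 R) : X.1.1 = Y.1.1 -> X.1.2 = Y.1.2 -> X.2 = Y.2 -> X = Y.
Proof. by case: X Y => [[x y] z] [[x' y'] z'] /= -> -> ->. Qed.

Lemma convex_segment u q t : K u -> K q -> 0 <= t <= 1 -> K (u + t *: (q - u)).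
Proof.
move=> Ku Kq t01; have := vK Ku Kq t01.
set Z := (X in K X -> _); suff -> : Z = u + t *: (q - u) by [].
by apply: E3_ext; rewrite /Z/= /GRing.scale/=; ring.
Qed.

Lemma cvg_height (X : E3 R) (p : E3 R * R) :
  dot q.1 X - q.2 @[q --> p] --> dot p.1 X - p.2.
Proof.
apply: cvgB; last exact: cvg_snd.
by apply: cvg_dot; [exact: cvg_fst|exact: cvg_cst].
Qed.

(** The height over a plane close to the given one is small at u and has a definite
    sign at p1 and at p2, so that it vanishes near u on one of the two segments. *)
Lemma crossing (n u p1 p2 : E3 R) (s eps : R) : dot n u = s ->
  dot n p1 < s -> s < dot n p2 -> 0 < eps ->
  \forall p \near (n, s), exists2 q, q = p1 \/ q = p2 & exists l,
    [/\ 0 <= l <= 1, `|l| < eps & dot p.1 (u + l *: (q - u)) = p.2].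
Proof.
move=> nu g1 g2 e0; pose h X (p : E3 R * R) := dot p.1 X - p.2.
have near_gt X c : c < dot n X - s -> \forall p \near (n, s), c < h X p.
  by move=> cX; have /cvgr_gt := @cvg_height X (n, s); apply.
have near_lt X c : dot n X - s < c -> \forall p \near (n, s), h X p < c.
  by move=> cX; have /cvgr_lt := @cvg_height X (n, s); apply.
pose m1 := (s - dot n p1) / 2; pose m2 := (dot n p2 - s) / 2.
have m10 : 0 < m1 by rewrite divr_gt0// subr_gt0.
have m20 : 0 < m2 by rewrite divr_gt0// subr_gt0.
have N1 := near_lt p1 (- m1) ltac:(rewrite /m1; lra).
have N2 := near_gt p2 m2 ltac:(rewrite /m2; lra).
have em1 : 0 < eps * m1 by rewrite mulr_gt0.
have em2 : 0 < eps * m2 by rewrite mulr_gt0.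
have N3 := near_lt u (eps * m1) ltac:(by rewrite nu subrr).
have N4 := near_gt u (- (eps * m2)) ltac:(by rewrite nu subrr oppr_lt0).
near=> p.
have h1 : h p1 p < - m1 by near: p.
have h2 : m2 < h p2 p by near: p.
have h3 : h u p < eps * m1 by near: p.
have h4 : - (eps * m2) < h u p by near: p.
have hE q l : dot p.1 (u + l *: (q - u)) - p.2 = h u p + l * (h q p - h u p).
  by rewrite /h !dotE; ring.
have [hu|hu] := leP (h u p) 0.
  have D0 : 0 < h p2 p - h u p by lra.
  exists p2; [by right|exists (- h u p / (h p2 p - h u p))].
  have l0 : 0 <= - h u p / (h p2 p - h u p) by rewrite divr_ge0 ?(ltW D0)// oppr_ge0.
  split; first by rewrite l0 ler_pdivrMr// mul1r; lra.
    rewrite ger0_norm// ltr_pdivrMr//.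
    apply: (@lt_le_trans _ _ (eps * m2)); first by rewrite ltrNl.
    by rewrite ler_pM2l//; lra.
  by apply: subr0_eq; rewrite hE divfK ?gt_eqF// addrN.
have D0 : 0 < h u p - h p1 p by lra.
exists p1; [by left|exists (h u p / (h u p - h p1 p))].
have l0 : 0 <= h u p / (h u p - h p1 p) by rewrite divr_ge0 ?(ltW D0) ?(ltW hu).
split; first by rewrite l0 ler_pdivrMr// mul1r; lra.
  rewrite ger0_norm// ltr_pdivrMr//.
  apply: (lt_le_trans h3).
  by rewrite ler_pM2l//; lra.
by apply: subr0_eq; rewrite hE -[h p1 p - _]opprB mulrN divfK ?gt_eqF// addrN.
Unshelve. all: by end_near. Qed.

Variables a b : E3 R.
Hypotheses (Ka : K a) (Kb : K b) (ab0 : 0 < dist2 a b).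
Hypothesis diam : forall X Y, K X -> K Y -> dist2 X Y <= dist2 a b.

(** Since a and b are at maximal distance in K, the disc cannot be wider than a
    b; if it contains two points a' and b' nearly as far apart, these are
    nearly opposite, so that the centre O is close to their midpoint. The
    parallelogram law makes this precise, and [dot_young] passes from O to the
    midpoint. *)
Lemma round_plane_mem (n : E3 R) (s th : R) (a' b' x : E3 R) : round_plane K n s ->
  0 < th -> K a' -> K b' -> dot n a' = s -> dot n b' = s -> dot n x = s ->
  4 * (1 + th) * dist2 x (2^-1 *: (a' + b')) +
    (1 + th^-1) * (dist2 a b - dist2 a' b') < dist2 a' b' -> K x.
Proof.
move=> rP th0 Ka' Kb' na nb nx; set D := dist2 a' b'; set d := dist2 a b => H.
have Dd : D <= d by exact: diam.
have thV : 0 < th^-1 by rewrite invr_gt0.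
have D0 : 0 < D.
  have : 0 <= 4 * (1 + th) * dist2 x (2^-1 *: (a' + b')).
    by rewrite !mulr_ge0 ?dist2E ?dot_ge0//; lra.
  have : 0 <= (1 + th^-1) * (d - D) by rewrite mulr_ge0//; lra.
  lra.
have Dab : D = dot (a' - b') (a' - b') by rewrite /D dist2E.
case: rP => [E| [ O [r [r0 nO H1 H2]]]].
  by move: D0; rewrite Dab (E a' b')// subrr -(scale0r (0 : E3 R)) dotZl mul0r ltxx.
have rd : 4 * r <= d.
  rewrite leNgt; apply/negP => dr.
  (* Otherwise K has opposite points in the direction a' - b' at squared distance
     w > d / 4 from O. *)
  pose w := (d / 4 + r) / 2; have w0 : 0 < w by rewrite /w; lra.
  pose t := Num.sqrt (w / D).
  have tE : t ^+ 2 * D = w by rewrite sqr_sqrtr ?divfK ?gt_eqF// divr_ge0 ?ltW.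
  have KO e : e ^+ 2 = 1 -> K (O + (e * t) *: (a' - b')).
    move=> e1; apply: H1; first by rewrite !dotE na nb nO; ring.
    have -> : dist2 (O + (e * t) *: (a' - b')) O = e ^+ 2 * (t ^+ 2 * D).
      by rewrite dist2E addrAC subrr add0r !(dotZl, dotZr) -Dab; ring.
    by rewrite e1 mul1r tE /w; lra.
  have := diam (KO 1 (expr1n _ _)) (KO (-1) ltac:(by rewrite sqrrN expr1n)).
  have -> : dist2 (O + (1 * t) *: (a' - b')) (O + (-1 * t) *: (a' - b')) = 4 * (t ^+ 2 * D).
    by rewrite Dab dist2E !dotE (dotC a' b') (dotC a' O) (dotC b' O); ring.
  by rewrite tE /w -/d; lra.
have aO := H2 _ na Ka'; have bO := H2 _ nb Kb'.
set m := 2^-1 *: (a' + b') in H *.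
have par : 2 * (dist2 a' O + dist2 b' O) = 4 * dist2 m O + D.
  by rewrite Dab !dist2E /m !dotE (dotC a' b') (dotC a' O) (dotC b' O); field.
have young : dist2 x O <= (1 + th) * dist2 x m + (1 + th^-1) * dist2 m O.
  by have := dot_young (x - m) (m - O) th0; rewrite addrA subrK -!dist2E.
apply: (H1 x nx).
have : (1 + th^-1) * (4 * dist2 m O) <= (1 + th^-1) * (d - D).
  by rewrite ler_pM2l; lra.
have := dot_ge0 (m - O); rewrite -dist2E.
lra.
Qed.

(** The complement of K is open. *)
Lemma not_mem_near (T : topologicalType) (f : T -> E3 R) (z : T) : {for z, continuous f} ->
  ~ K (f z) -> \forall y \near z, ~ K (f y).
Proof.
move=> cf nK; apply: (cf (~` K)); apply: open_nbhs_nbhs; split => //.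
by apply: closed_openC; apply: compact_closed => //; exact: norm_hausdorff.
Qed.

Let c := 2^-1 *: (a + b).

(** A round plane close to the one considered meets K close to a and close to
    b, by [crossing], so it contains all of a disc close to the disc of
    diameter a b by [round_plane_mem]; and K is closed. *)
Lemma separated_plane_disc (n x p1 p2 : E3 R) : dot n (b - a) = 0 -> K p1 -> K p2 ->
  dot n (p1 - a) < 0 -> 0 < dot n (p2 - a) -> dot n (x - a) = 0 ->
  4 * dist2 x c < dist2 a b -> K x.
Proof.
rewrite !dotDr !dotNr => /subr0_eq nb Kp1 Kp2; rewrite subr_lt0 subr_gt0.
set s := dot n a in nb * => np1 np2 /subr0_eq nx; set d := dist2 a b => xd.
have w0 : 0 <= dist2 x c by rewrite dist2E dot_ge0.
(* Small enough for the strict inequality at x to survive the factor 1 + th. *)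
pose th := (d - 4 * dist2 x c) / d.
have th0 : 0 < th by rewrite divr_gt0// subr_gt0.
have thd : 4 * (1 + th) * dist2 x c < d.
  have -> : 4 * (1 + th) * dist2 x c = 4 * dist2 x c + (4 * dist2 x c / d) * (d - 4 * dist2 x c).
    by rewrite /th; field; exact: lt0r_neq0.
  have : 4 * dist2 x c / d * (d - 4 * dist2 x c) < 1 * (d - 4 * dist2 x c).
    by rewrite ltr_pM2r ?subr_gt0// ltr_pdivrMr// mul1r.
  lra.
pose A (q : E3 R) (l : R) := a + l *: (q - a); pose B (q : E3 R) (l : R) := b + l *: (q - b).
pose X (l : R) := x + l *: n.
(* Positivity of Th is the last hypothesis of [round_plane_mem], for points on the
   segments from a to q and b to q' and on the normal through x. *)
pose Th q q' (z : R * R * R) := dist2 (A q z.1.1) (B q' z.1.2) -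
  4 * (1 + th) * dist2 (X z.2) (2^-1 *: (A q z.1.1 + B q' z.1.2)) -
  (1 + th^-1) * (d - dist2 (A q z.1.1) (B q' z.1.2)).
have cline (u v : E3 R) (g : R * R * R -> R) : g z @[z --> (0, 0, 0)] --> (0 : R) ->
    u + g z *: v @[z --> ((0, 0, 0) : R * R * R)] --> u.
  move=> g0; rewrite -[X in _ --> X]addr0 -(scale0r v).
  by apply: cvgD; [exact: cvg_cst|apply: cvgZr_tmp].
have near_Th q q' : \forall z \near ((0, 0, 0) : R * R * R), 0 < Th q q' z.
  have c11 : (fun z : R * R * R => z.1.1) z @[z --> (0, 0, 0)] --> (0 : R).
    by apply: (@continuous_comp _ _ _ fst fst (0, 0, 0)); exact: cvg_fst.
  have c12 : (fun z : R * R * R => z.1.2) z @[z --> (0, 0, 0)] --> (0 : R).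
    by apply: (@continuous_comp _ _ _ fst snd (0, 0, 0)); [exact: cvg_fst|exact: cvg_snd].
  have c2 : (fun z : R * R * R => z.2) z @[z --> (0, 0, 0)] --> (0 : R) by exact: cvg_snd.
  have cA := cline a (q - a) _ c11; have cB := cline b (q' - b) _ c12.
  have cX := cline x n _ c2.
  have cm : 2^-1 *: (A q z.1.1 + B q' z.1.2) @[z --> ((0, 0, 0) : R * R * R)] --> c.
    by apply: cvgZ; [exact: cvg_cst|exact: cvgD].
  have cdist (f g : R * R * R -> E3 R) u v : f z @[z --> (0, 0, 0)] --> u ->
      g z @[z --> (0, 0, 0)] --> v -> dist2 (f z) (g z) @[z --> (0, 0, 0)] --> dist2 u v.
    move=> cf cg; rewrite dist2E; under eq_cvg do rewrite dist2E.
    by apply: cvg_dot; apply: cvgB.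
  have cTh : Th q q' z @[z --> (0, 0, 0)] -->
      d - 4 * (1 + th) * dist2 x c - (1 + th^-1) * (d - d).
    apply: cvgB; first (apply: cvgB; first exact: cdist).
      by apply: cvgM; [exact: cvg_cst|exact: cdist].
    apply: cvgM; first exact: cvg_cst.
    by apply: cvgB; [exact: cvg_cst|exact: cdist].
  have /cvgr_gt := cTh; apply.
  by rewrite subrr mulr0 subr0 subr_gt0.
apply: contrapT => nKx.
have near_X : \forall l \near (0 : R), ~ K (X l).
  apply: not_mem_near; last by rewrite /X scale0r addr0.
  suff : X l @[l --> (0 : R)] --> x + 0 *: n by [].
  by apply: cvgD; [exact: cvg_cst|apply: cvgZ; [exact: cvg_id|exact: cvg_cst]].
have [e [e0 HX HT]] : exists e, [/\ 0 < e, forall l, `|l| < e -> ~ K (X l) &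
    forall q q' l m k, q = p1 \/ q = p2 -> q' = p1 \/ q' = p2 ->
      `|l| < e -> `|m| < e -> `|k| < e -> 0 < Th q q' (l, m, k)].
  move: near_X => /nbhs_ballP[e1 /= e10 H1].
  have : \forall z \near ((0, 0, 0) : R * R * R), (0 < Th p1 p1 z /\ 0 < Th p1 p2 z) /\
     (0 < Th p2 p1 z /\ 0 < Th p2 p2 z).
    by do 2 apply: filterI; exact: near_Th.
  move=> /nbhs_ballP[e2 /= e20 H2].
  exists (Num.min e1 e2); split; first by rewrite lt_min e10.
    by move=> l; rewrite lt_min => /andP[le _]; apply: H1; rewrite /ball/= sub0r normrN.
  move=> q q' l m k qE qE'; rewrite !lt_min => /andP[_ l2] /andP[_ m2] /andP[_ k2].
  have : ball ((0, 0, 0) : R * R * R) e2 (l, m, k).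
    by split; [split|]; rewrite /ball/= sub0r normrN.
  by move=> /H2 [[h1 h2] [h3 h4]]; move: qE qE' => [->|->] [->|->].
have n0 : n != 0.
  apply/eqP => nE; move: np1 np2; rewrite nE /s nE -(scale0r (0 : E3 R)) !dotZl !mul0r.
  by rewrite ltxx.
have N0 := dot_gt0 n0; set N := dot n n in N0.
have nearN : \forall p \near (n, s), N / 2 < dot p.1 n.
  have : dot p.1 n @[p --> (n, s)] --> N.
    by apply: cvg_dot; [exact: cvg_fst|exact: cvg_cst].
  by move=> /cvgr_gt; apply; lra.
have nearx : \forall p \near (n, s), `|dot p.1 x - p.2| < e * (N / 2).
  have := @cvg_height x (n, s); rewrite /= nx subrr => /cvgr0_norm_lt; apply.
  by rewrite mulr_gt0// divr_gt0.
have nearA := crossing (erefl : dot n a = s) np1 np2 e0.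
have nearB := crossing (nb : dot n b = s) np1 np2 e0.
have := dense_round (filterI (filterI nearN nearx) (filterI nearA nearB)).
move=> [p [[pN px]]] [[q qE [l [l01 le hA]]]] [q' qE' [m [m01 me hB]]] rp.
pose k := (p.2 - dot p.1 x) / dot p.1 n.
have pn0 : 0 < dot p.1 n by apply: lt_trans pN; rewrite divr_gt0.
have ke : `|k| < e.
  rewrite normrM normfV (gtr0_norm pn0) ltr_pdivrMr// distrC (lt_trans px)//.
  by rewrite ltr_pM2l.
apply: (HX k ke).
have Kq : K q by case: qE => ->. 
have Kq' : K q' by case: qE' => ->.
have := HT q q' l m k qE qE' le me ke; rewrite /Th/= => HTh.
apply: (round_plane_mem rp th0 (convex_segment Ka Kq l01) (convex_segment Kb Kq' m01) hA hB).
  by rewrite /X !dotE /k divfK ?gt_eqF// subrKC.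
by move: HTh; rewrite /A /B -/d; lra.
Qed.

Let ab_dot : dist2 a b = dot (b - a) (b - a).
Proof. by rewrite dist2E -[a - b]opprB dotNl dotNr opprK. Qed.

(** Otherwise p would be farther from b than a is. *)
Lemma acute p : K p -> p != a -> 0 < dot (b - a) (p - a).
Proof.
move=> Kp pa; have pa0 : 0 < dot (p - a) (p - a) by rewrite dot_gt0// subr_eq0.
have := diam Kp Kb; rewrite !dist2E.
have -> : p - b = (p - a) - (b - a) by rewrite opprB addrA subrK.
have -> : a - b = - (b - a) by rewrite opprB.
move: (p - a) (b - a) pa0 => u v; rewrite !dotE (dotC v u); lra.
Qed.

(** A round plane separating a from b and p meets the segments from a to b and
    p in two points, so that it contains a disc of K, and with it two
    independent directions. If K were in one plane, both planes would have the
    same directions, but only one of the two separates a from b. *)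
Lemma not_planar p : K p -> cross (b - a) (p - a) != 0 ->
  exists2 q, K q & dot (cross (b - a) (p - a)) (q - a) != 0.
Proof.
set v := cross (b - a) (p - a) => Kp v0; apply: contrapT => /forall2NP H.
have {}H q : K q -> dot v (q - a) = 0.
  by move=> Kq; have [//|/negP/negPn/eqP] := H q.
have pa : p != a.
  apply: contraNneq v0 => pa; apply/eqP; rewrite /v pa subrr.
  by apply: E3_ext; rewrite /cross/= !mulr0 subrr.
have g1 : 0 < dot (b - a) (b - a) by rewrite -ab_dot.
have g2 := acute Kp pa.
pose s := dot (b - a) a + Num.min (dot (b - a) (b - a)) (dot (b - a) (p - a)) / 2.
have m0 : 0 < Num.min (dot (b - a) (b - a)) (dot (b - a) (p - a)) by rewrite lt_min g1.
have m1 : Num.min (dot (b - a) (b - a)) (dot (b - a) (p - a)) <= dot (b - a) (b - a).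
  by rewrite ge_min lexx.
have m2 : Num.min (dot (b - a) (b - a)) (dot (b - a) (p - a)) <= dot (b - a) (p - a).
  by rewrite ge_min lexx orbT.
have sa : dot (b - a) a < s by rewrite /s; lra.
have sb : s < dot (b - a) b by rewrite /s; move: m1 m0; rewrite dotDr dotNr; lra.
have sp : s < dot (b - a) p by rewrite /s; move: m2 m0; rewrite [dot _ (p - a)]dotDr dotNr; lra.
have cutoff X : dot (b - a) X < s -> \forall q \near (b - a, s), dot q.1 X - q.2 < 0.
  by move=> sX; have /cvgr_lt := @cvg_height X (b - a, s); apply; rewrite subr_lt0.
have cuton X : s < dot (b - a) X -> \forall q \near (b - a, s), 0 < dot q.1 X - q.2.
  by move=> sX; have /cvgr_gt := @cvg_height X (b - a, s); apply; rewrite subr_gt0.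
have := dense_round (filterI (cutoff _ sa) (filterI (cuton _ sb) (cuton _ sp))).
move=> [[n t] /= [ha [hb hp]]] rn.
have cut X : K X -> 0 < dot n X - t -> exists2 l, 0 < l &
    K (a + l *: (X - a)) /\ dot n (a + l *: (X - a)) = t.
  move=> KX hX; have D0 : 0 < dot n X - dot n a by lra.
  exists ((t - dot n a) / (dot n X - dot n a)); first by rewrite divr_gt0//; lra.
  split; last by rewrite dotDr dotZr dotDr dotNr divfK ?gt_eqF// subrKC.
  apply: convex_segment => //; rewrite divr_ge0//= ?ler_pdivrMr//; lra.
have [l l0 [Kl nl]] := cut b Kb hb; have [m mu0 [Km nm]] := cut p Kp hp.
have nb0 : 0 < dot n (b - a) by rewrite dotDr dotNr; lra.
case: rn => [E| [ O [r [r0 nO H1 _]]]].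
  have e : l *: (b - a) = m *: (p - a) by apply: (addrI a); exact: E.
  move/eqP: v0; apply; have mv : m *: v = 0.
    have -> : m *: v = cross (b - a) (m *: (p - a)).
      by apply: E3_ext; rewrite /cross/= /GRing.scale/=; ring.
    rewrite -e; apply: E3_ext; rewrite /cross/= /GRing.scale/=; ring.
  by move/eqP: mv; rewrite scaler_eq0 gt_eqF//= => /eqP.
(* Up to a factor, w is the orthogonal projection of v to the directions of the plane. *)
have [w wE] : exists w, w = dot n n *: v - dot v n *: n by eexists.
have nw : dot n w = 0 by rewrite wE !dotE (dotC v n); ring.
have [w0|w0] := eqVneq w 0; last first.
  have ww := dot_gt0 w0.
  pose e := Num.sqrt (r / (2 * dot w w)).
  have eE : e ^+ 2 * dot w w = r / 2.
    by rewrite sqr_sqrtr; [field; rewrite gt_eqF|rewrite divr_ge0// ltW// mulr_gt0].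
  have KO : K O by apply: H1 => //; rewrite dist2E subrr -(scale0r (0 : E3 R)) dotZl mul0r.
  have KOw : K (O + e *: w).
    apply: H1; first by rewrite !dotE nw mulr0 addr0.
    by rewrite dist2E addrAC subrr add0r dotZl dotZr mulrA -expr2 eE; lra.
  have := H _ KOw; have := H _ KO; rewrite !dotE => h1 h2.
  have e0 : e != 0 by apply/eqP => eZ; move: eE; rewrite eZ expr0n mul0r; lra.
  have vw : dot v w = 0 by apply: (mulfI e0); rewrite mulr0; lra.
  have : dot w w = 0 by rewrite {1}wE dotDl dotZl dotNl dotZl vw nw !mulr0 subrr.
  by move=> wz; rewrite wz ltxx in ww.
have n0 : n != 0.
  by apply: contraTneq nb0 => ->; rewrite -(scale0r (0 : E3 R)) dotZl mul0r ltxx.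
have nn := dot_gt0 n0.
have : dot w (b - a) = 0 by rewrite w0 -(scale0r (0 : E3 R)) dotZl mul0r.
rewrite wE dotDl dotZl dotNl dotZl (H _ Kb) mulr0 sub0r => /eqP.
rewrite oppr_eq0 mulf_eq0 (gt_eqF nb0) orbF => /eqP vn.
move: w0; rewrite wE vn scale0r subr0 => /eqP.
by rewrite scaler_eq0 (gt_eqF nn)/= (negbTE v0).
Qed.

Let center_dot n : dot n (b - a) = 0 -> dot n (c - a) = 0.
Proof. by rewrite /c !dotE; lra. Qed.

(** Some plane through a and b separates p from a point q of K, so it contains
    the disc of diameter a b; this disc has points on both sides of every other
    plane through a and b. *)
Lemma open_ball_sub p x : K p -> cross (b - a) (p - a) != 0 ->
  4 * dist2 x c < dist2 a b -> K x.
Proof.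
move=> Kp v0; have [q Kq] := not_planar Kp v0; set v := cross _ _ in v0 * => vq.
pose n := cross (b - a) ((p - a) + (q - a)).
have nb : dot n (b - a) = 0 by rewrite dotC; exact: (dot_cross _ _).1.
have nq : dot n (q - a) = dot v (q - a).
  by rewrite /n /v /dot /cross/=; ring.
have np : dot n (p - a) = - dot v (q - a).
  by rewrite /n /v /dot /cross/=; ring.
have base y : dot n (y - a) = 0 -> 4 * dist2 y c < dist2 a b -> K y.
  have [h|h|h] := ltrgtP (dot v (q - a)) 0; last by rewrite h eqxx in vq.
    by apply: (separated_plane_disc nb Kq Kp); rewrite ?nq ?np ?oppr_gt0.
  by apply: (separated_plane_disc nb Kp Kq); rewrite ?nq ?np ?oppr_lt0.
(* Up to a factor, w is the direction normal to b - a in the plane of normal n. *)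
move=> xd; pose m := cross (b - a) (x - c); pose w := cross n (b - a).
have mw : dot m w = - (dot (b - a) (b - a) * dot n (x - c)).
  by rewrite dot_cross_cross (dotC _ n) nb mul0r sub0r (dotC n).
have [nx|nx] := eqVneq (dot n (x - c)) 0.
  by apply: base => //; rewrite -(subrKA c) dotDr nx (center_dot nb) addr0.
have mb : dot m (b - a) = 0 by rewrite dotC; exact: (dot_cross _ _).1.
have mx : dot m (x - c) = 0 by rewrite dotC; exact: (dot_cross _ _).2.
have mc := center_dot mb; have nc := center_dot nb.
have mw0 : dot m w != 0 by rewrite mw oppr_eq0 mulf_neq0// gt_eqF// -ab_dot.
have w0 : w != 0.
  by apply: contra_neq mw0 => ->; rewrite -(scale0r (0 : E3 R)) dotZr mul0r.
have ww := dot_gt0 w0.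
pose e := Num.sqrt (dist2 a b / (8 * dot w w)).
have eE : e ^+ 2 * dot w w = dist2 a b / 8.
  by rewrite sqr_sqrtr; [field; rewrite gt_eqF|rewrite divr_ge0 ?ltW// mulr_gt0].
have e0 : e != 0 by apply/eqP => eZ; move: eE ab0; rewrite eZ expr0n mul0r; lra.
have Ke (f : R) : f ^+ 2 = e ^+ 2 -> K (c + f *: w).
  move=> fE; apply: base.
    by rewrite addrAC dotDr nc add0r dotZr (dot_cross _ _).1 mulr0.
  have -> : dist2 (c + f *: w) c = f ^+ 2 * dot w w.
    by rewrite dist2E addrAC subrr add0r dotZl dotZr mulrA -expr2.
  by rewrite fE eE; move: ab0; lra.
have side f : dot m (c + f *: w - a) = f * dot m w.
  by rewrite addrAC dotDr mc add0r dotZr.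
have mxa : dot m (x - a) = 0 by rewrite -(subrKA c) dotDr mx mc addr0.
have es : e * dot m w != 0 by rewrite mulf_neq0.
have Kp1 := Ke e erefl; have Kp2 := Ke (- e) (sqrrN e).
have [h|h|h] := ltrgtP (e * dot m w) 0; last by rewrite h eqxx in es.
  by apply: (separated_plane_disc mb Kp1 Kp2) => //; rewrite side// mulNr oppr_gt0.
by apply: (separated_plane_disc mb Kp2 Kp1) => //; rewrite side// mulNr oppr_lt0.
Qed.

Lemma dist2_line (x y : E3 R) t :
  [/\ dist2 (x + t *: (y - x)) y = (1 - t) ^+ 2 * dist2 x y,
      dist2 (y - t *: (x - y)) y = t ^+ 2 * dist2 x y &
      dist2 x (y - t *: (x - y)) = (1 + t) ^+ 2 * dist2 x y].
Proof. by split; rewrite !dist2E !dotE (dotC y x); ring. Qed.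

(** K contains the ball of diameter a b. A point of K outside the ball would be
    farther than the length of a b from the point of the ball opposite to it. *)
Lemma round_body_ball p : K p -> cross (b - a) (p - a) != 0 -> is_ball K.
Proof.
move=> Kp v0; have sub := open_ball_sub Kp v0; have d0 : 0 < dist2 a b := ab0.
have csub x : 4 * dist2 x c <= dist2 a b -> K x.
  move=> xd; apply: contrapT => nKx.
  have : \forall t \near (0 : R), ~ K (x + t *: (c - x)).
    apply: not_mem_near; last by rewrite scale0r addr0.
    suff : (fun t => x + t *: (c - x)) l @[l --> (0 : R)] --> x + 0 *: (c - x) by [].
    by apply: cvgD; [exact: cvg_cst|apply: cvgZ; [exact: cvg_id|exact: cvg_cst]].
  move=> /nbhs_ballP[e /= e0 H].
  pose t := Num.min (e / 2) 1; have t0 : 0 < t by rewrite lt_min divr_gt0//=.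
  have t1 : t <= 1 by rewrite ge_min lexx orbT.
  have te : t < e by rewrite gt_min; apply/orP; left; lra.
  have tt : ball (0 : R) e t by rewrite /ball/= sub0r normrN gtr0_norm.
  apply: (H t tt); apply: sub.
  have [-> _ _] := dist2_line x c t.
  rewrite mulrCA; apply: (@le_lt_trans _ _ ((1 - t) ^+ 2 * dist2 a b)).
    by rewrite ler_wpM2l ?sqr_ge0.
  by rewrite gtr_pMl// expr2; nra.
have supc x : K x -> 4 * dist2 x c <= dist2 a b.
  move=> Kx; rewrite leNgt; apply/negP => xd; set w := dist2 x c in xd.
  have w0 : 0 < w by lra.
  pose t := Num.sqrt (dist2 a b / (4 * w)).
  have t0 : 0 < t by rewrite sqrtr_gt0 divr_gt0// mulr_gt0.
  have tE : t ^+ 2 * (4 * w) = dist2 a b.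
    by rewrite sqr_sqrtr ?divfK ?gt_eqF// ?mulr_gt0// divr_ge0 ?ltW// mulr_gt0.
  have yE : dist2 (c - t *: (x - c)) c = t ^+ 2 * w.
    by have [] := dist2_line x c t.
  have Ky : K (c - t *: (x - c)) by apply: csub; rewrite yE; lra.
  have := diam Kx Ky.
  have [_ _ ->] := dist2_line x c t; rewrite -/w.
  have t1 : t < 1.
    rewrite -(ltr_pXn2r (n := 2)) ?nnegrE ?ltW// expr1n.
    by rewrite -(ltr_pM2r (mulr_gt0 (ltr0Sn R 3) w0)) tE mul1r.
  have tt : t ^+ 2 * w < t * w by rewrite ltr_pM2r// expr2 gtr_pMr.
  have : t ^+ 2 * w < w by rewrite (lt_trans tt)// gtr_pMl.
  have -> : (1 + t) ^+ 2 * w = w + 2 * (t * w) + t ^+ 2 * w by ring.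
  by lra.
exists c, (Num.sqrt (dist2 a b) / 2); split; first by rewrite divr_gt0// sqrtr_gt0.
have eN x : (enorm (x - c) <= Num.sqrt (dist2 a b) / 2) = (4 * dist2 x c <= dist2 a b).
  have -> : enorm (x - c) = Num.sqrt (dist2 x c) by [].
  have s4 : Num.sqrt 4 = 2 :> R.
    by rewrite (_ : 4 = 2 ^+ 2) ?sqrtr_sqr ?ger0_norm//; ring.
  by rewrite ler_pdivlMr// mulrC -s4 -sqrtrM// ler_sqrt// ltW.
by apply/seteqP; split => x /=; rewrite eN; [exact: supc|exact: csub].
Qed.

End round_body.

(** * Extremal bodies are balls *)

Section conclusion.
Variables (R : realType) (K : set (E3 R)).

Lemma convex_set3 : convex_set K -> convex3 K.
Proof.
move=> vK p q s Kp Kq /andP[s0 s1].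
have := vK q p (Itv01 s0 s1); rewrite !inE => /(_ Kq Kp).
set Z := (X in K X -> _); suff -> : Z = ((1 - s) * p.1.1 + s * q.1.1,
  (1 - s) * p.1.2 + s * q.1.2, (1 - s) * p.2 + s * q.2) by [].
have -> : Z = s *: q + (1 - s) *: p by [].
by apply: E3_ext; rewrite /= /GRing.scale/= addrC.
Qed.

Hypotheses (cK : compact K) (vK : convex3 K).

Lemma is_ballE : is_ball K -> exists O w, K = [set X | dist2 X O <= w].
Proof.
move=> [ O [r [r0 ->]]]; exists O, (r ^+ 2); apply/seteqP.
suff e X : (enorm (X - O) <= r) = (dist2 X O <= r ^+ 2) by split=> X; rewrite /= e.
have -> : enorm (X - O) = Num.sqrt (dist2 X O) by [].
by rewrite -{1}(ger0_norm (ltW r0)) -sqrtr_sqr ler_sqrt// sqr_ge0.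
Qed.

Lemma ae_round_ball : ~ in_a_line K ->
  {ae @space_measure R, forall q, round_section K q.1 q.2} -> is_ball K.
Proof.
move=> nline ae_round; have dense_round := round_plane_dense ae_round.
have [p0 Kp0] : K !=set0.
  apply: contrapT => /set0P/negP/negPn/eqP K0; apply: nline.
  by exists 0, 0 => x; rewrite K0.
have cD : continuous (fun q : E3 R * E3 R => dist2 q.1 q.2).
  move=> q; rewrite /continuous_at dist2E; under eq_cvg do rewrite dist2E.
  by apply: cvg_dot; (apply: cvgB; [exact: cvg_fst|exact: cvg_snd]).
have KK0 : K `*` K !=set0 by exists (p0, p0).
have [[a b] [/= Ka Kb] diam] := compact_argmax (compact_setX cK cK) KK0 cD.
have {}diam X Y : K X -> K Y -> dist2 X Y <= dist2 a b by move=> KX KY; exact: (diam (X, Y)).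
have ab0 : 0 < dist2 a b.
  rewrite ltNge; apply/negP => d0; apply: nline; exists a, 0 => x Kx; exists 0.
  rewrite scaler0 addr0; apply/eqP; rewrite -subr_eq0; apply/eqP/dot_eq0/le_anti.
  by rewrite dot_ge0 -dist2E (le_trans (diam _ _ Kx Ka) d0).
have [p Kp] : exists2 p, K p & cross (b - a) (p - a) != 0.
  apply: contrapT => /forall2NP H; apply: nline; exists a, (b - a) => x Kx.
  have [//|/negP/negPn/eqP cx] := H x.
  have dE : dist2 a b = dot (b - a) (b - a).
    by rewrite dist2E -[a - b]opprB dotNl dotNr opprK.
  exists (dot (b - a) (x - a) / dist2 a b).
  apply: (addIr (- a)); rewrite addrAC subrr add0r.
  apply: (scalerI (lt0r_neq0 ab0)); rewrite scalerA mulrCA mulfV ?lt0r_neq0// mulr1.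
  apply/eqP; rewrite -subr_eq0; apply/eqP.
  have -> : dist2 a b *: (x - a) - dot (b - a) (x - a) *: (b - a) =
      cross (cross (b - a) (x - a)) (b - a).
    rewrite dE; move: (b - a) (x - a) => u v.
    by apply: E3_ext; rewrite /cross /dot/= /GRing.scale/=; ring.
  by rewrite cx; apply: E3_ext; rewrite /cross/= !mul0r subrr.
exact: (round_body_ball cK vK dense_round Ka Kb ab0 diam Kp).
Qed.

End conclusion.

Local Open Scope ereal_scope.

Theorem theorem1p4 (R : realType) (K : set (E3 R))
    (K_compact : compact K) (K_convex : convex_set K) :
  (4 * pi ^+ 2)%:E * lebesgue3 R K
    <= \int[lebesgue3 R]_(P in ~` K) sphere_area (solid_angle K P) ^+ 2
  /\
  (~ in_a_line K ->
    (\int[lebesgue3 R]_(P in ~` K) sphere_area (solid_angle K P) ^+ 2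
       = (4 * pi ^+ 2)%:E * lebesgue3 R K
     <-> is_ball K)).
Proof.
have vK := convex_set3 K_convex; have Vfin := volume_fin K_compact.
have cVfin : (4 * pi ^+ 2)%:E * lebesgue3 R K \is a fin_num by rewrite fin_numM.
have total := visual_angle_integral K_compact vK.
have e8 : (8 * pi ^+ 2)%:E * lebesgue3 R K =
    (4 * pi ^+ 2)%:E * lebesgue3 R K + (4 * pi ^+ 2)%:E * lebesgue3 R K.
  by rewrite -muleDl// -EFinD; congr (_%:E * _); ring.
split=> [|nline].
  have := volume_le_line_measure K_compact vK; rewrite -total e8.
  by rewrite leeD2rE.
split=> [E|].
  apply: ae_round_ball => //; apply: ae_round_section => //.
  by rewrite -total E e8.
move=> /is_ballE[c [w KE]].
have := ball_line_measure K_compact KE; rewrite -total e8.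
by move=> /(congr1 (fun x => x - (4 * pi ^+ 2)%:E * lebesgue3 R K)); rewrite !addeK.
Qed.
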